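(* Let $1\le p\le\infty$, $1/p+1/q=1$, $s\in\mathbb{N}$, $\delta\in(0,1/2)$. For every $j\in\mathbb{N}$ let $\widetilde\varphi_j\in\mathcal{D}'$ and $\varphi_j\in\mathcal{T}_{M^j}$ be such that $$\widehat{\varphi_j}(k)\,\widehat{\widetilde\varphi_j}(k)=1+\sum_{[\beta]=s}(M^{-j}k)^\beta\,\Gamma_{j,s}(k)\quad\text{for all } k\in D(\delta M^j),$$ where $$\sup_j\big\|\{\Gamma_{j,s}(k)v_\delta(M^{-j}k)\}_k\big\|_{\mathcal{M}_p}<\infty.$$ Then, for any $j\in\mathbb{N}$ and any $f\in B_{\widetilde\varphi_j,p}$, $$\|f-Q_j(f,\varphi_j,\widetilde\varphi_j)\|_p\le C\Big(\Omega_s(f,M^{-j})_p+K_{\varphi_j,q}\,\widetilde E_{\frac\delta2M^j}(\widetilde\varphi_j*f)_p\Big).$$ If, additionally, $\widetilde\varphi_j\in L_q$, then for any $f\in L_p$, $$\|f-Q_j(f,\varphi_j,\widetilde\varphi_j)\|_p\le C\big(1+K_{\varphi_j,q}\|\widetilde\varphi_j\|_{\mathcal{L}_{q,j}}\big)\Omega_s(f,M^{-j})_p.$$ Here the constant $C>0$ does not depend on $f$ and $j$.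
   Context: $\mathbb{T}^d=\mathbb{R}^d/\mathbb{Z}^d$, identified with $[-1/2,1/2)^d$ where needed. For $\beta\in\mathbb{Z}_+^d$ (vectors with nonnegative integer entries), $[\beta]=\sum_i\beta_i$, and sums over $[\beta]=s$ run over $\beta\in\mathbb{Z}_+^d$. $L_p=L_p(\mathbb{T}^d)$ with norm $\|\cdot\|_p$; for $p=\infty$ the space of approximated functions $L_\infty$ is replaced by $C(\mathbb{T}^d)$. $B$ is the space of bounded measurable functions on $\mathbb{T}^d$. $\widehat f(k)=\int_{\mathbb{T}^d}f(x)e^{-2\pi i(k,x)}dx$. $\mathcal{D}'$ is the space of periodic distributions (continuous linear functionals on $C^\infty(\mathbb{T}^d)$), with Fourier coefficients $\widehat{\widetilde\varphi}(k)=\langle e^{-2\pi i(k,\cdot)},\widetilde\varphi\rangle$. $M=\mathrm{diag}(m_1,\dots,m_d)$ is a fixed diagonal matrix with integers $m_i$, $|m_i|>1$, and $m=|\det M|$. For a real diagonal matrix $A$ (such as $M^j$ or $\delta M^j$): $D(A)=(A[-1/2,1/2)^d)\cap\mathbb{Z}^d$; $\mathcal{T}_A$ is the set of trigonometric polynomials with frequencies in $D(A)$; for $g\in B$, $\widetilde E_A(g)_p=\inf\{\|t-T\|_p: t,T\in\mathcal{T}_A,\ t(x)\le g(x)\le T(x)\ \forall x\in\mathbb{T}^d\}$ (inequalities between real-valued functions). For $\widetilde\varphi\in\mathcal{D}'$, $B_{\widetilde\varphi,p}$ is the class of $f\in L_p$ such that $\sum_{\ell\in\mathbb{Z}^d}\widehat{\widetilde\varphi}(\ell)\widehat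 f(\ell)e^{2\pi i(\ell,x)}$ is the Fourier series of a bounded function, which is denoted $\widetilde\varphi*f$. If $\widetilde\varphi\in L_q$, $1/p+1/q=1$, then $B_{\widetilde\varphi,p}=L_p$. The quasi-interpolation operator is $$Q_j(f,\varphi_j,\widetilde\varphi_j)(x)=\frac1{m^j}\sum_{k\in D(M^j)}(\widetilde\varphi_j*f)(M^{-j}k)\,\varphi_j(x-M^{-j}k).$$ For a trigonometric polynomial $\varphi$, $K_{\varphi,q}=\sup_{\|f\|_q\le1}\|\varphi*f\|_q$ (convolution on $\mathbb{T}^d$). For $\widetilde\varphi_j\in L_q$, $$\|\widetilde\varphi_j\|_{\mathcal{L}_{q,j}}=\Big(m^j\int_{M^{-j}\mathbb{T}^d}\Big(\frac1{m^j}\sum_{k\in D(M^j)}|\widetilde\varphi_j(x-M^{-j}k)|\Big)^q dx\Big)^{1/q}\ (1\le q<\infty),$$ $$\|\widetilde\varphi_j\|_{\mathcal{L}_{\infty,j}}=\frac1{m^j}\sup_{x\in\mathbb{R}^d}\sum_{k\in D(M^j)}|\widetilde\varphi_j(x-M^{-j}k)|,$$ with $M^{-j}\mathbb{T}^d=M^{-j}[-1/2,1/2)^d$. In the hypothesis $\widetilde\varphi_j\in L_q$ with $q=\infty$, $L_\infty$ is the usual space of essentially bounded functions. Modulus of smoothness: $\Omega_s(f,M^{-j})_p=\sup\{\|\Delta_h^sf\|_p: h\in\mathbb{R}^d,\ |M^jh|<1\}$, where $\Delta_h^sf(x)=\sum_{\nu=0}^s(-1)^\nu\binom s\nu f(x+\nu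 h)$ and $|\cdot|$ is the Euclidean norm. Fourier multipliers: a sequence $\Lambda=\{\lambda_k\}_{k\in\mathbb{Z}^d}$ is a Fourier multiplier in $L_p$ if for every $f\in L_p$ the series $\sum_k\lambda_k\widehat f(k)e^{2\pi i(k,x)}$ is the Fourier series of some $\Lambda f\in L_p$; $\|\{\lambda_k\}_k\|_{\mathcal{M}_p}=\sup_{\|f\|_p\le1}\|\Lambda f\|_p$. The function $v\in C^\infty(\mathbb{R}^d)$ is fixed with $v(\xi)=1$ for $\xi\in[-1/4,1/4)^d$ and $v(\xi)=0$ for $\xi\notin[-3/8,3/8)^d$; $v_\delta(\xi)=v(\delta^{-1}\xi)$. *)

(* Defs.v *)
From HB Require Import structures.
From mathcomp Require Import all_boot all_order all_algebra.
From mathcomp Require Import all_classical all_reals all_analysis.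
From mathcomp Require Import complex.

Set Implicit Arguments.
Unset Strict Implicit.
Unset Printing Implicit Defensive.

Import Order.TTheory GRing.Theory Num.Theory.
Import numFieldNormedType.Exports.

Local Open Scope classical_set_scope.
Local Open Scope complex_scope.
Local Open Scope ring_scope.

Local Notation normc := ComplexField.Normc.normc.

(* The Borel sigma-algebra on column vectors, generated by the coordinates. *)
Section measurable_cV.
Context {R : realType} {n : nat}.

Let coords : 'I_n -> 'cV[R]_n -> R := fun i x => x i ord0.

Let cV_set0 : g_sigma_preimage coords set0.
Proof. exact: sigma_algebra0. Qed.

Let cV_setC A : g_sigma_preimage coords A -> g_sigma_preimage coords (~` A).
Proof. exact: sigma_algebraC. Qed.

Let cV_bigcup (F : (set 'cV[R]_n)^nat) :
  (forall i, g_sigma_preimage coords (F i)) ->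
  g_sigma_preimage coords (\bigcup_i (F i)).
Proof. exact: sigma_algebra_bigcup. Qed.

HB.instance Definition _ := @isMeasurable.Build default_measure_display
  'cV[R]_n (g_sigma_preimage coords) cV_set0 cV_setC cV_bigcup.

Lemma measurable_coord (i : 'I_n) :
  measurable_fun [set: 'cV[R]_n] (fun x : 'cV[R]_n => x i ord0).
Proof.
move=> _ Y mY; rewrite setTI; apply: sub_sigma_algebra => /=.
rewrite -bigcup_seq/=; exists i => /=; first by rewrite mem_index_enum.
by exists Y => //; rewrite setTI.
Qed.

Lemma measurable_fun_cV d (T : measurableType d) (f : T -> 'cV[R]_n) :
  (forall i, measurable_fun setT (fun t => f t i ord0)) ->
  measurable_fun setT f.
Proof.
move=> mf _ A mA.
have : (g_sigma_preimage (fun i => coords i \o f)) `<=` measurable.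
  apply: smallest_sub; first exact: sigma_algebra_measurable.
  rewrite -bigcup_seq; apply: bigcup_sub => i _ B [C mC <-].
  exact: mf.
by apply; rewrite g_sigma_preimage_comp; exists A.
Qed.

End measurable_cV.

(* Lebesgue measure on R^n, as the n-fold product of Lebesgue measure on R. *)
Section lebesgue_cV.
Context {R : realType}.

Definition snoc_cV n (x : 'cV[R]_n * measurableTypeR R) : 'cV[R]_n.+1 :=
  \col_i if unlift ord_max i is Some j then x.1 j ord0 else x.2.

Lemma measurable_snoc_cV n : measurable_fun setT (@snoc_cV n).
Proof.
apply: measurable_fun_cV => i; rewrite /snoc_cV.
case: (unliftP ord_max i) => [j ->|->].
  under eq_fun do rewrite mxE liftK.
  exact: (measurableT_comp (measurable_coord j)).
under eq_fun do rewrite mxE unlift_none.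
exact: measurable_snd.
Qed.

(* The measure structure on the pushforward takes the measurability proof as an
   argument, which unification cannot find; hence the explicit name. *)
Definition snoc_measure n (mu : {measure set 'cV[R]_n -> \bar R}) :
    {measure set 'cV[R]_n.+1 -> \bar R} :=
  measure_function_pushforward__canonical__measure_function_Measure
    (mu \x @lebesgue_measure R)%E (@measurable_snoc_cV n).

Fixpoint lebesgue_cV_rec n : {measure set 'cV[R]_n -> \bar R} :=
  if n is n'.+1 return {measure set 'cV[R]_n -> \bar R}
  then snoc_measure (lebesgue_cV_rec n') else dirac (0 : 'cV[R]_0).

Definition lebesgue_cV n : set 'cV[R]_n -> \bar R := lebesgue_cV_rec n.
HB.instance Definition _ n := Measure.on (@lebesgue_cV n).

End lebesgue_cV.
Arguments lebesgue_cV R n : clear implicits.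

(* Functions on T^d are 1-periodic functions on R^d; T^d is integrated over
   through its fundamental domain [-1/2, 1/2)^d. *)
Section torus.
Context {R : realType} {d : nat}.
Local Notation Rd := 'cV[R]_d.
Local Notation Zd := 'cV[int]_d.
Local Notation C := R[i].
Implicit Types (f g h psi phi : Rd -> C) (k : Zd) (x y : Rd).

Definition int_vec k : Rd := map_mx intr k.

Definition cube : set Rd :=
  [set x | forall i, - 2^-1 <= x i ord0 < 2^-1].

Lemma measurable_cube : measurable cube.
Proof.
rewrite (_ : cube = \bigcap_(i : 'I_d)
    ((fun x => x i ord0) @^-1` [set` `[- 2^-1, 2^-1[%R])); last first.
  apply/seteqP; split=> [x cx i _|x cx i] /=; first by rewrite in_itv/= cx.
  by have := cx i Logic.I; rewrite /= in_itv.
apply: fin_bigcap_measurable => // i _; rewrite -[X in measurable X]setTI.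
by apply: measurable_coord => //; exact: measurable_itv.
Qed.

Definition torus : set Rd -> \bar R :=
  mrestr (lebesgue_cV R d) measurable_cube.
HB.instance Definition _ := Measure.on torus.

Definition periodic f := forall k x, f (x + int_vec k) = f x.

Definition Cmeasurable f :=
  measurable_fun setT (fun x => complex.Re (f x)) /\
  measurable_fun setT (fun x => complex.Im (f x)).

Definition Ccontinuous f :=
  continuous (fun x => complex.Re (f x)) /\
  continuous (fun x => complex.Im (f x)).

Definition Cint f : C :=
  (\int[torus]_x complex.Re (f x))%R +i*
  (\int[torus]_x complex.Im (f x))%R.

Definition lpnorm (p : \bar R) f : \bar R :=
  Lnorm torus p (fun x => (normc (f x))%:E).

Definition Lp (p : \bar R) f :=
  [/\ periodic f, Cmeasurable f & (lpnorm p f < +oo)%E].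

(* The space of approximated functions: L_p, and C(T^d) when p = oo. *)
Definition Xp (p : \bar R) f :=
  if p == +oo%E then periodic f /\ Ccontinuous f else Lp p f.

(* The space B of bounded measurable functions. *)
Definition bounded_measurable f :=
  [/\ periodic f, Cmeasurable f & exists K, forall x, normc (f x) <= K].

(* e^{2 pi i (k,x)} *)
Definition expk k x : C :=
  let t := 2 * pi * \sum_i (k i ord0)%:~R * x i ord0 in cos t +i* sin t.

Definition fcoef f k : C := Cint (fun x => f x * expk (- k) x).

Definition tconv phi f : Rd -> C :=
  fun x => Cint (fun y => phi (x - y) * f y).

(* Smooth functions: all iterated partial derivatives exist and are
   continuous. *)
Definition Cderivable f :=
  forall i x, derivable (fun y => complex.Re (f y)) x (delta_mx i ord0) /\
              derivable (fun y => complex.Im (f y)) x (delta_mx i ord0).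

Definition pderiv (i : 'I_d) f : Rd -> C :=
  fun x => 'D_(delta_mx i ord0) (fun y => complex.Re (f y)) x +i*
           'D_(delta_mx i ord0) (fun y => complex.Im (f y)) x.

Definition pderivs (a : seq 'I_d) f : Rd -> C := foldr pderiv f a.

Definition smooth f :=
  forall a, Ccontinuous (pderivs a f) /\ Cderivable (pderivs a f).

Definition test_function f := periodic f /\ smooth f.

(* Periodic distributions: linear functionals on C^oo(T^d), continuous for the
   topology of uniform convergence of all derivatives. Values outside
   C^oo(T^d) are irrelevant. *)
Definition distribution_linear (u : (Rd -> C) -> C) :=
  forall (a : C) f g, test_function f -> test_function g ->
    u (fun x => a * f x + g x) = a * u f + u g.

Definition distribution_continuous (u : (Rd -> C) -> C) :=
  forall f, test_function f -> forall e : R, 0 < e ->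
    exists N : nat, exists2 eta : R, 0 < eta &
      forall g, test_function g ->
        (forall a : seq 'I_d, (size a <= N)%N ->
           forall x, normc (pderivs a g x - pderivs a f x) < eta) ->
        normc (u g - u f) < e.

Definition periodic_distribution u :=
  distribution_linear u /\ distribution_continuous u.

Definition dcoef (u : (Rd -> C) -> C) k : C := u (expk (- k)).

(* The distribution u is (integration against) the function psi. *)
Definition represents psi (u : (Rd -> C) -> C) :=
  forall h, test_function h -> u h = Cint (fun x => h x * psi x).

(* g is a bounded function whose Fourier series is that of u * f. *)
Definition is_dconv (u : (Rd -> C) -> C) f g :=
  bounded_measurable g /\ forall k, fcoef g k = dcoef u k * fcoef f k.

(* D(A) = (A [-1/2,1/2)^d) \cap Z^d *)
Definition freq (A : 'M[R]_d) : set Zd :=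
  [set k | exists2 u, cube u & int_vec k = A *m u].

Definition trig_poly (A : 'M[R]_d) : set (Rd -> C) :=
  [set t | exists c : Zd -> C,
     t = (fun x => \sum_(k \in freq A) c k * expk k x)].

(* In the order of R[i], z <= w means that w - z is a nonnegative real; so t
   being real-valued forces g and T to be real-valued as well, and the infimum
   is +oo when g is not real-valued. *)
Definition one_sided_error (A : 'M[R]_d) (p : \bar R) g : \bar R :=
  ereal_inf [set e | exists t T : Rd -> C,
    [/\ trig_poly A t, trig_poly A T, forall x, t x \is Num.real,
        forall x, t x <= g x <= T x &
        e = lpnorm p (fun x => t x - T x)]].

Definition conv_norm (q : \bar R) phi : \bar R :=
  ereal_sup [set lpnorm q (tconv phi f) |
    f in [set f | Lp q f /\ (lpnorm q f <= 1)%E]].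

Definition enorm x : R := Num.sqrt (\sum_i x i ord0 ^+ 2).

Definition fdiff (s : nat) (h : Rd) f : Rd -> C :=
  fun x => \sum_(nu < s.+1) (-1) ^+ nu * 'C(s, nu)%:R * f (x + h *+ nu).

(* Omega_s(f, A^{-1})_p *)
Definition modulus (s : nat) f (A : 'M[R]_d) (p : \bar R) : \bar R :=
  ereal_sup [set lpnorm p (fdiff s h f) | h in [set h | enorm (A *m h) < 1]].

Definition multiplies (lam : Zd -> C) f g :=
  forall k, fcoef g k = lam k * fcoef f k.

Definition multiplier (p : \bar R) (lam : Zd -> C) :=
  forall f, Lp p f -> exists2 g, Lp p g & multiplies lam f g.

Definition multiplier_norm (p : \bar R) (lam : Zd -> C) : \bar R :=
  ereal_sup [set e | exists f g,
    [/\ Lp p f, (lpnorm p f <= 1)%E, Lp p g, multiplies lam f g &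
        e = lpnorm p g]].

(* The diagonal matrix M, from the vector of its diagonal entries. *)
Definition dilation (mu : 'rV[int]_d) : 'M[R]_d := diag_mx (map_mx intr mu).

Section quasi_interpolation.
Variables (M : 'M[R]_d) (j : nat).
Let m := `|\det M|.

(* M^{-j} k *)
Definition node k : Rd := invmx (M ^+ j) *m int_vec k.

(* Q_j(f, phi_j, tphi_j), where g stands for tphi_j * f. *)
Definition quasi_interp g phi : Rd -> C :=
  fun x => (m ^- j)%:C *
    \sum_(k \in freq (M ^+ j)) g (node k) * phi (x - node k).

Let node_sum psi x : R :=
  \sum_(k \in freq (M ^+ j)) normc (psi (x - node k)).

Definition Lqj_norm (q : \bar R) psi : \bar R :=
  match q with
  | r%:E => ((m ^+ j)%:E *
      \int[lebesgue_cV R d]_(x in [set invmx (M ^+ j) *m y | y in cube])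
        ((m ^- j * node_sum psi x) `^ r)%:E) `^ r^-1
  | +oo => (m ^- j)%:E * ereal_sup [set (node_sum psi x)%:E | x in setT]
  | -oo => 0
  end%E.

(* \sum_([beta] = s) (M^{-j} k)^beta; the entries of beta are at most s. *)
Definition power_sum (s : nat) k : R :=
  \sum_(b : {ffun 'I_d -> 'I_s.+1} | (\sum_i b i)%N == s)
    \prod_i node k i ord0 ^+ b i.

End quasi_interpolation.

End torus.

(* Main.v *)
(* Write A = M^j = diag(a_i) and let V be the Fourier multiplier with symbol
   v(A^-1 k / delta), that is, convolution with the kernel
   sum_k v(A^-1 k / delta) e_k. Summation by parts bounds such kernels by
   C prod_i |a_i| (1 + a_i^2 (2 - 2 cos (2 pi y_i)))^-N, and this weight has
   moments int |A y|^s bounded uniformly in j. Integrating s-th differences of f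
   against kernels of this kind gives two things: ||f - V f||_p <= C Omega_s, and,
   since the sum P of the monomials of degree s is homogeneous of degree s and
   sum_nu (-1)^nu C(s, nu) nu^s = (-1)^s s!, a function F with ||F||_p <= C Omega_s
   and Fourier coefficients P(A^-1 k) f^(k) on the support of v(A^-1 k / delta).

   Put g = tphi_j * f and let V g be the trigonometric polynomial with symbol
   v(A^-1 k / delta). On such polynomials Q_j acts as the multiplier phi_j^, so the
   hypothesis on phi_j^ tphi_j^ gives
     f - Q_j g = (f - V f) - R - Q_j (g - V g),
   where R is obtained from F by the multiplier Gamma_j v and a smooth cutoff.
   Duality and a Marcinkiewicz-Zygmund inequality bound ||Q_j r||_p by
   C K_{phi_j,q} times the normalised l_p norm of r at the nodes. For t <= g <= T
   one has g - V g = (g - t) - V (g - t) with |g - t| <= T - t; for tphi_j in L_q,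
   g - V g = tphi_j * (f - V f) at the nodes and a discrete Young inequality
   applies. *)
Require Import Defs.
From HB Require Import structures.
From mathcomp Require Import all_boot all_order all_algebra.
From mathcomp Require Import finmap.
From mathcomp Require Import all_classical all_reals all_analysis.
From mathcomp Require Import measurable_realfun ess_sup_inf complex ring lra zify.

Set Implicit Arguments.
Unset Strict Implicit.
Unset Printing Implicit Defensive.

Import Order.TTheory GRing.Theory Num.Theory.
Import numFieldNormedType.Exports.

Local Open Scope classical_set_scope.
Local Open Scope complex_scope.
Local Open Scope ring_scope.

Local Notation normc := ComplexField.Normc.normc.

(** * Lebesgue measure on R^n and translation invariance on the torus *)

(** All constants must be uniform in j and hold for every p in [1, oo], so multipliers are
    controlled through L_1 bounds on their kernels; hence the smooth cutoff [v] instead of a sharp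
    truncation to D(A). Cutoffs at different scales fit together because [v] lives in |x_i| <= 3/8
    and equals 1 for |x_i| < 1/4: doubling the scale makes one cutoff equal to 1 on the support of
    the other. The obstacle is sampling, since an L_p norm says nothing about values at the nodes.
    Node values are therefore estimated only for band-limited functions, for functions dominated
    pointwise by a band-limited one (the role of one-sided approximation), and for convolutions with
    tphi_j in L_q, where averaging over the nodes is built into the norm of tphi_j. Since only
    Gamma_j v is known to be a multiplier, it is applied to a function F in L_p that has the right
    coefficients where the cutoff lives; a second cutoff turns the result into a finite sum that can
    be read off from coefficients. Complex integrals are bounded through real and imaginary parts,
    at the price of a factor 2. *)

Section one_dim.
Context {R : realType}.
Local Notation leb := (@lebesgue_measure R).
Local Notation I1 := (`[- 2^-1, 2^-1[%classic : set R).
Implicit Types (F : R -> \bar R) (a b h : R).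

Lemma measurable_affine a b :
  measurable_fun setT (fun t => a * t + b : measurableTypeR R).
Proof. by apply: measurable_funD. Qed.

(** Both sides are measures in [A] that agree on half-open intervals, so uniqueness of Lebesgue
    measure applies. A negative [a] moves the closed end of the interval to the other side, which
    does not change its length. *)
Lemma lebesgue_measure_affine a b (A : set R) : a != 0 -> measurable A ->
  (`|a|%:E * leb ((fun t => (a * t + b)%R) @^-1` A) = leb A)%E.
Proof.
move=> a0 mA.
pose m1 : {measure set (measurableTypeR R) -> \bar R} :=
  measure_function_pushforward__canonical__measure_function_Measure
    leb (measurable_affine a b).
pose k : {nonneg R} := NngNum (normr_ge0 a).
pose m2 : {measure set (measurableTypeR R) -> \bar R} := mscale k m1.
suff -> : leb A = m2 A by [].
apply: lebesgue_measure_unique => //= _ [[x y]] _ <-.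
change (leb `]x, y]%classic =
  (`|a|%:E * leb ((fun t => (a * t + b)%R) @^-1` `]x, y]%classic))%E).
have [ap|an|/eqP] := ltgtP a 0; last by rewrite (negbTE a0).
- have -> : (fun t => a * t + b) @^-1` `]x, y] =
      `[(y - b) / a, (x - b) / a[%classic.
    apply/seteqP; split => t /=; rewrite !in_itv/= ler_ndivrMr// ltr_ndivlMr//;
    by rewrite [t * a]mulrC lerBrDr ltrBlDr andbC.
  rewrite !lebesgue_measure_itv/= !lte_fin ltr_ndivrMr// divfK// ltrD2r.
  case: ifPn => _; rewrite ?mule0//.
  by rewrite -EFinB -EFinM ltr0_norm//; congr _%:E; field.
- have -> : (fun t => a * t + b) @^-1` `]x, y] =
      `](x - b) / a, (y - b) / a]%classic.
    apply/seteqP; split => t /=; rewrite !in_itv/= ler_pdivlMr// ltr_pdivrMr//;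
    by rewrite [t * a]mulrC lerBrDr ltrBlDr.
  rewrite !lebesgue_measure_itv/= !lte_fin ltr_pdivrMr// divfK// ltrD2r.
  case: ifPn => _; rewrite ?mule0//.
  by rewrite -EFinB -EFinM gtr0_norm//; congr _%:E; field.
Qed.

Lemma ge0_integral_affine a b (D : set R) F : a != 0 ->
  measurable D -> measurable_fun setT F -> (forall t, 0 <= F t)%E ->
  (`|a|%:E * \int[leb]_(t in (fun t => (a * t + b)%R) @^-1` D) F (a * t + b)%R
     = \int[leb]_(t in D) F t)%E.
Proof.
move=> a0 mD mF F0.
pose m1 : {measure set (measurableTypeR R) -> \bar R} :=
  measure_function_pushforward__canonical__measure_function_Measure
    leb (measurable_affine a b).
have mFD : measurable_fun D F by exact: measurable_funTS.
rewrite -[X in (_ * X)%E](@ge0_integral_pushforward _ _ (measurableTypeR R)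
  (measurableTypeR R) R _ (measurable_affine a b) leb D F) //.
rewrite -(@ge0_integral_mscale _ (measurableTypeR R) _ m1 D mD
  (NngNum (normr_ge0 a)))//.
apply: eq_measure_integral => A mA _.
by rewrite /mscale/= /pushforward -(lebesgue_measure_affine b a0 mA).
Qed.

(** Only the fractional part [u] of [h] matters. The translated window is cut at 1/2 and the
    overhang is moved back by one period. *)
Lemma ge0_integral_period1 h F : measurable_fun setT F ->
  (forall t, 0 <= F t)%E -> (forall t (k : int), F (t + k%:~R) = F t) ->
  (\int[leb]_(t in I1) F (t + h)%R = \int[leb]_(t in I1) F t)%E.
Proof.
move=> mF F0 FZ.
pose u := h - (Num.floor h)%:~R.
have u01 : 0 <= u < 1.
  by rewrite /u subr_ge0 ltrBlDl -[X in _ < _ + X]/(1%:~R) -intrD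
     floor_le_tmp floorD1_gt.
have -> : (fun t => F (t + h)) = (fun t => F (t + u)).
  by apply/funext => t; rewrite -(FZ (t + u) (Num.floor h)) /u -addrA subrK.
case/andP: u01 => u0 u1.
have shift c (D : set R) : measurable D ->
    (\int[leb]_(t in (fun t => (1 * t + c)%R) @^-1` D) F (1 * t + c)%R
     = \int[leb]_(t in D) F t)%E.
  move=> mD; rewrite -(@ge0_integral_affine 1 c D F)// normr1 mul1e.
  by apply: eq_integral.
have := shift u `[- 2^-1 + u, 2^-1 + u[%classic (measurable_itv _).
have -> : (fun t => 1 * t + u) @^-1` `[- 2^-1 + u, 2^-1 + u[%classic =
    `[- 2^-1, 2^-1[%classic.
  by apply/seteqP; split => t /=; rewrite !in_itv/= mul1r lerD2r ltrD2r.
under eq_integral do rewrite mul1r.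
move=> ->.
have itvU (x y z : R) : x <= y <= z ->
    `[x, z[%classic = `[x, y[%classic `|` `[y, z[%classic.
  move=> /andP[xy yz]; apply/seteqP; split => t /=; rewrite !in_itv/=.
    by case: (ltP t y) => ty /andP[xt tz]; [left|right]; rewrite ?xt ?tz.
  by move=> [|] /andP[? ?]; apply/andP; split; lra.
have E1 : `[- 2^-1 + u, 2^-1 + u[%classic =
    `[- 2^-1 + u, 2^-1[%classic `|` `[2^-1, 2^-1 + u[%classic :> set R.
  by rewrite -itvU//; lra.
have E2 : `[- 2^-1, 2^-1[%classic =
    `[- 2^-1, - 2^-1 + u[%classic `|` `[- 2^-1 + u, 2^-1[%classic :> set R.
  by rewrite -itvU//; lra.
rewrite E1 E2 !ge0_integral_setU//; last 4 first.
- exact: measurable_funTS.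
- by apply/disj_setPS => t /= []; rewrite !in_itv/= => /andP[? ?] /andP[? ?]; lra.
- exact: measurable_funTS.
- by apply/disj_setPS => t /= []; rewrite !in_itv/= => /andP[? ?] /andP[? ?]; lra.
rewrite addeC; congr (_ + _)%E.
rewrite -(shift 1 `[2^-1, 2^-1 + u[%classic (measurable_itv _)).
have -> : (fun t => 1 * t + 1) @^-1` `[2^-1, 2^-1 + u[%classic =
    `[- 2^-1, - 2^-1 + u[%classic.
  by apply/seteqP; split => t /=; rewrite !in_itv/= => /andP[? ?]; lra.
by apply: eq_integral => t _; rewrite mul1r -[X in _ + X]/(1%:~R) FZ.
Qed.

End one_dim.

Section lebesgue_cV_theory.
Context {R : realType}.
Local Notation leb := (@lebesgue_measure R).

Definition box n (J : 'I_n -> set R) : set 'cV[R]_n :=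
  [set x | forall i, J i (x i ord0)].

Lemma measurable_box n (J : 'I_n -> set R) :
  (forall i, measurable (J i)) -> measurable (box J).
Proof.
move=> mJ; rewrite (_ : box J = \bigcap_(i : 'I_n)
    ((fun x => x i ord0) @^-1` J i)); last first.
  by apply/seteqP; split=> [x cx i _|x cx i] /=; [exact: cx|exact: cx].
apply: fin_bigcap_measurable => // i _; rewrite -[X in measurable X]setTI.
exact: measurable_coord.
Qed.

Lemma snoc_cV_lift n (x : 'cV[R]_n) (t : R) (i : 'I_n) :
  snoc_cV (x, t : measurableTypeR R) (lift ord_max i) ord0 = x i ord0.
Proof. by rewrite mxE liftK. Qed.

Lemma snoc_cV_max n (x : 'cV[R]_n) (t : R) :
  snoc_cV (x, t : measurableTypeR R) ord_max ord0 = t.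
Proof. by rewrite mxE unlift_none. Qed.

Lemma snoc_cV_preimage_box n (J : 'I_n.+1 -> set R) :
  @snoc_cV R n @^-1` box J =
  (box (fun i => J (lift ord_max i)) `*` (J ord_max : set (measurableTypeR R))).
Proof.
apply/seteqP; split => [[x t]|[x t]] /=.
  move=> h; split => [i|].
    by have := h (lift ord_max i); rewrite snoc_cV_lift.
  by have := h ord_max; rewrite snoc_cV_max.
move=> [h1 h2] i; case: (unliftP ord_max i) => [j ->|->].
  by rewrite snoc_cV_lift; exact: h1.
by rewrite snoc_cV_max.
Qed.

Lemma lebesgue_cV_boxS n (J : 'I_n.+1 -> set R) :
  (forall i, measurable (J i)) ->
  (lebesgue_cV R n.+1 (box J) =
   lebesgue_cV R n (box (fun i => J (lift ord_max i))) * leb (J ord_max))%E.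
Proof.
move=> mJ.
have mB : measurable (box (fun i => J (lift ord_max i))) by exact: measurable_box.
rewrite -(@product_measure1E _ _ _ (measurableTypeR R) R (lebesgue_cV R n) leb _ _
  mB (mJ ord_max)).
by rewrite -snoc_cV_preimage_box.
Qed.

Lemma lebesgue_cV_box_fin n (J : 'I_n -> set R) :
  (forall i, measurable (J i)) -> (forall i, leb (J i) < +oo)%E ->
  (lebesgue_cV R n (box J) < +oo)%E.
Proof.
elim: n J => [J mJ _|n IH J mJ fJ].
  rewrite (_ : box J = setT) /lebesgue_cV/=; last by apply/seteqP; split => // x _ [].
  by rewrite diracT ltry.
rewrite lebesgue_cV_boxS//; apply: lte_mul_pinfty => //.
by rewrite ge0_fin_numE// IH.
Qed.

Lemma lebesgue_cV_sigma_finite n : sigma_finite setT (lebesgue_cV R n).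
Proof.
exists (fun k : nat => box (fun _ : 'I_n => `[- k%:R, k%:R]%classic : set R)).
  apply/seteqP; split => // x _.
  have [k _ xk] : exists2 k : nat, True & forall i, `|x i ord0| <= k%:R.
    exists (\sum_i (Num.trunc `|x i ord0|).+1)%N => // i.
    have := truncnS_gt `|x i ord0|; move/ltW/le_trans; apply.
    by rewrite ler_nat (bigD1 i)//= leq_addr.
  by exists k => // i /=; rewrite in_itv/= -ler_norml.
move=> k; split; first by apply: measurable_box => i; exact: measurable_itv.
apply: lebesgue_cV_box_fin => i; first exact: measurable_itv.
by rewrite lebesgue_measure_itv/=; case: ifPn => _; rewrite -?EFinB ltry.
Qed.

HB.instance Definition _ n := @Measure_isSigmaFinite.Build _ _ _ (lebesgue_cV R n)
  (lebesgue_cV_sigma_finite n).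

End lebesgue_cV_theory.

Section torus_measure.
Context {R : realType}.
Local Notation leb := (@lebesgue_measure R).
Local Notation I1 := (`[- 2^-1, 2^-1[%classic : set R).

Lemma cube_box n : @cube R n = box (fun _ => I1).
Proof. by apply/seteqP; split => x /= cx i; have := cx i; rewrite /= in_itv. Qed.

Lemma lebesgue_cV_cube n : lebesgue_cV R n cube = 1%E.
Proof.
rewrite cube_box; elim: n => [|n IH].
  rewrite (_ : box _ = setT) /lebesgue_cV/=; last by apply/seteqP; split => // x _ [].
  by rewrite diracT.
rewrite lebesgue_cV_boxS// IH mul1e lebesgue_measure_itv/= lte_fin.
by rewrite ifT; [rewrite -EFinB opprK; congr _%:E; lra|lra].
Qed.

Lemma torusT n : torus [set: 'cV[R]_n] = 1%E.
Proof. by rewrite /torus/= /mrestr setTI lebesgue_cV_cube. Qed.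

Lemma torus_fin_num n : fin_num_fun (@torus R n).
Proof.
move=> A mA; rewrite ge0_fin_numE//.
rewrite (@le_lt_trans _ _ 1%E) ?ltry// -(torusT n).
by apply: le_measure => //; rewrite inE.
Qed.

HB.instance Definition _ n := @Measure_isFinite.Build _ _ _ (@torus R n)
  (@torus_fin_num n).

Lemma ge0_integral_torus n (F : 'cV[R]_n -> \bar R) : measurable_fun setT F ->
  (forall x, 0 <= F x)%E ->
  (\int[torus]_x F x = \int[lebesgue_cV R n]_(x in cube) F x)%E.
Proof.
move=> mF F0.
have mC := @measurable_cube R n.
rewrite (@ge0_negligible_integral _ _ _ torus setT (~` cube))//; last 2 first.
- exact: measurableC.
- by change (lebesgue_cV R n (~` cube `&` cube) = 0%E); rewrite setIC setICr measure0.
rewrite setDE setCK setTI; apply: eq_measure_integral => A mA AC.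
by change (lebesgue_cV R n (A `&` cube) = lebesgue_cV R n A); rewrite setIidl.
Qed.

Lemma ge0_integral_box n (J : 'I_n.+1 -> set R) (F : 'cV[R]_n.+1 -> \bar R) :
  (forall i, measurable (J i)) -> measurable_fun setT F -> (forall x, 0 <= F x)%E ->
  (\int[lebesgue_cV R n.+1]_(x in box J) F x =
   \int[lebesgue_cV R n]_(x in box (fun i => J (lift ord_max i)))
     \int[leb]_(t in J ord_max) F (snoc_cV (x, t)))%E.
Proof.
move=> mJ mF F0.
have mB : measurable (box (fun i => J (lift ord_max i))) by exact: measurable_box.
rewrite [LHS](@ge0_integral_pushforward _ _ _ _ R _ (@measurable_snoc_cV R n)
  (lebesgue_cV R n \x leb)%E (box J) F (measurable_box mJ))//; last first.
  exact: measurable_funTS.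
have mFs : measurable_fun setT (F \o @snoc_cV R n).
  exact: (measurableT_comp mF (@measurable_snoc_cV R n)).
rewrite snoc_cV_preimage_box integral_mkcond fubini_tonelli1.
- rewrite [RHS]integral_mkcond; apply: eq_integral => x _ /=.
  rewrite /fubini_F patchE; case: ifPn => xB.
    rewrite [RHS]integral_mkcond; apply: eq_integral => t _.
    by rewrite !patchE in_setX/= xB.
  by rewrite integral0_eq// => t _; rewrite patchE in_setX/= (negbTE xB).
- apply/(measurable_restrictT _ _).1.
    by apply: measurableX => //; exact: mJ.
  exact: measurable_funTS.
- by move=> z; rewrite patchE; case: ifPn => //= _; exact: F0.
Qed.

Lemma measurable_int_snoc n (J : set R) (F : 'cV[R]_n.+1 -> \bar R) :
  measurable J -> measurable_fun setT F -> (forall x, 0 <= F x)%E ->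
  measurable_fun setT (fun x => \int[leb]_(t in J) F (snoc_cV (x, t)))%E.
Proof.
move=> mJ mF F0.
pose G := (F \o @snoc_cV R n) \_ (setT `*` (J : set (measurableTypeR R))).
have mG : measurable_fun setT G.
  apply/(measurable_restrictT _ _).1; first by apply: measurableX => //; exact: mJ.
  apply: measurable_funTS.
  exact: (measurableT_comp mF (@measurable_snoc_cV R n)).
have G0 z : (0 <= G z)%E by rewrite /G patchE; case: ifPn => //= _; exact: F0.
have := measurable_fun_fubini_tonelli_F (m2 := leb) G mG G0.
congr (measurable_fun _ _); apply/funext => x.
rewrite /fubini_F [RHS]integral_mkcond; apply: eq_integral => t _.
by rewrite /G !patchE in_setX/= in_setT.
Qed.

Lemma ge0_integral_torusS n (F : 'cV[R]_n.+1 -> \bar R) :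
  measurable_fun setT F -> (forall x, 0 <= F x)%E ->
  (\int[torus]_x F x =
   \int[torus]_x \int[leb]_(t in I1) F (snoc_cV (x, t)))%E.
Proof.
move=> mF F0.
rewrite !ge0_integral_torus//.
- by rewrite cube_box ge0_integral_box// -cube_box.
- exact: measurable_int_snoc.
- by move=> x; exact: integral_ge0.
Qed.

Lemma ge0_integral_torus0 (F : 'cV[R]_0 -> \bar R) :
  measurable_fun setT F -> (forall x, 0 <= F x)%E ->
  (\int[torus]_x F x = F 0%R)%E.
Proof.
move=> mF F0; rewrite ge0_integral_torus// (_ : cube = setT); last first.
  by apply/seteqP; split => // x _ [].
by rewrite /lebesgue_cV/= integral_dirac// diracT mul1e.
Qed.

Lemma measurable_snoc_cVr n (x : 'cV[R]_n) :
  measurable_fun [set: R] (fun t : R => snoc_cV (x, t : measurableTypeR R)).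
Proof.
apply: measurable_fun_cV => i; case: (unliftP ord_max i) => [j ->|->].
  by under eq_fun do rewrite snoc_cV_lift; exact: measurable_cst.
by under eq_fun do rewrite snoc_cV_max; exact: measurable_id.
Qed.

Lemma snoc_cVD n (x h : 'cV[R]_n.+1) :
  x + h = snoc_cV (\col_i (x (lift ord_max i) ord0 + h (lift ord_max i) ord0),
                   x ord_max ord0 + h ord_max ord0).
Proof.
apply/colP => i; case: (unliftP ord_max i) => [j ->|->].
  by rewrite snoc_cV_lift !mxE.
by rewrite snoc_cV_max !mxE.
Qed.

Definition eperiodic n (F : 'cV[R]_n -> \bar R) :=
  forall x k, F (x + int_vec k) = F x.

Lemma measurable_funD_cV n (h : 'cV[R]_n) :
  measurable_fun setT (fun x : 'cV[R]_n => x + h).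
Proof.
apply: measurable_fun_cV => i; under eq_fun do rewrite mxE.
by apply: measurable_funD => //; exact: measurable_coord.
Qed.

(** Induction on the dimension: the one-dimensional invariance treats the last coordinate, and the
    inner integral is still a periodic function of the other coordinates. *)
Lemma ge0_integral_torusD n (h : 'cV[R]_n) (F : 'cV[R]_n -> \bar R) :
  measurable_fun setT F -> (forall x, 0 <= F x)%E -> eperiodic F ->
  (\int[torus]_x F (x + h)%R = \int[torus]_x F x)%E.
Proof.
elim: n h F => [h F mF F0 FZ|n IH h F mF F0 FZ].
  rewrite !ge0_integral_torus0//; last first.
    exact: (measurableT_comp mF (measurable_funD_cV h)).
  by congr F; apply/colP => -[].
rewrite (ge0_integral_torusS (measurableT_comp mF (measurable_funD_cV h)));
  last by move=> x /=; exact: F0.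
rewrite (ge0_integral_torusS mF F0).
pose h' : 'cV[R]_n := \col_i h (lift ord_max i) ord0.
rewrite -(IH h' (fun x => \int[leb]_(t in I1) F (snoc_cV (x, t)))%E).
- apply: eq_integral => x _.
  rewrite -(@ge0_integral_period1 _ (h ord_max ord0)
    (fun t => F (snoc_cV (x + h', t)))).
  + apply: eq_integral => t _; rewrite /= snoc_cVD; congr (F (snoc_cV (_, _))).
      by apply/colP => i; rewrite !mxE liftK.
    by rewrite snoc_cV_max.
  + exact: (measurableT_comp mF (measurable_snoc_cVr _)).
  + by move=> t.
  + move=> t k; rewrite -[RHS](FZ _ (\col_i if i == ord_max then k else 0)).
    rewrite snoc_cVD; congr (F (snoc_cV (_, _))).
      apply/colP => i; rewrite !mxE liftK eq_sym (negbTE (neq_lift _ _)).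
      by rewrite /= addr0 !mxE.
    by rewrite !snoc_cV_max !mxE eqxx.
- exact: measurable_int_snoc.
- by move=> x; exact: integral_ge0.
- move=> x k; apply: eq_integral => t _.
  rewrite -[in RHS](FZ _ (\col_i if unlift ord_max i is Some j then k j ord0 else 0)).
  rewrite snoc_cVD; congr (F (snoc_cV (_, _))).
    by apply/colP => i; rewrite !mxE !liftK.
  by rewrite snoc_cV_max !mxE unlift_none addr0.
Qed.

Lemma ge0_integral_dilate n (a : 'I_n -> R) (J : 'I_n -> set R)
    (F : 'cV[R]_n -> \bar R) :
  (forall i, a i != 0) -> (forall i, measurable (J i)) ->
  measurable_fun setT F -> (forall x, 0 <= F x)%E ->
  ((\prod_i `|a i|)%:E *
      \int[lebesgue_cV R n]_(x in box (fun i => (fun t => (a i * t)%R) @^-1` J i))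
        F (\col_i (a i * x i ord0)%R) =
   \int[lebesgue_cV R n]_(x in box J) F x)%E.
Proof.
have mdil m (b : 'I_m -> R) :
    measurable_fun setT (fun x : 'cV[R]_m => \col_i (b i * x i ord0)).
  apply: measurable_fun_cV => i; under eq_fun do rewrite mxE.
  by apply: measurable_funM => //; exact: measurable_coord.
have mpre (c : R) (K : set R) : measurable K ->
    measurable ((fun t : R => c * t) @^-1` K).
  move=> mK; rewrite -[X in measurable X]setTI.
  by apply: (measurable_funM (f := cst c) (g := id)).
elim: n a J F => [a J F _ _ mF F0|n IH a J F a0 mJ mF F0].
  rewrite big_ord0 mul1e (_ : box (fun i => _ @^-1` _) = setT); last first.
    by apply/seteqP; split => // x _ [].
  rewrite (_ : box J = setT); last by apply/seteqP; split => // x _ [].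
  by apply: eq_integral => x _; congr F; apply/colP => -[].
pose b i := a (lift ord_max i).
have mpreb (i : 'I_n) : measurable ((fun t => b i * t) @^-1` J (lift ord_max i)).
  exact: mpre.
have mG := measurable_int_snoc (mJ ord_max) mF F0.
have mFd := measurableT_comp mF (mdil _ a).
rewrite !ge0_integral_box//; last by move=> i; exact: mpre.
have G0 x : (0 <= \int[leb]_(t in J ord_max) F (snoc_cV (x, t)))%E.
  exact: integral_ge0.
rewrite -(IH b (fun i => J (lift ord_max i))
  (fun x => \int[leb]_(t in J ord_max) F (snoc_cV (x, t)))%E
  (fun i => a0 _) (fun i => mJ _) mG G0).
rewrite big_ord_recr/= (eq_bigr (fun i => `|b i|)); last first.
  move=> i _; rewrite /b (_ : widen_ord _ i = lift ord_max i)//.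
  by apply/val_inj; rewrite /= /bump leqNgt ltn_ord.
rewrite EFinM -muleA; congr (_ * _)%E.
rewrite -ge0_integralZl_EFin//.
- apply: eq_integral => x _.
  rewrite -(@ge0_integral_affine _ (a ord_max) 0 (J ord_max))//.
    under [in RHS]eq_fun do rewrite addr0.
    congr (_ * _)%E; apply: eq_integral => t _; congr F; apply/colP => i.
    rewrite mxE; case: (unliftP ord_max i) => [j ->|->].
      by rewrite !snoc_cV_lift mxE.
    by rewrite !snoc_cV_max addr0.
  exact: (measurableT_comp mF (measurable_snoc_cVr _)).
- exact: measurable_box.
- by move=> x _; exact: integral_ge0.
- apply: measurable_funTS.
  by apply: (measurable_int_snoc (mpre _ _ (mJ ord_max)) mFd) => x; exact: F0.
Qed.

End torus_measure.

Section torus_invariance.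
Context {R : realType} {n : nat}.
Local Notation Rn := 'cV[R]_n.
Implicit Types (F : Rn -> \bar R) (b : 'I_n -> int).

Definition scale_cV (a : 'I_n -> R) (x : Rn) : Rn := \col_i (a i * x i ord0).

Lemma measurable_scale_cV a : measurable_fun setT (scale_cV a).
Proof.
apply: measurable_fun_cV => i; under eq_fun do rewrite mxE.
by apply: measurable_funM => //; exact: measurable_coord.
Qed.

Lemma scale_cVD a x y : scale_cV a (x + y) = scale_cV a x + scale_cV a y.
Proof. by apply/colP => i; rewrite !mxE mulrDr. Qed.

Lemma scale_cVK a : (forall i, a i != 0) ->
  cancel (scale_cV (fun i => (a i)^-1)) (scale_cV a).
Proof. by move=> a0 x; apply/colP => i; rewrite !mxE mulVKf. Qed.

Lemma scale_cVVK a : (forall i, a i != 0) ->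
  cancel (scale_cV a) (scale_cV (fun i => (a i)^-1)).
Proof. by move=> a0 x; apply/colP => i; rewrite !mxE mulKf. Qed.

Lemma scale_int_vec b k :
  scale_cV (fun i => (b i)%:~R) (int_vec k) = int_vec (\col_i (b i * k i ord0)).
Proof. by apply/colP => i; rewrite !mxE intrM. Qed.

Lemma ge0_integral_torus_cst (c : \bar R) : (0 <= c)%E ->
  (\int[torus]_(x in [set: Rn]) c = c)%E.
Proof. by move=> c0; rewrite integral_cst//= torusT mule1. Qed.

(* Averaging over all translates reduces the dilation to translation invariance. *)
Lemma ge0_integral_torus_affine (x : Rn) b F : (forall i, b i != 0) ->
  measurable_fun setT F -> (forall y, 0 <= F y)%E -> eperiodic F ->
  (\int[torus]_y F (x + scale_cV (fun i => (b i)%:~R) y)%R = \int[torus]_y F y)%E.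
Proof.
move=> b0 mF F0 FZ; set a : 'I_n -> R := fun i => _.
have a0 i : a i != 0 by rewrite intr_eq0.
have mFx u : measurable_fun setT (fun y => F (u + scale_cV a y)).
  apply: (measurableT_comp mF); under eq_fun do rewrite addrC.
  exact: (measurableT_comp (measurable_funD_cV u) (measurable_scale_cV a)).
have step u : (\int[torus]_y F (u + (x + scale_cV a y))%R =
               \int[torus]_y F (x + scale_cV a y)%R)%E.
  rewrite -[RHS](@ge0_integral_torusD _ _ (scale_cV (fun i => (a i)^-1) u)
    (fun y => F (x + scale_cV a y))%R)//.
    apply: eq_integral => y _; rewrite scale_cVD scale_cVK//.
    by congr F; rewrite addrCA [u + _]addrC.
  by move=> y k; rewrite scale_cVD addrA scale_int_vec FZ.
rewrite -[LHS]ge0_integral_torus_cst; last exact: integral_ge0.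
under eq_integral => u _ do rewrite -(step u).
rewrite (fubini_tonelli (m1 := torus) (m2 := torus)
  (fun z => F (z.1 + (x + scale_cV a z.2))%R))//=; last first.
  apply: (measurableT_comp mF); apply: measurable_fun_cV => i.
  under eq_fun do rewrite !mxE.
  apply: measurable_funD; first exact: (measurableT_comp (measurable_coord i)).
  apply: measurable_funD => //; apply: measurable_funM => //.
  exact: (measurableT_comp (measurable_coord i)).
under eq_integral do rewrite ge0_integral_torusD//.
by rewrite ge0_integral_torus_cst// integral_ge0.
Qed.

Lemma ge0_integral_torusN (x : Rn) F :
  measurable_fun setT F -> (forall y, 0 <= F y)%E -> eperiodic F ->
  (\int[torus]_y F (x - y)%R = \int[torus]_y F y)%E.
Proof.
move=> mF F0 FZ.
rewrite -(@ge0_integral_torus_affine x (fun=> -1) F)//.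
by apply: eq_integral => y _; congr F; congr (x + _); apply/colP => i; rewrite !mxE mulN1r.
Qed.

(** An integer dilation preserves torus integrals, and a linear change of variables turns the
    dilated cube into one cell. This identifies the integral in [Lqj_norm] with an integral over the
    torus, and lets averages over a cell be computed as averages over the torus. *)
Lemma ge0_integral_cell b F : (forall i, b i != 0) ->
  measurable_fun setT F -> (forall y, 0 <= F y)%E ->
  (forall y k, F (y + scale_cV (fun i => (b i)%:~R^-1) (int_vec k))%R = F y) ->
  ((\prod_i `|(b i)%:~R|)%:E * \int[lebesgue_cV R n]_(x in
      [set scale_cV (fun i => (b i)%:~R^-1)%R y | y in cube]) F x =
   \int[torus]_y F y)%E.
Proof.
move=> b0 mF F0 FZ; set a : 'I_n -> R := fun i => (b i)%:~R.
have a0 i : a i != 0 by rewrite intr_eq0.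
have mG : measurable_fun setT (F \o scale_cV (fun i => (a i)^-1)).
  exact: (measurableT_comp mF (measurable_scale_cV _)).
transitivity (\int[torus]_y F (scale_cV (fun i => (a i)^-1)%R y))%E.
  rewrite ge0_integral_torus//.
  have := @ge0_integral_dilate R n a (fun=> `[- 2^-1, 2^-1[%classic) _ a0
    (fun i => measurable_itv _) mG (fun x => F0 _).
  rewrite -cube_box => <-; congr (_ * _)%E.
  rewrite (_ : [set _ | _ in _] =
    box (fun i => (fun t => a i * t) @^-1` `[- 2^-1, 2^-1[%classic)); last first.
    apply/seteqP; split => [_ [y cy <-] i|x bx] /=.
      by rewrite in_itv/= mxE mulVKf//; exact: cy.
    exists (scale_cV a x); last by rewrite scale_cVVK.
    by move=> i; have := bx i; rewrite /= in_itv/= mxE.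
  by apply: eq_integral => x _; rewrite /= (scale_cVVK a0 x).
rewrite -(@ge0_integral_torus_affine 0 b (F \o scale_cV (fun i => (a i)^-1)))//.
  by apply: eq_integral => y _; rewrite /= add0r scale_cVVK.
  by move=> y; exact: F0.
by move=> y k; rewrite /= scale_cVD FZ.
Qed.

End torus_invariance.

(** * Integrals of products and of the Cauchy kernel *)

Section weight.
Context {R : realType}.
Local Notation leb := (@lebesgue_measure R).
Local Notation I1 := (`[- 2^-1, 2^-1[%classic : set R).

Lemma ge0_integral_torus_prod n (w : 'I_n -> R -> R) (c : R) :
  (forall i, measurable_fun setT (w i)) -> (forall i t, 0 <= w i t) ->
  (forall i, \int[leb]_(t in I1) (w i t)%:E <= c%:E)%E ->
  (\int[torus]_x (\prod_i w i (x i ord0))%:E <= (c ^+ n)%:E)%E.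
Proof.
elim: n w => [w _ _ _|n IH w mw w0 wc].
  by under eq_integral do rewrite big_ord0; rewrite ge0_integral_torus_cst// lee01.
have c0 : 0 <= c.
  by rewrite -lee_fin; apply: le_trans (wc ord0); apply: integral_ge0 => t _;
     rewrite lee_fin.
have mprod m (u : 'I_m -> R -> R) : (forall i, measurable_fun setT (u i)) ->
    measurable_fun setT (fun x : 'cV[R]_m => \prod_i u i (x i ord0)).
  move=> mu; apply: measurable_prod => i _.
  exact: (measurableT_comp (mu i) (measurable_coord i)).
rewrite ge0_integral_torusS; last 2 first.
- by apply/measurable_EFinP; exact: mprod.
- by move=> x; rewrite lee_fin prodr_ge0.
pose w' i := w (lift ord_max i).
have w'0 (x : 'cV[R]_n) : (0 <= (\prod_i w' i (x i ord0))%:E)%E by rewrite lee_fin prodr_ge0// => i _; exact: w0.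
have mw' : measurable_fun setT (fun x : 'cV[R]_n => (\prod_i w' i (x i ord0))%:E).
  by apply/measurable_EFinP; apply: mprod => i; exact: mw.
apply: (@le_trans _ _ (\int[torus]_x (c%:E * (\prod_i w' i (x i ord0))%:E))%E).
  apply: ge0_le_integral => //.
  - by move=> x _; apply: integral_ge0 => t _; rewrite lee_fin prodr_ge0.
  - apply: (@measurable_int_snoc R n I1 (fun x => (\prod_i w i (x i ord0))%:E)) => //.
      by apply/measurable_EFinP; exact: mprod.
    by move=> x; rewrite lee_fin prodr_ge0.
  - exact: measurable_funeM.
  - move=> x _.
    have -> : (\int[leb]_(t in I1) (\prod_i w i (snoc_cV (x, t) i ord0))%:E =
        \int[leb]_(t in I1) ((\prod_i w' i (x i ord0))%:E * (w ord_max t)%:E))%E.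
      apply: eq_integral => t _.
      rewrite big_ord_recr/= snoc_cV_max EFinM; congr (_%:E * _)%E.
      apply: eq_bigr => i _; rewrite (_ : widen_ord _ i = lift ord_max i) ?snoc_cV_lift//.
      by apply/val_inj; rewrite /= /bump leqNgt ltn_ord.
    rewrite ge0_integralZl//=; last 2 first.
    + by apply/measurable_EFinP; exact: (measurable_funTS (mw ord_max)).
    + by move=> t _; rewrite lee_fin.
    by rewrite [leRHS]muleC; apply: lee_wpmul2l => //; exact: wc.
rewrite ge0_integralZl// exprS EFinM lee_pmul// ?lee_fin//; first exact: integral_ge0.
by apply: IH => // i; [exact: mw|exact: w0|exact: wc].
Qed.

(** The antiderivative is atan (a t), whose increments stay below pi whatever [a] is; all later
    uniformity in the dilation rests on this. *)
Lemma integral_cauchy_le (a : R) : 0 < a ->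
  (\int[leb]_(t in I1) (a / (1 + a ^+ 2 * t ^+ 2))%:E <= pi%:E)%E.
Proof.
move=> a0.
have cf : continuous (fun t : R => a / (1 + a ^+ 2 * t ^+ 2)).
  move=> t; apply: cvgM; first exact: cvg_cst.
  apply: cvgV; first by rewrite gt_eqF// ltr_pwDl// mulr_ge0// sqr_ge0.
  apply: cvgD; first exact: cvg_cst.
  by apply: cvgM; [exact: cvg_cst|exact: exprn_continuous].
have mf : measurable_fun I1 (fun t : R => (a / (1 + a ^+ 2 * t ^+ 2))%:E).
  apply/measurable_EFinP; apply: measurable_funTS.
  exact: continuous_measurable_fun.
rewrite (integral_itv_bndo_bndc mf).
have dF (t : R) : is_derive t 1 (fun t : R => atan (a * t)) (a / (1 + a ^+ 2 * t ^+ 2)).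
  have -> : a / (1 + a ^+ 2 * t ^+ 2) = (1 + (a * t) ^+ 2)^-1 * (a *: 1).
    by rewrite exprMn [RHS]mulrC /GRing.scale/= mulr1.
  by apply: (@is_derive1_comp _ atan (fun t => a * t)); exact: is_deriveZ.
rewrite (@continuous_FTC2 _ _ (fun t : R => atan (a * t)))//.
- rewrite -EFinB lee_fin.
  have := atan_ltpi2 (a * 2^-1); have := atan_gtNpi2 (a * - 2^-1); lra.
- by lra.
- exact: continuous_subspaceT.
- split.
  + by move=> t _; exact: ex_derive.
  + apply: cvg_at_right_filter; apply: differentiable_continuous.
    by apply/derivable1_diffP; exact: ex_derive.
  + apply: cvg_at_left_filter; apply: differentiable_continuous.
    by apply/derivable1_diffP; exact: ex_derive.
- by move=> t _; rewrite derive1E derive_val.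
Qed.

End weight.

(** * Complex integration and Fourier coefficients *)

Section complex_measurable.
Context {R : realType} {dT : measure_display} {T : measurableType dT}.
Local Notation C := R[i].
Implicit Types (f g : T -> C).

Definition cmeas f :=
  measurable_fun setT (fun x => complex.Re (f x)) /\
  measurable_fun setT (fun x => complex.Im (f x)).

Lemma cmeas_cst (c : C) : cmeas (fun=> c).
Proof. by split; exact: measurable_cst. Qed.

Lemma cmeasD f g : cmeas f -> cmeas g -> cmeas (fun x => f x + g x).
Proof.
move=> [f1 f2] [g1 g2]; split.
  by under eq_fun do rewrite raddfD; exact: measurable_funD.
by under eq_fun do rewrite raddfD; exact: measurable_funD.
Qed.

Lemma cmeasN f : cmeas f -> cmeas (fun x => - f x).
Proof.
move=> [f1 f2]; split.
  by under eq_fun do rewrite raddfN; exact: measurable_funN.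
by under eq_fun do rewrite raddfN; exact: measurable_funN.
Qed.

Lemma cmeasB f g : cmeas f -> cmeas g -> cmeas (fun x => f x - g x).
Proof. by move=> mf mg; apply: cmeasD => //; exact: cmeasN. Qed.

Lemma ReM (z w : C) :
  complex.Re (z * w) = complex.Re z * complex.Re w - complex.Im z * complex.Im w.
Proof. by case: z; case: w. Qed.

Lemma ImM (z w : C) :
  complex.Im (z * w) = complex.Re z * complex.Im w + complex.Im z * complex.Re w.
Proof. by case: z; case: w. Qed.

Lemma cmeasM f g : cmeas f -> cmeas g -> cmeas (fun x => f x * g x).
Proof.
move=> [f1 f2] [g1 g2]; split.
  by under eq_fun do rewrite ReM; apply: measurable_funB; exact: measurable_funM.
by under eq_fun do rewrite ImM; apply: measurable_funD; exact: measurable_funM.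
Qed.

Lemma cmeas_sum (I : Type) (s : seq I) (P : pred I) (F : I -> T -> C) :
  (forall i, cmeas (F i)) -> cmeas (fun x => \sum_(i <- s | P i) F i x).
Proof.
move=> mF; elim: s => [|i s IH].
  by under eq_fun do rewrite big_nil; exact: cmeas_cst.
under eq_fun do rewrite big_cons; case: (P i) => //.
exact: cmeasD.
Qed.

Lemma cmeas_normc f : cmeas f -> measurable_fun setT (fun x => normc (f x)).
Proof.
move=> [f1 f2].
rewrite (_ : (fun x => _) =
  (fun x => Num.sqrt (complex.Re (f x) ^+ 2 + complex.Im (f x) ^+ 2))); last first.
  by apply/funext => x; case: (f x).
apply: (@measurableT_comp _ _ _ _ _ _ (@Num.sqrt R)).
  by apply: continuous_measurable_fun; exact: sqrt_continuous.
by apply: measurable_funD; exact: measurable_funX.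
Qed.

Lemma emeas_normc f : cmeas f -> measurable_fun setT (fun x => (normc (f x))%:E).
Proof. by move=> mf; apply/measurable_EFinP; exact: cmeas_normc. Qed.

End complex_measurable.

Section complex_facts.
Context {R : realType}.
Local Notation C := R[i].
Implicit Types (z w : C).

Lemma normc_ge0 z : 0 <= normc z.
Proof. by case: z => a b; exact: sqrtr_ge0. Qed.

Lemma normcM z w : normc (z * w) = normc z * normc w.
Proof. exact: ComplexField.Normc.normcM. Qed.

Lemma normcD z w : normc (z + w) <= normc z + normc w.
Proof. exact: le_normcD. Qed.

Lemma normcN z : normc (- z) = normc z.
Proof. by case: z => a b /=; rewrite !sqrrN. Qed.

Lemma normc0 : normc (0 : C) = 0.
Proof. exact: ComplexField.Normc.normc0. Qed.

Lemma normc1 : normc (1 : C) = 1.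
Proof. exact: ComplexField.Normc.normc1. Qed.

Lemma normc_sum (I : Type) (s : seq I) (P : pred I) (F : I -> C) :
  normc (\sum_(i <- s | P i) F i) <= \sum_(i <- s | P i) normc (F i).
Proof.
elim: s => [|i s IH]; first by rewrite !big_nil normc0.
by rewrite !big_cons; case: (P i) => //; apply: le_trans (normcD _ _) _; rewrite lerD2l.
Qed.

Lemma normc_real (a : R) : normc a%:C = `|a|.
Proof. by rewrite /= expr0n/= addr0 sqrtr_sqr. Qed.

Lemma normc_Re z : `|complex.Re z| <= normc z.
Proof. by case: z => a b /=; rewrite -sqrtr_sqr ler_wsqrtr// lerDl sqr_ge0. Qed.

Lemma normc_Im z : `|complex.Im z| <= normc z.
Proof. by case: z => a b /=; rewrite -sqrtr_sqr ler_wsqrtr// lerDr sqr_ge0. Qed.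

Lemma normc_ReIm z : normc z <= `|complex.Re z| + `|complex.Im z|.
Proof.
case: z => a b /=; rewrite -[leRHS]ger0_norm ?addr_ge0// -sqrtr_sqr ler_wsqrtr//.
by rewrite sqrrD !real_normK ?num_real// -addrA lerD2l lerDr mulrn_wge0// mulr_ge0.
Qed.

Lemma normc_eq0 z : normc z = 0 -> z = 0.
Proof. exact: ComplexField.Normc.eq0_normc. Qed.

Lemma normcMconj z : z * z^*%C = (normc z ^+ 2)%:C.
Proof.
case: z => a b /=; rewrite sqr_sqrtr ?addr_ge0 ?sqr_ge0//.
by apply/eqP; rewrite eq_complex/=; apply/andP; split; apply/eqP; ring.
Qed.

Lemma normc_conj z : normc z^*%C = normc z.
Proof. by case: z => a b /=; rewrite sqrrN. Qed.

End complex_facts.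

Section complex_integral.
Context {R : realType} {n : nat}.
Local Notation Rn := 'cV[R]_n.
Local Notation C := R[i].
Implicit Types (f g : Rn -> C).

Definition cintegrable f :=
  cmeas f /\ (\int[torus]_x (normc (f x))%:E < +oo)%E.

Lemma cintegrable_Re f : cintegrable f ->
  torus.-integrable setT (EFin \o (fun x => complex.Re (f x))).
Proof.
move=> [mf foo]; apply/integrableP; split.
  by apply/measurable_EFinP; exact: mf.1.
apply: le_lt_trans foo; apply: ge0_le_integral => //.
- by apply: measurableT_comp => //; apply/measurable_EFinP; exact: mf.1.
- exact: emeas_normc.
- by move=> x _; rewrite /= lee_fin normc_Re.
Qed.

Lemma cintegrable_Im f : cintegrable f ->
  torus.-integrable setT (EFin \o (fun x => complex.Im (f x))).
Proof.
move=> [mf foo]; apply/integrableP; split.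
  by apply/measurable_EFinP; exact: mf.2.
apply: le_lt_trans foo; apply: ge0_le_integral => //.
- by apply: measurableT_comp => //; apply/measurable_EFinP; exact: mf.2.
- exact: emeas_normc.
- by move=> x _; rewrite /= lee_fin normc_Im.
Qed.

Lemma cintegrableD f g : cintegrable f -> cintegrable g ->
  cintegrable (fun x => f x + g x).
Proof.
move=> [mf fo] [mg go]; split; first exact: cmeasD.
apply: (@le_lt_trans _ _ (\int[torus]_x ((normc (f x))%:E + (normc (g x))%:E))%E).
  apply: ge0_le_integral => //.
  - by move=> x _; rewrite lee_fin normc_ge0.
  - by apply: emeas_normc; exact: cmeasD.
  - by apply: emeasurable_funD; exact: emeas_normc.
  - by move=> x _; rewrite -EFinD lee_fin normcD.
rewrite ge0_integralD//; [exact: lte_add_pinfty|..].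
- by move=> x _; rewrite lee_fin normc_ge0.
- exact: emeas_normc.
- by move=> x _; rewrite lee_fin normc_ge0.
- exact: emeas_normc.
Qed.

Lemma cintegrableMb f g (K : R) : cintegrable f -> cmeas g ->
  (forall x, normc (g x) <= K) -> cintegrable (fun x => g x * f x).
Proof.
move=> [mf fo] mg gK; split; first exact: cmeasM.
have K0 : 0 <= K by apply: le_trans (gK 0); exact: normc_ge0.
apply: (@le_lt_trans _ _ (\int[torus]_x (K%:E * (normc (f x))%:E))%E).
  apply: ge0_le_integral => //.
  - by move=> x _; rewrite lee_fin normc_ge0.
  - by apply: emeas_normc; exact: cmeasM.
  - by apply: measurable_funeM; exact: emeas_normc.
  - by move=> x _; rewrite -EFinM lee_fin normcM ler_wpM2r// normc_ge0.
rewrite ge0_integralZl//; first exact: lte_mul_pinfty.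
- exact: emeas_normc.
- by move=> x _; rewrite lee_fin normc_ge0.
Qed.

Lemma cintegrable_bounded g (K : R) : cmeas g ->
  (forall x, normc (g x) <= K) -> cintegrable g.
Proof.
move=> mg gK; rewrite (_ : g = (fun x => g x * (fun=> 1) x)); last first.
  by apply/funext => x; rewrite mulr1.
apply: (@cintegrableMb _ _ K) => //; split; first exact: cmeas_cst.
by rewrite ge0_integral_torus_cst ?lee_fin ?normc_ge0// ltry.
Qed.

Lemma cintegrableZ (c : C) f : cintegrable f -> cintegrable (fun x => c * f x).
Proof. by move=> fi; apply: (@cintegrableMb _ (fun=> c) (normc c)) => //; exact: cmeas_cst. Qed.

Lemma cintegrable0 : cintegrable (fun=> 0).
Proof. by apply: (@cintegrable_bounded _ 0); [exact: cmeas_cst|move=> x; rewrite normc0]. Qed.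

Lemma cintegrable_sum (I : Type) (s : seq I) (P : pred I) (F : I -> Rn -> C) :
  (forall i, cintegrable (F i)) -> cintegrable (fun x => \sum_(i <- s | P i) F i x).
Proof.
move=> mF; elim: s => [|i s IH].
  by under eq_fun do rewrite big_nil; exact: cintegrable0.
under eq_fun do rewrite big_cons; case: (P i) => //.
exact: cintegrableD.
Qed.

Lemma complexD_split (a b c d : R) : (a + b) +i* (c + d) = (a +i* c) + (b +i* d).
Proof. by []. Qed.

Lemma CintD f g : cintegrable f -> cintegrable g ->
  Cint (fun x => f x + g x) = Cint f + Cint g.
Proof.
move=> fi gi; rewrite /Cint -complexD_split; congr (_ +i* _).
  under eq_Rintegral do rewrite raddfD.
  by rewrite RintegralD//; exact: cintegrable_Re.
under eq_Rintegral do rewrite raddfD.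
by rewrite RintegralD//; exact: cintegrable_Im.
Qed.

Lemma CintZ (c : C) f : cintegrable f -> Cint (fun x => c * f x) = c * Cint f.
Proof.
move=> fi; have fr := cintegrable_Re fi; have fm := cintegrable_Im fi.
have sr (a : R) : torus.-integrable setT (EFin \o (fun x => a * complex.Re (f x))).
  by apply: (integrableZl measurableT a fr).
have sm (a : R) : torus.-integrable setT (EFin \o (fun x => a * complex.Im (f x))).
  by apply: (integrableZl measurableT a fm).
case: c => a b; rewrite /Cint; apply/eqP; rewrite eq_complex/=; apply/andP; split; apply/eqP.
  under eq_Rintegral do rewrite ReM.
  by rewrite RintegralB// !RintegralZl.
under eq_Rintegral do rewrite ImM.
by rewrite RintegralD// !RintegralZl.
Qed.

Lemma Cint0 : Cint (fun _ : Rn => 0 : C) = 0.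
Proof. by rewrite /Cint !Rintegral_cst//= !mul0r. Qed.

Lemma Cint_sum (I : Type) (s : seq I) (P : pred I) (F : I -> Rn -> C) :
  (forall i, cintegrable (F i)) ->
  Cint (fun x => \sum_(i <- s | P i) F i x) = \sum_(i <- s | P i) Cint (F i).
Proof.
move=> Fi; elim: s => [|i s IH].
  by rewrite big_nil; under eq_fun do rewrite big_nil; exact: Cint0.
rewrite big_cons; under eq_fun do rewrite big_cons.
by case: ifP => // _; rewrite CintD ?IH//; exact: cintegrable_sum.
Qed.

Lemma Cint_cst (c : C) : Cint (fun _ : Rn => c) = c.
Proof. by rewrite /Cint !Rintegral_cst//= torusT /= !mulr1; case: c. Qed.

(** Real and imaginary parts are estimated separately, which costs the factor 2; it is absorbed by
    the constants. *)
Lemma normc_Cint f : cintegrable f ->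
  ((normc (Cint f))%:E <= 2%:E * \int[torus]_x (normc (f x))%:E)%E.
Proof.
move=> fi; have [mf foo] := fi.
have h (r : Rn -> R) : torus.-integrable setT (EFin \o r) ->
    (forall x, `|r x| <= normc (f x)) ->
    (`|\int[torus]_x r x|%:E <= \int[torus]_x (normc (f x))%:E)%E.
  move=> ri rf; rewrite /Rintegral -fine_abse//; last exact: integrable_fin_num.
  rewrite fineK; last by rewrite abse_fin_num; exact: integrable_fin_num.
  apply: le_trans (le_abse_integral _ _ _) _ => //.
    exact: measurable_int ri.
  apply: ge0_le_integral => //.
  - by apply: measurableT_comp => //; exact: measurable_int ri.
  - exact: emeas_normc.
  - by move=> x _; rewrite lee_fin.
apply: (@le_trans _ _ (`|complex.Re (Cint f)| + `|complex.Im (Cint f)|)%:E).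
  by rewrite lee_fin normc_ReIm.
rewrite EFinD (_ : 2%:E * _ = \int[torus]_x (normc (f x))%:E +
    \int[torus]_x (normc (f x))%:E)%E; last first.
  rewrite -(fineK (_ : \int[torus]_x (normc (f x))%:E \is a fin_num)%E).
    by rewrite -EFinM -EFinD; congr _%:E; ring.
  by rewrite ge0_fin_numE//; apply: integral_ge0 => x _; rewrite lee_fin normc_ge0.
apply: leeD; apply: h.
- exact: cintegrable_Re.
- by move=> x; exact: normc_Re.
- exact: cintegrable_Im.
- by move=> x; exact: normc_Im.
Qed.

(** The invariance under [tau] is assumed for nonnegative functions and carried over by positive and
    negative parts of Re and Im. It serves translations, reflections and integer dilations alike. *)
Lemma Cint_change (tau : Rn -> Rn) f : measurable_fun setT tau ->
  (forall F : Rn -> \bar R, measurable_fun setT F -> (forall x, 0 <= F x)%E ->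
     eperiodic F -> (\int[torus]_x F (tau x) = \int[torus]_x F x)%E) ->
  Defs.periodic f -> cmeas f -> Cint (f \o tau) = Cint f.
Proof.
move=> mtau inv pf [mr mi].
have h (r : Rn -> R) : measurable_fun setT r -> (forall k x, r (x + int_vec k) = r x) ->
    \int[torus]_x r (tau x) = \int[torus]_x r x.
  move=> mr' pr; rewrite /Rintegral integralE [in RHS]integralE; congr (fine (_ - _)).
    rewrite -[RHS](inv ((EFin \o r)^\+)%E)//.
    - by apply: eq_integral => x _; rewrite !funeposE.
    - by apply: measurable_funepos; exact/measurable_EFinP.
    - by move=> x k; rewrite !funeposE/= pr.
  rewrite -[RHS](inv ((EFin \o r)^\-)%E)//.
  - by apply: eq_integral => x _; rewrite !funenegE.
  - by apply: measurable_funeneg; exact/measurable_EFinP.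
  - by move=> x k; rewrite !funenegE/= pr.
by rewrite /Cint; congr (_ +i* _); apply: h => // k x; rewrite pf.
Qed.

Lemma cintegrable_change (tau : Rn -> Rn) f : measurable_fun setT tau ->
  (forall F : Rn -> \bar R, measurable_fun setT F -> (forall x, 0 <= F x)%E ->
     eperiodic F -> (\int[torus]_x F (tau x) = \int[torus]_x F x)%E) ->
  Defs.periodic f -> cintegrable f -> cintegrable (f \o tau).
Proof.
move=> mtau inv pf [[mr mi] foo]; split.
  by split; [exact: (measurableT_comp mr mtau)|exact: (measurableT_comp mi mtau)].
rewrite (inv (fun x => (normc (f x))%:E))//; first exact: emeas_normc.
- by move=> x; rewrite lee_fin normc_ge0.
- by move=> x k; rewrite pf.
Qed.

End complex_integral.

(** * Characters, Fourier coefficients and convolution along dilated arguments *)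

Section fourier.
Context {R : realType} {n : nat}.
Local Notation Rn := 'cV[R]_n.
Local Notation Zn := 'cV[int]_n.
Local Notation C := R[i].
Implicit Types (f g : Rn -> C) (k l : Zn) (x y h : Rn) (S : {fset Zn}) (w : Zn -> C).

(** This is e^{2 pi i t}. *)
Definition cis (t : R) : C := cos (2 * pi * t) +i* sin (2 * pi * t).

Lemma cisD t u : cis (t + u) = cis t * cis u.
Proof.
rewrite /cis mulrDr cosD sinD; apply/eqP; rewrite eq_complex/=.
by rewrite eqxx addrC eqxx.
Qed.

Lemma cis0 : cis 0 = 1.
Proof. by rewrite /cis mulr0 cos0 sin0. Qed.

Lemma normc_cis t : normc (cis t) = 1.
Proof. by rewrite /= cos2Dsin2 sqrtr1. Qed.

Lemma cis1 : cis 1 = 1.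
Proof. by rewrite /cis mulr1 mulr_natl cos2pi sin2pi. Qed.

Lemma cis_nat m : cis m%:R = 1.
Proof. by elim: m => [|m IH]; rewrite ?cis0// -addn1 natrD cisD IH cis1 mulr1. Qed.

Lemma cisN_nat m : cis (- m%:R) = 1.
Proof. by have := cisD (- m%:R) m%:R; rewrite addNr cis0 cis_nat mulr1 => <-. Qed.

Lemma cis_int (z : int) : cis z%:~R = 1.
Proof.
case: z => m; first by rewrite -(cis_nat m).
by rewrite NegzE mulrNz -pmulrn cisN_nat.
Qed.

Lemma cis_half : cis 2^-1 = -1.
Proof.
rewrite /cis (_ : 2 * pi * 2^-1 = pi) ?cospi ?sinpi//; last by rewrite mulrAC mulfV// mul1r.
by apply/eqP; rewrite eq_complex/= oppr0 !eqxx.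
Qed.

(** Once the integer part is removed, 1 - cos (2 pi u) = 2 sin (pi u)^2 with 0 <= u < 1, which
    vanishes only at u = 0. *)
Lemma cis_eq1 t : cis t = 1 -> exists z : int, t = z%:~R.
Proof.
pose z := Num.floor t; pose u := t - z%:~R.
have u01 : 0 <= u < 1.
  by rewrite /u subr_ge0 ltrBlDl -[X in _ < _ + X]/(1%:~R) -intrD
     floor_le_tmp floorD1_gt.
have -> : cis t = cis u by rewrite -[t in LHS](subrK z%:~R) cisD cis_int mulr1.
move=> /eqP; rewrite eq_complex/= => /andP[/eqP c1 _].
exists z; apply/eqP; rewrite -subr_eq0 -/u; apply/eqP.
case/andP: u01; rewrite le_eqVlt => /predU1P[<-//|u0] u1.
have s0 : 0 < sin (pi * u).
  apply: sin_gt0_pi; rewrite mulr_gt0 ?pi_gt0//=.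
  by rewrite -[ltRHS]mulr1 ltr_pM2l// pi_gt0.
move: c1; rewrite -mulrA mulr_natl cos_mulr2n cos2sin2 => c1.
have : sin (pi * u) ^+ 2 = 0 by lra.
by move/eqP; rewrite expf_eq0/= => /eqP h; move: s0; rewrite h ltxx.
Qed.

Definition dotp k x : R := \sum_i (k i ord0)%:~R * x i ord0.

Lemma expkE k x : expk k x = cis (dotp k x).
Proof. by []. Qed.

Lemma dotpDr k x y : dotp k (x + y) = dotp k x + dotp k y.
Proof. by rewrite -big_split/=; apply: eq_bigr => i _; rewrite mxE mulrDr. Qed.

Lemma dotpDl k l x : dotp (k + l) x = dotp k x + dotp l x.
Proof. by rewrite -big_split/=; apply: eq_bigr => i _; rewrite mxE intrD mulrDl. Qed.

Lemma dotp0l x : dotp 0 x = 0.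
Proof. by rewrite /dotp big1// => i _; rewrite mxE mul0r. Qed.

Lemma dotp0r k : dotp k 0 = 0.
Proof. by rewrite /dotp big1// => i _; rewrite mxE mulr0. Qed.

Lemma dotp_int k l : dotp k (int_vec l) = (\sum_i k i ord0 * l i ord0)%:~R.
Proof.
rewrite rmorph_sum/=; apply: eq_bigr => i _.
by rewrite mxE intrM.
Qed.

Lemma expkDr k x y : expk k (x + y) = expk k x * expk k y.
Proof. by rewrite !expkE dotpDr cisD. Qed.

Lemma expkDl k l x : expk (k + l) x = expk k x * expk l x.
Proof. by rewrite !expkE dotpDl cisD. Qed.

Lemma expk0l x : expk 0 x = 1 :> C.
Proof. by rewrite expkE dotp0l cis0. Qed.

Lemma expk0r k : expk k 0 = 1 :> C.
Proof. by rewrite expkE dotp0r cis0. Qed.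

Lemma expkVl k x : expk (- k) x * expk k x = 1.
Proof. by rewrite -expkDl addNr expk0l. Qed.

Lemma expkVr k x : expk k (- x) * expk k x = 1.
Proof. by rewrite -expkDr addNr expk0r. Qed.

Lemma normc_expk k x : normc (expk k x) = 1.
Proof. exact: normc_cis. Qed.

Lemma expkNr k x : expk k (- x) = expk (- k) x.
Proof. by rewrite -[LHS]mul1r -(expkVl k x) -mulrA [expk k x * _]mulrC expkVr mulr1. Qed.

Lemma expk_int k l : expk k (int_vec l) = 1 :> C.
Proof. by rewrite expkE dotp_int cis_int. Qed.

Lemma expk_periodic k : Defs.periodic (@expk R n k).
Proof. by move=> l x; rewrite expkDr expk_int mulr1. Qed.

Lemma cmeas_expk k : cmeas (@expk R n k).
Proof.
have md : measurable_fun setT (fun x : Rn => 2 * pi * dotp k x).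
  apply: measurable_funM => //; apply: measurable_sum => i.
  by apply: measurable_funM => //; exact: measurable_coord.
split.
  apply: (@measurableT_comp _ _ _ _ _ _ (@cos R) _ _ _ md).
  by apply: continuous_measurable_fun; exact: continuous_cos.
apply: (@measurableT_comp _ _ _ _ _ _ (@sin R) _ _ _ md).
by apply: continuous_measurable_fun; exact: continuous_sin.
Qed.

Lemma cintegrable_expkM k f : cintegrable f -> cintegrable (fun x => expk k x * f x).
Proof.
move=> fi; apply: (@cintegrableMb _ _ f (expk k) 1) => //; first exact: cmeas_expk.
by move=> x; rewrite normc_expk.
Qed.

Lemma cintegrable_expk k : cintegrable (@expk R n k).
Proof. by apply: (@cintegrable_bounded _ _ _ 1); [exact: cmeas_expk|move=> x; rewrite normc_expk]. Qed.

(** Translation invariance gives Cint f = z Cint f. This is the source of every orthogonality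
    relation for integrals below. *)
Lemma Cint_twist f h (z : C) : Defs.periodic f -> cintegrable f ->
  (forall x, f (x + h) = z * f x) -> z != 1 -> Cint f = 0.
Proof.
move=> pf fi fz z1.
have : Cint (f \o (fun x => x + h)) = Cint f.
  apply: Cint_change => //; [exact: measurable_funD_cV| |exact: fi.1].
  exact: ge0_integral_torusD.
rewrite (_ : f \o _ = (fun x => z * f x)); last by apply/funext => x /=; rewrite fz.
rewrite CintZ// => /eqP; rewrite -subr_eq0 -{2}[Cint f]mul1r -mulrBl mulf_eq0.
by rewrite subr_eq0 (negbTE z1) => /eqP.
Qed.

Lemma cis_neq1_notint t : (forall z : int, t <> z%:~R) -> cis t != 1.
Proof. by move=> h; apply/eqP => /cis_eq1[z]; exact: h. Qed.

Lemma dotp_delta k i (c : R) :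
  dotp k (\col_j (if j == i then c else 0)) = (k i ord0)%:~R * c.
Proof.
rewrite /dotp (bigD1 i)//= mxE eqxx big1 ?addr0// => j ji.
by rewrite mxE (negbTE ji) mulr0.
Qed.

Lemma Cint_expk k : Cint (@expk R n k) = (k == 0)%:R.
Proof.
have [->|k0] := eqVneq k 0.
  by rewrite (_ : expk 0 = (fun=> 1)) ?Cint_cst//; apply/funext => x; exact: expk0l.
have [i ki] : exists i, k i ord0 != 0.
  apply/existsP; apply: contraNT k0; rewrite negb_exists => /forallP h.
  by apply/eqP/colP => i; rewrite mxE; have := h i; rewrite negbK => /eqP.
(* Half a wavelength in a direction where [k] does not vanish: this shift multiplies the character
   by -1. *)
pose c : R := 2^-1 / (k i ord0)%:~R.
apply: (@Cint_twist _ (\col_j (if j == i then c else 0)) (-1)).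
- exact: expk_periodic.
- exact: cintegrable_expk.
- move=> x; rewrite expkDr mulrC; congr (_ * _).
  by rewrite expkE dotp_delta /c mulrCA mulfV ?mulr1 ?cis_half// intr_eq0.
- by rewrite -subr_eq0 -opprD oppr_eq0 -(natrD _ 1 1) pnatr_eq0.
Qed.

Lemma fcoefZ (c : C) f k : cintegrable f -> fcoef (fun x => c * f x) k = c * fcoef f k.
Proof.
move=> fi; rewrite /fcoef -CintZ; last first.
  by under eq_fun do rewrite mulrC; exact: cintegrable_expkM.
by congr Cint; apply/funext => x; rewrite mulrA.
Qed.

Lemma cintegrable_coef f k : cintegrable f -> cintegrable (fun x => f x * expk (- k) x).
Proof. by move=> fi; under eq_fun do rewrite mulrC; exact: cintegrable_expkM. Qed.

Lemma fcoefD f g k : cintegrable f -> cintegrable g ->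
  fcoef (fun x => f x + g x) k = fcoef f k + fcoef g k.
Proof.
move=> fi gi; rewrite /fcoef -CintD; try exact: cintegrable_coef.
by congr Cint; apply/funext => x; rewrite mulrDl.
Qed.

Definition trig S w : Rn -> C := fun x => \sum_(k <- S) w k * expk k x.

Lemma cintegrable_trig S w : cintegrable (trig S w).
Proof. by apply: cintegrable_sum => k; apply: cintegrableZ; exact: cintegrable_expk. Qed.

Lemma cmeas_trig S w : cmeas (trig S w).
Proof. by case: (cintegrable_trig S w). Qed.

Lemma trig_periodic S w : Defs.periodic (trig S w).
Proof. by move=> l x; apply: eq_bigr => k _; rewrite expk_periodic. Qed.

Lemma normc_trig S w x : normc (trig S w x) <= \sum_(k <- S) normc (w k).
Proof.
apply: le_trans (normc_sum _ _ _) _.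
by rewrite le_eqVlt; apply/orP; left; apply/eqP/eq_bigr => k _; rewrite normcM normc_expk mulr1.
Qed.

Lemma fcoef_trig S w k : fcoef (trig S w) k = if k \in S then w k else 0.
Proof.
rewrite /fcoef /trig.
under [X in Cint X]eq_fun => x do rewrite mulr_suml.
rewrite Cint_sum; last first.
  move=> l; under eq_fun do rewrite -mulrA -expkDl.
  by apply: cintegrableZ; exact: cintegrable_expk.
have E l : Cint (fun x => w l * expk l x * expk (- k) x) = w l * (l == k)%:R.
  under [X in Cint X]eq_fun => x do rewrite -mulrA -expkDl.
  by rewrite CintZ; [rewrite Cint_expk subr_eq0|exact: cintegrable_expk].
under eq_bigr do rewrite E.
case: ifPn => kS.
  rewrite (big_fsetD1 k)//= eqxx mulr1 big_seq big1 ?addr0// => l.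
  by rewrite !inE => /andP[/negbTE-> _]; rewrite mulr0.
rewrite big_seq big1// => l lS; case: eqVneq => [lk|_]; rewrite ?mulr0//.
by rewrite lk (negbTE kS) in lS.
Qed.

Lemma scale_cVN_nat (nu : nat) y : scale_cV (fun=> (- nu%:Z)%:~R) y = - (y *+ nu) :> Rn.
Proof. by apply/colP => i; rewrite !mxE mulrNz mulNr -pmulrn mulr_natl mulmxnE. Qed.

Lemma expkMn k x (nu : nat) : expk k (x *+ nu) = expk (k *+ nu) x.
Proof.
elim: nu => [|nu IH]; first by rewrite !mulr0n expk0l expk0r.
by rewrite !mulrS expkDl expkDr IH.
Qed.

Lemma cintegrable_conv f x (nu : nat) : (0 < nu)%N -> Defs.periodic f -> cintegrable f ->
  cintegrable (fun y => f (x - y *+ nu)).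
Proof.
move=> nu0 pf fi.
have inv := @ge0_integral_torus_affine R n x (fun=> - nu%:Z).
pose tau (y : Rn) := x + scale_cV (fun=> (- nu%:Z)%:~R) y.
have mtau : measurable_fun setT tau.
  rewrite /tau; under eq_fun do rewrite addrC.
  exact: (measurableT_comp (measurable_funD_cV x) (measurable_scale_cV _)).
rewrite (_ : (fun y => _) = f \o tau).
  apply: cintegrable_change => // F mF F0 FZ; apply: inv => // i.
  by rewrite oppr_eq0 -lt0n.
by apply/funext => y; rewrite /= /tau scale_cVN_nat.
Qed.

(** The substitution y -> x - nu y preserves torus integrals because its linear part is a nonzero
    integer dilation. *)
Lemma conv_expk_div f x l (nu : nat) : (0 < nu)%N -> Defs.periodic f -> cintegrable f ->
  Cint (fun y => expk (l *+ nu) y * f (x - y *+ nu)) = fcoef f l * expk l x.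
Proof.
move=> nu0 pf fi.
pose tau (y : Rn) := x + scale_cV (fun=> (- nu%:Z)%:~R) y.
have mtau : measurable_fun setT tau.
  rewrite /tau; under eq_fun do rewrite addrC.
  exact: (measurableT_comp (measurable_funD_cV x) (measurable_scale_cV _)).
pose g y := f y * expk (- l) y.
have gi : cintegrable g by exact: cintegrable_coef.
have pg : Defs.periodic g by move=> k y; rewrite /g pf expk_periodic.
have <- : Cint (g \o tau) = fcoef f l.
  apply: Cint_change => //; last exact: gi.1.
  move=> F mF F0 FZ; apply: ge0_integral_torus_affine => // i.
  by rewrite oppr_eq0 -lt0n.
have gti : cintegrable (g \o tau).
  apply: cintegrable_change => // F mF F0 FZ; apply: ge0_integral_torus_affine => // i.
  by rewrite oppr_eq0 -lt0n.
rewrite mulrC -CintZ//; congr Cint; apply/funext => y.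
have E : expk (- l) (x - y *+ nu) = expk (- l) x * expk (l *+ nu) y :> C.
  by rewrite expkDr [expk (- l) (- _)]expkNr opprK expkMn.
rewrite /g /tau /= scale_cVN_nat E.
rewrite -[LHS]mul1r -(expkVl l x); ring.
Qed.

(** Shifting [y] by 1/nu along a coordinate leaves f (x - nu y) unchanged and multiplies the
    character by e^{2 pi i k_i / nu}, which differs from 1 for a coordinate that [nu] does not
    divide. *)
Lemma conv_expk_ndiv f x k (nu : nat) : (0 < nu)%N -> Defs.periodic f -> cintegrable f ->
  (forall l, k <> l *+ nu) ->
  Cint (fun y => expk k y * f (x - y *+ nu)) = 0.
Proof.
move=> nu0 pf fi knu.
have nuR0 : (nu%:R : R) != 0 by rewrite pnatr_eq0 -lt0n.
have [i ki] : exists i, forall z : int, k i ord0 <> z *+ nu.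
  apply: contrapT => h; apply: (knu (\col_i (k i ord0 %/ nu)%Z)).
  apply/colP => i; rewrite mulmxnE mxE.
  apply: contrapT => ki; apply: h; exists i => z kz; apply: ki.
  rewrite [LHS]kz kz; congr (_ *+ _).
  by rewrite -mulr_natr natz mulzK// -lt0n.
pose c : R := nu%:R^-1.
apply: (@Cint_twist _ (\col_j (if j == i then c else 0)) (cis ((k i ord0)%:~R * c))).
- move=> l y; rewrite expk_periodic mulrnDl opprD addrA -[- (int_vec l *+ nu)]mulNrn.
  congr (_ * _); rewrite -[RHS](pf (- (l *+ nu))); congr (f (_ + _)).
  by apply/colP => r; rewrite !mulmxnE !mxE mulmxnE mulNrn rmorphN rmorphMn.
- by apply: cintegrable_expkM; exact: cintegrable_conv.
- move=> y; rewrite expkDr [expk k y * _]mulrC -mulrA expkE dotp_delta.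
  congr (_ * (_ * _)); rewrite mulrnDl opprD addrA.
  rewrite -[RHS](pf (\col_j (if j == i then -1 else 0))); congr (f (_ + _)).
  apply/colP => r; rewrite !mxE mulmxnE !mxE; case: eqP => _.
    by rewrite -mulr_natr /c mulVf.
  by rewrite mul0rn oppr0.
- apply: cis_neq1_notint => z /(congr1 (fun t => t * nu%:R)).
  rewrite /c mulfVK// mulr_natr -(rmorphMn (intr : int -> R)) => /intr_inj; exact: ki.
Qed.

(** The terms f (x - nu y) come from s-th differences. Integrated against a polynomial in [y], they
    see only the frequencies nu l, so the symbol is sampled at nu l instead of at l. *)
Lemma conv_trig S w f x (nu : nat) (S' : {fset Zn}) :
  (0 < nu)%N -> Defs.periodic f -> cintegrable f ->
  (forall k, k \notin S -> w k = 0) ->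
  (forall l, l \notin S' -> w (l *+ nu) = 0) ->
  Cint (fun y => trig S w y * f (x - y *+ nu)) =
  trig S' (fun l => w (l *+ nu) * fcoef f l) x.
Proof.
move=> nu0 pf fi wS wS'.
have -> : (fun y => trig S w y * f (x - y *+ nu)) =
    (fun y => \sum_(k <- S) w k * (expk k y * f (x - y *+ nu))).
  by apply/funext => y; rewrite mulr_suml; apply: eq_bigr => k _; rewrite mulrA.
have ci k : cintegrable (fun y => expk k y * f (x - y *+ nu)).
  by apply: cintegrable_expkM; exact: cintegrable_conv.
rewrite Cint_sum; last by move=> k; exact: cintegrableZ.
under eq_bigr do rewrite CintZ//.
pose Phi k := Cint (fun y => expk k y * f (x - y *+ nu)).
rewrite -(@fsbigTE _ _ _ _ S (fun k => w k * Phi k)); last by move=> k /wS ->; rewrite mul0r.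
rewrite /trig -(@fsbigTE _ _ _ _ S' (fun l => w (l *+ nu) * fcoef f l * expk l x)); last first.
  by move=> k /wS' ->; rewrite !mul0r.
have inj : {in [set: Zn] &, injective (fun l : Zn => l *+ nu)}.
  move=> l l' _ _ /colP h; apply/colP => i; have := h i; rewrite !mulmxnE => /eqP.
  by rewrite eqr_pMn2r -?lt0n// => /eqP.
(* Frequencies outside nu Z^n contribute nothing; the others are reindexed by l -> nu l. *)
rewrite -(@fsbig_widen _ _ _ _ [set l *+ nu | l in [set: Zn]]) //; last first.
  move=> k [_ /= nk]; rewrite /Phi conv_expk_ndiv ?mulr0// => l kl.
  by apply: nk; exists l.
rewrite (@reindex_fsbig _ _ _ _ _ (fun l => l *+ nu) setT).
  by apply: eq_fsbigr => l _; rewrite /Phi conv_expk_div// mulrA.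
by split=> [l _|//|_ [l _ <-]]; [exists l|exists l].
Qed.

End fourier.

(** * Kernel estimates by summation by parts *)

Section nice.
Context {R : realType} {n : nat}.
Local Notation Rn := 'cV[R]_n.
Local Notation C := R[i].
Implicit Types (G H : Rn -> C) (x y h : Rn) (i l : 'I_n).

Definition bounded_support (r : R) G :=
  (exists K, forall x, normc (G x) <= K) /\
  (forall x, (exists i, r < `|x i ord0|) -> G x = 0).

(** Existence and boundedness of partial derivatives up to order [m] is what the mean value theorem
    consumes, and the common support box makes every sampled sum finite. The recursive form lets an
    induction on [m] peel off one derivative at a time. *)
Fixpoint nice (m : nat) (r : R) G : Prop :=
  if m is m'.+1 then
    [/\ bounded_support r G, Cderivable G & forall i, nice m' r (pderiv i G)]
  else bounded_support r G.

Lemma nice_supp m r G : nice m r G -> bounded_support r G.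
Proof. by case: m => //= m []. Qed.

Lemma niceW m m' r G : (m' <= m)%N -> nice m r G -> nice m' r G.
Proof.
elim: m' m G => [m G _|m' IH [//|m] G]; first exact: nice_supp.
by rewrite ltnS => mm' /= [h1 h2 h3]; split => // i; exact: IH (h3 i).
Qed.

(** Transposition carries compactness of boxes, available as [rV_compact] for row vectors, over to
    columns. *)
Lemma continuous_trmx_rV : continuous (fun x : 'rV[R]_n => x^T : Rn).
Proof.
move=> x B [P xP PB]; exists (fun a b => P b a) => [a b|y yP].
  by have := xP b a; rewrite mxE.
by apply: PB => i j; rewrite mxE; exact: yP.
Qed.

Lemma continuous_bounded_box (r : R) (g : Rn -> R) : continuous g ->
  exists K, forall x, (forall i, `|x i ord0| <= r) -> `|g x| <= K.
Proof.
move=> cg.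
pose A := [set v : 'rV[R]_n | forall i, `[- r, r]%classic (v ord0 i)].
have cA : compact A.
  exact: (@rV_compact R n (fun=> `[- r, r]%classic) (fun=> @segment_compact _ _ _)).
have cgt : {within A, continuous (fun v : 'rV[R]_n => g v^T)}.
  apply: continuous_subspaceT => v.
  by apply: (@continuous_comp _ _ _ (fun v : 'rV[R]_n => v^T : Rn) g v);
    [exact: continuous_trmx_rV|exact: cg].
have [K [Kr HK]] := compact_bounded (continuous_compact cgt cA).
exists (K + 1) => x xr.
apply: (HK (K + 1)); first by rewrite ltrDl.
by exists x^T; rewrite ?trmxK// => i /=; rewrite in_itv/= -ler_norml mxE.
Qed.

Lemma bounded_compact_support (r : R) (g : Rn -> R) : continuous g ->
  (forall x, (exists i, r < `|x i ord0|) -> g x = 0) ->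
  exists K, forall x, `|g x| <= K.
Proof.
move=> /(continuous_bounded_box r)[K hK] gr; exists (Num.max K 0) => x.
have [xr|xr] := pselect (forall i, `|x i ord0| <= r); first by rewrite le_max hK.
rewrite gr ?normr0 ?le_max ?lexx ?orbT//.
by move/existsNP: xr => [i /negP]; rewrite -ltNge; exists i.
Qed.

Lemma pderivs_rcons (a : seq 'I_n) i G : pderivs (rcons a i) G = pderivs a (pderiv i G).
Proof. by rewrite /pderivs foldr_rcons. Qed.

Lemma smooth_pderiv i G : smooth G -> smooth (pderiv i G).
Proof. by move=> sG a; rewrite -pderivs_rcons; exact: sG. Qed.

Lemma near_coord_gt x i (r : R) : r < `|x i ord0| ->
  nbhs x [set y : Rn | r < `|y i ord0|].
Proof.
move=> rx.
have c : `|y i ord0| @[y --> x] --> `|x i ord0|.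
  by apply: cvg_norm; exact: coord_continuous.
exact: (cvgr_gt _ c).
Qed.

Lemma derive_near0 (g : Rn -> R) x h : nbhs x [set y | g y = 0] -> 'D_h g x = 0.
Proof.
move=> g0; have : {near x, g =1 cst 0} by exact: g0.
by move=> /(near_eq_derive h) ->; exact: derive_cst.
Qed.

(** The strict inequality makes the region where [G] is prescribed to vanish open, so derivatives
    vanish there too and the same [r] works for every order. *)
Lemma pderiv_supp i (r : R) G : (forall x, (exists i, r < `|x i ord0|) -> G x = 0) ->
  forall x, (exists i, r < `|x i ord0|) -> pderiv i G x = 0.
Proof.
move=> Gr x [l rl]; rewrite /pderiv !derive_near0//.
- by apply: filterS (near_coord_gt rl) => y ry /=; rewrite Gr//; exists l.
- by apply: filterS (near_coord_gt rl) => y ry /=; rewrite Gr//; exists l.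
Qed.

Lemma smooth_nice m (r : R) G : smooth G ->
  (forall x, (exists i, r < `|x i ord0|) -> G x = 0) -> nice m r G.
Proof.
elim: m G => [|m IH] G sG Gr.
  split => //.
  have [[cR cI] _] := sG [::].
  have [K1 h1] : exists K, forall x, `|complex.Re (G x)| <= K.
    by apply: (@bounded_compact_support r) => // x xr; rewrite Gr.
  have [K2 h2] : exists K, forall x, `|complex.Im (G x)| <= K.
    by apply: (@bounded_compact_support r) => // x xr; rewrite Gr.
  exists (K1 + K2) => x; apply: le_trans (normc_ReIm _) _; exact: lerD.
have n0 : nice 0 r G.
  split => //.
  have [[cR cI] _] := sG [::].
  have [K1 h1] : exists K, forall x, `|complex.Re (G x)| <= K.
    by apply: (@bounded_compact_support r) => // x xr; rewrite Gr.
  have [K2 h2] : exists K, forall x, `|complex.Im (G x)| <= K.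
    by apply: (@bounded_compact_support r) => // x xr; rewrite Gr.
  exists (K1 + K2) => x; apply: le_trans (normc_ReIm _) _; exact: lerD.
split => //; first by have [_] := sG [::].
move=> i; apply: IH; first exact: smooth_pderiv.
exact: pderiv_supp.
Qed.

Lemma ReZ (c : R) (z : C) : complex.Re (c%:C * z) = c * complex.Re z.
Proof. by rewrite ReM/= mul0r subr0. Qed.

Lemma ImZ (c : R) (z : C) : complex.Im (c%:C * z) = c * complex.Im z.
Proof. by rewrite ImM/= mul0r addr0. Qed.

Lemma derive_quot_shift (g : Rn -> R) x h w :
  (fun k : R => k^-1 *: (((fun y => g (y + h)) \o shift x) (k *: w) - g (x + h))) =
  (fun k : R => k^-1 *: ((g \o shift (x + h)) (k *: w) - g (x + h))).
Proof. by apply/funext => k /=; rewrite addrA. Qed.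

Lemma derive_shift (g : Rn -> R) x h w : 'D_w (fun y => g (y + h)) x = 'D_w g (x + h).
Proof.
by rewrite /derive (derive_quot_shift g).
Qed.

Lemma derivable_shift (g : Rn -> R) x h w :
  derivable g (x + h) w -> derivable (fun y => g (y + h)) x w.
Proof.
by rewrite /derivable (derive_quot_shift g).
Qed.

Lemma CderivableT G h : Cderivable G -> Cderivable (fun x => G (x + h)).
Proof. by move=> dG i x; split; [
  exact: (@derivable_shift (fun y => complex.Re (G y)) _ _ _ (dG i _).1)|
  exact: (@derivable_shift (fun y => complex.Im (G y)) _ _ _ (dG i _).2)]. Qed.

Lemma pderivT G h i : pderiv i (fun x => G (x + h)) = (fun x => pderiv i G (x + h)).
Proof.
apply/funext => x; rewrite /pderiv (derive_shift (fun y => complex.Re (G y))).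
by rewrite (derive_shift (fun y => complex.Im (G y))).
Qed.

Lemma CderivableD G H : Cderivable G -> Cderivable H -> Cderivable (fun x => G x + H x).
Proof.
move=> dG dH i x; split.
  under eq_fun do rewrite raddfD.
  by apply: derivableD; [exact: (dG i x).1|exact: (dH i x).1].
under eq_fun do rewrite raddfD.
by apply: derivableD; [exact: (dG i x).2|exact: (dH i x).2].
Qed.

Lemma pderivD G H i : Cderivable G -> Cderivable H ->
  pderiv i (fun x => G x + H x) = (fun x => pderiv i G x + pderiv i H x).
Proof.
move=> dG dH; apply/funext => x; rewrite /pderiv -complexD_split; congr (_ +i* _).
  under eq_fun do rewrite raddfD.
  by rewrite deriveD; [|exact: (dG i x).1|exact: (dH i x).1].
under eq_fun do rewrite raddfD.
by rewrite deriveD; [|exact: (dG i x).2|exact: (dH i x).2].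
Qed.

Lemma CderivableZ G (c : R) : Cderivable G -> Cderivable (fun x => c%:C * G x).
Proof.
move=> dG i x; split.
  under eq_fun do rewrite ReZ.
  exact: (@derivableZ _ _ _ (fun y => complex.Re (G y)) c _ _ (dG i x).1).
under eq_fun do rewrite ImZ.
exact: (@derivableZ _ _ _ (fun y => complex.Im (G y)) c _ _ (dG i x).2).
Qed.

Lemma pderivZ G (c : R) i : Cderivable G ->
  pderiv i (fun x => c%:C * G x) = (fun x => c%:C * pderiv i G x).
Proof.
move=> dG; apply/funext => x; apply/eqP; rewrite eq_complex ReZ ImZ /pderiv/=.
apply/andP; split; apply/eqP.
  under eq_fun do rewrite ReZ.
  by rewrite (deriveZ c (dG i x).1).
under eq_fun do rewrite ImZ.
by rewrite (deriveZ c (dG i x).2).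
Qed.

Lemma derivable_coord i x (w : Rn) : derivable (fun y : Rn => y i ord0) x w.
Proof.
have := @derivable_id R Rn x w; move/derivable_mxP; exact.
Qed.

Lemma derive_coord i x (w : Rn) : 'D_w (fun y : Rn => y i ord0) x = w i ord0.
Proof.
have := derive_mx (@derivable_id R Rn x w).
by rewrite derive_id => /matrixP/(_ i ord0); rewrite mxE.
Qed.

Lemma Cderivable_coord G i : Cderivable G -> Cderivable (fun x => (x i ord0)%:C * G x).
Proof.
move=> dG l x; split.
  under eq_fun do rewrite ReZ.
  by apply: derivableM; [exact: derivable_coord|exact: (dG l x).1].
under eq_fun do rewrite ImZ.
by apply: derivableM; [exact: derivable_coord|exact: (dG l x).2].
Qed.

Lemma pderiv_coord G i l : Cderivable G ->
  pderiv l (fun x => (x i ord0)%:C * G x) =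
  (fun x => (x i ord0)%:C * pderiv l G x + ((l == i)%:R : R)%:C * G x).
Proof.
move=> dG; apply/funext => x.
have e : (delta_mx l ord0 : Rn) i ord0 = (l == i)%:R by rewrite mxE eq_sym andbT.
apply/eqP; rewrite eq_complex raddfD/= raddfD/=.
apply/andP; split; apply/eqP.
  under eq_fun do rewrite ReZ.
  rewrite (deriveM (@derivable_coord i x _) (dG l x).1) derive_coord e.
  by rewrite ReZ mul0r subr0; congr (_ + _); rewrite mulrC.
under eq_fun do rewrite ImZ.
rewrite (deriveM (@derivable_coord i x _) (dG l x).2) derive_coord e.
by rewrite ImZ mul0r addr0; congr (_ + _); rewrite mulrC.
Qed.

Lemma bounded_supportD r G H : bounded_support r G -> bounded_support r H ->
  bounded_support r (fun x => G x + H x).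
Proof.
move=> [[K hK] Gr] [[L hL] Hr]; split.
  by exists (K + L) => x; apply: le_trans (normcD _ _) _; exact: lerD.
by move=> x xr; rewrite Gr// Hr// addr0.
Qed.

Lemma bounded_supportZ r G (c : R) : bounded_support r G ->
  bounded_support r (fun x => c%:C * G x).
Proof.
move=> [[K hK] Gr]; split.
  by exists (`|c| * K) => x; rewrite normcM normc_real; apply: ler_wpM2l.
by move=> x xr; rewrite Gr// mulr0.
Qed.

Lemma bounded_support_coord r G i : bounded_support r G ->
  bounded_support r (fun x => (x i ord0)%:C * G x).
Proof.
move=> [[K hK] Gr]; split; last by move=> x xr; rewrite Gr// mulr0.
have K0 : 0 <= K by apply: le_trans (hK 0); exact: normc_ge0.
exists (`|r| * K) => x; have [xr|xr] := pselect (exists i, r < `|x i ord0|).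
  by rewrite Gr// mulr0 normc0 mulr_ge0.
rewrite normcM normc_real; apply: ler_pM => //; first exact: normc_ge0.
rewrite real_leNgt ?num_real//; apply/negP => h; apply: xr; exists i.
exact: le_lt_trans (ler_norm _) h.
Qed.

Lemma niceD m r G H : nice m r G -> nice m r H -> nice m r (fun x => G x + H x).
Proof.
elim: m G H => [|m IH] G H /=; first exact: bounded_supportD.
move=> [h1 h2 h3] [g1 g2 g3]; split; [exact: bounded_supportD|exact: CderivableD|].
by move=> i; rewrite pderivD//; exact: IH.
Qed.

Lemma niceZ m r G (c : R) : nice m r G -> nice m r (fun x => c%:C * G x).
Proof.
elim: m G => [|m IH] G /=; first exact: bounded_supportZ.
move=> [h1 h2 h3]; split; [exact: bounded_supportZ|exact: CderivableZ|].
by move=> i; rewrite pderivZ//; exact: IH.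
Qed.

Lemma nice_coord m r G i : nice m r G -> nice m r (fun x => (x i ord0)%:C * G x).
Proof.
elim: m G => [|m IH] G /=; first exact: bounded_support_coord.
move=> [h1 h2 h3]; split; [exact: bounded_support_coord|exact: Cderivable_coord|].
move=> l; rewrite pderiv_coord//; apply: niceD; first exact: IH.
by apply: niceZ; apply: (@niceW m.+1).
Qed.

Lemma nice_coord_prod m r G (b : 'I_n -> nat) (s : seq 'I_n) : nice m r G ->
  nice m r (fun x => (\prod_(i <- s) x i ord0 ^+ b i)%:C * G x).
Proof.
move=> nG; elim: s => [|i s IH].
  by rewrite (_ : (fun x => _) = G)//; apply/funext => x; rewrite big_nil mul1r.
rewrite (_ : (fun x => _) = (fun x => (x i ord0 ^+ b i)%:C *
    ((\prod_(i <- s) x i ord0 ^+ b i)%:C * G x))); last first.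
  by apply/funext => x; rewrite big_cons rmorphM/= mulrA.
elim: (b i) => [|k IHk].
  by under eq_fun do rewrite expr0 mul1r.
under eq_fun do rewrite exprS rmorphM/= -mulrA.
exact: nice_coord.
Qed.

Lemma nice_sum m r (I : Type) (s : seq I) (P : pred I) (F : I -> Rn -> C) :
  nice m r (fun=> 0) -> (forall j, nice m r (F j)) ->
  nice m r (fun x => \sum_(j <- s | P j) F j x).
Proof.
move=> n0 nF; elim: s => [|i s IH].
  by under eq_fun do rewrite big_nil.
under eq_fun do rewrite big_cons; case: (P i) => //.
exact: niceD.
Qed.

(** Mean value theorem along a coordinate line, applied to Re and Im separately; hence the factor
    2. *)
Lemma Cderivable_line_bound G i x (t K : R) : Cderivable G ->
  (forall y, normc (pderiv i G y) <= K) ->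
  normc (G (x + t *: delta_mx i ord0) - G x) <= 2 * `|t| * K.
Proof.
move=> dG hK.
have h (g : Rn -> R) : (forall y, derivable g y (delta_mx i ord0)) ->
    (forall y, `|'D_(delta_mx i ord0) g y| <= K) ->
    forall u z, 0 <= u -> `|g (z + u *: delta_mx i ord0) - g z| <= u * K.
  move=> dg gK u z u0.
  pose f (c : R) := g (z + c *: delta_mx i ord0).
  have df (c : R) : is_derive c 1 f ('D_(delta_mx i ord0) g (z + c *: delta_mx i ord0)).
    have E : (fun k : R => k^-1 *: ((f \o shift c) (k *: 1) - f c)) =
        (fun k : R => k^-1 *: ((g \o shift (z + c *: delta_mx i ord0))
          (k *: delta_mx i ord0) - g (z + c *: delta_mx i ord0))).
      apply/funext => k; rewrite /f /=; congr (_ *: (g _ - _)).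
      by rewrite [k *: (1 : R)]mulr1 scalerDl addrCA.
    split; last by rewrite /derive E.
    by rewrite /derivable E; exact: dg.
  have cf : {within `[0, u], continuous f}.
    by apply: derivable_within_continuous => c _; exact: ex_derive.
  have [c _ E] := MVT_segment u0 (fun c _ => df c) cf.
  move: E; rewrite /f scale0r addr0 subr0 => ->.
  by rewrite normrM mulrC (ger0_norm u0) ler_wpM2l.
have h' (g : Rn -> R) : (forall y, derivable g y (delta_mx i ord0)) ->
    (forall y, `|'D_(delta_mx i ord0) g y| <= K) ->
    `|g (x + t *: delta_mx i ord0) - g x| <= `|t| * K.
  move=> dg gK; have [t0|t0] := leP 0 t; first by rewrite (ger0_norm t0); exact: h.
  rewrite (ltr0_norm t0) distrC.
  have := h g dg gK (- t) (x + t *: delta_mx i ord0).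
  by rewrite scaleNr addrK; apply; rewrite oppr_ge0 ltW.
apply: le_trans (normc_ReIm _) _; rewrite !raddfB/= -mulrA mulr_natl mulr2n.
apply: lerD.
- apply: (h' (fun y => complex.Re (G y))) => y; first exact: (dG i y).1.
  by apply: le_trans (hK y); have := normc_Re (pderiv i G y).
- apply: (h' (fun y => complex.Im (G y))) => y; first exact: (dG i y).2.
  by apply: le_trans (hK y); have := normc_Im (pderiv i G y).
Qed.

End nice.

(** * Trigonometric kernels with sampled symbols and their decay *)

Section kernel.
Context {R : realType} {n : nat}.
Local Notation Rn := 'cV[R]_n.
Local Notation Zn := 'cV[int]_n.
Local Notation C := R[i].
Implicit Types (G H : Rn -> C) (x y : Rn) (i l : 'I_n) (a : 'I_n -> R).

(* [1 - a_i^2 delta_i^2] with the centred second difference of step [1 / a_i];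
   on [k |-> G (A^-1 k)] it is the Fourier dual of multiplication by
   [1 + a_i^2 (2 - 2 cos (2 pi y_i))]. *)
Definition sdiff a i G : Rn -> C := fun x =>
  G x + (- a i ^+ 2)%:C * (G (x + (a i)^-1 *: delta_mx i ord0) +
    ((-2)%:C * G x + G (x - (a i)^-1 *: delta_mx i ord0))).

Opaque Cderivable.

Definition sdiffs a (L : seq 'I_n) G : Rn -> C := foldr (sdiff a) G L.

Lemma Cderivable_sdiff a i G : Cderivable G -> Cderivable (sdiff a i G).
Proof.
move=> dG; apply: (CderivableD dG); apply: CderivableZ.
apply: (CderivableD (CderivableT _ dG)).
exact: (CderivableD (CderivableZ _ dG) (CderivableT _ dG)).
Qed.

Lemma pderiv_sdiff a i l G : Cderivable G ->
  pderiv l (sdiff a i G) = sdiff a i (pderiv l G).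
Proof.
move=> dG.
have d1 := CderivableZ (-2) dG.
have d2 h := CderivableT h dG.
have d3 h := CderivableD d1 (d2 h).
have d4 h h' := CderivableD (d2 h) (d3 h').
rewrite /sdiff (pderivD l dG (CderivableZ (- a i ^+ 2) (d4 _ _))).
rewrite (pderivZ (- a i ^+ 2) l (d4 _ _)) (pderivD l (d2 _) (d3 _)).
by rewrite (pderivD l d1 (d2 _)) (pderivZ (-2) l dG) !pderivT.
Qed.

Lemma Cderivable_sdiffs a L G : Cderivable G -> Cderivable (sdiffs a L G).
Proof.
by move=> dG; elim: L => [|i L IH]; [exact: dG|exact: Cderivable_sdiff IH].
Qed.

Lemma pderiv_sdiffs a l L G : Cderivable G ->
  pderiv l (sdiffs a L G) = sdiffs a L (pderiv l G).
Proof.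
move=> dG; elim: L => [//|i L IH].
rewrite [sdiffs a (i :: L) G]/= [RHS]/= -IH.
exact: pderiv_sdiff (Cderivable_sdiffs a L dG).
Qed.

(** The factor a_i^2 cancels the squared step of the second difference, so the bound involves a
    second derivative and is uniform in [a]. The 4 is the square of the 2 in
    [Cderivable_line_bound]. *)
Lemma sdiff_bound a i G (K K2 : R) : a i != 0 -> Cderivable G ->
  Cderivable (pderiv i G) -> (forall x, normc (G x) <= K) ->
  (forall x, normc (pderiv i (pderiv i G) x) <= K2) ->
  forall x, normc (sdiff a i G x) <= K + 4 * K2.
Proof.
move=> a0 dG dG2 GK GK2 x; apply: le_trans (normcD _ _) _; apply: lerD => //.
rewrite normcM normc_real normrN ger0_norm ?sqr_ge0//.
set t := (a i)^-1; set e := delta_mx i ord0.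
(* The centred second difference is a forward difference [D] at x minus the same at x - t e. *)
pose D (y : Rn) := G (y + t *: e) + (-1)%:C * G y.
have dD : Cderivable D.
  by apply: CderivableD; [exact: CderivableT|exact: CderivableZ].
have -> : G (x + t *: e) + ((-2)%:C * G x + G (x - t *: e)) = D x - D (x - t *: e).
  rewrite /D subrK (_ : (-2)%:C = -2 :> C); last first.
    by rewrite rmorphN /= rmorph_nat.
  by rewrite (_ : (-1)%:C = -1 :> C) ?rmorphN//; ring.
have pD y : normc (pderiv i D y) <= 2 * `|t| * K2.
  rewrite /D pderivD; [|exact: CderivableT|exact: CderivableZ].
  rewrite pderivT pderivZ// (_ : (-1)%:C = -1 :> C) ?rmorphN// mulN1r.
  exact: Cderivable_line_bound.
have := Cderivable_line_bound (x - t *: e) t dD pD; rewrite subrK => h.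
apply: le_trans (ler_wpM2l (sqr_ge0 _) h) _.
have -> : a i ^+ 2 * (2 * `|t| * (2 * `|t| * K2)) = (a i * t) ^+ 2 * (4 * K2).
  by rewrite exprMn -[t ^+ 2]real_normK ?num_real//; ring.
by rewrite /t mulfV// expr1n mul1r.
Qed.

(** The operators [sdiff] commute with partial derivatives and each one uses two of them, hence the
    order [m.*2]. The bound depends neither on the steps nor on the order of the indices in [L]. *)
Lemma sdiffs_bound m (r : R) G : nice m.*2 r G ->
  exists K, forall a L, (forall i, a i != 0) -> (size L <= m)%N ->
    forall x, normc (sdiffs a L G x) <= K.
Proof.
elim: m G => [|m IH] G nG.
  have [[K hK] _] := nice_supp nG; exists K => a [|//] _ _ x; exact: hK.
have nG2 i : nice m.*2 r (pderiv i (pderiv i G)).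
  by move: nG => /= [_ _ /(_ i)[_ _ /(_ i)]].
have [K hK] := IH G (@niceW R n m.*2.+2 m.*2 r G (leqW (leqnSn _)) nG).
have [K2 hK2] := choice (fun i => IH _ (nG2 i)).
have [dG dG2] : Cderivable G /\ forall i, Cderivable (pderiv i G).
  by move: nG => /= [_ h1 h2]; split; [exact: h1|move=> i; have [] := h2 i].
have K0 : 0 <= K.
  apply: le_trans (hK (fun=> 1) [::] (fun=> oner_neq0 R) (leq0n m) 0).
  exact: normc_ge0.
have K20 i : 0 <= K2 i.
  apply: le_trans (hK2 i (fun=> 1) [::] (fun=> oner_neq0 R) (leq0n m) 0).
  exact: normc_ge0.
have S0 : 0 <= \sum_i K2 i by exact: sumr_ge0.
exists (K + 4 * \sum_i K2 i) => a [|i L] a0 sL x.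
  apply: le_trans (hK a [::] a0 _ x) _ => //.
  by rewrite lerDl mulr_ge0.
apply: le_trans (@sdiff_bound a i _ K (K2 i) (a0 i) _ _ _ _ x) _.
- exact: (Cderivable_sdiffs a L dG).
- by rewrite (pderiv_sdiffs a i L dG); exact: (Cderivable_sdiffs a L (dG2 i)).
- by move=> y; exact: hK.
- by move=> y; rewrite (pderiv_sdiffs a i L dG) (pderiv_sdiffs a i L (dG2 i)); exact: hK2.
- rewrite lerD2l; apply: ler_wpM2l => //.
  by rewrite (bigD1 i)//= lerDl sumr_ge0.
Qed.

(** One difference enlarges the support by its step, at most 1/eps. *)
Lemma sdiff_supp a i G (r eps : R) : 0 < eps -> eps <= `|a i| ->
  (forall x, (exists l, r < `|x l ord0|) -> G x = 0) ->
  forall x, (exists l, r + eps^-1 < `|x l ord0|) -> sdiff a i G x = 0.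
Proof.
move=> e0 ea Gr x [l rl].
have ai : `|(a i)^-1| <= eps^-1.
  by rewrite normfV lef_pV2// posrE// (lt_le_trans e0).
have h (c : R) : `|c| <= eps^-1 -> G (x + c *: delta_mx i ord0) = 0.
  move=> ce; apply: Gr; exists l; rewrite !mxE eqxx andbT.
  have : `|c * (l == i)%:R| <= eps^-1.
    by case: (l == i); rewrite ?mulr1// mulr0 normr0 invr_ge0 ltW.
  have := lerB_dist (x l ord0) (- (c * (l == i)%:R)); rewrite opprK normrN; lra.
have h1 := h _ ai; have h2 : G (x - (a i)^-1 *: delta_mx i ord0) = 0.
  by rewrite -scaleNr; apply: h; rewrite normrN.
rewrite /sdiff h1 h2.
have -> : G x = 0 by rewrite -[x]addr0 -(scale0r (delta_mx i ord0)); apply: h; rewrite normr0 invr_ge0 ltW.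
by rewrite !(mulr0, addr0).
Qed.

Lemma sdiffs_supp a L G (r eps : R) : 0 < eps -> (forall i, eps <= `|a i|) ->
  (forall x, (exists l, r < `|x l ord0|) -> G x = 0) ->
  forall x, (exists l, r + (size L)%:R / eps < `|x l ord0|) -> sdiffs a L G x = 0.
Proof.
move=> e0 ea Gr; elim: L => [|i L IH] /=; first by rewrite mul0r addr0.
move=> x [l xl]; apply: (sdiff_supp e0 (ea i) IH); exists l.
by rewrite (le_lt_trans _ xl)// -addrA -natr1 mulrDl mul1r.
Qed.

Definition intbox (N : 'I_n -> nat) : {fset Zn} :=
  seq_fset tt (map (fun g : {dffun forall i : 'I_n, 'I_((N i).*2.+1)} =>
    \col_i ((g i : nat)%:Z - (N i)%:Z)) (enum predT)).

Lemma in_intbox N (k : Zn) : (forall i, (`|k i ord0| <= (N i)%:Z)%R) -> k \in intbox N.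
Proof.
move=> kN.
have hb i : (absz (k i ord0 + (N i)%:Z)%R < (N i).*2.+1)%N.
  by have := kN i; lia.
rewrite seq_fsetE; apply/mapP; exists [ffun i => Ordinal (hb i)]; first by rewrite mem_enum.
apply/colP => i; rewrite !mxE ffunE /=.
have E : k i ord0 = Posz (absz (k i ord0 + (N i)%:Z)%R) - (N i)%:Z.
  by have := kN i; lia.
exact: E.
Qed.

Lemma card_intbox N : (#|` intbox N| <= \prod_i (N i).*2.+1)%N.
Proof.
rewrite size_seq_fset; apply: leq_trans (size_undup _) _.
rewrite size_map -cardE card_dep_ffun foldrE big_map enumT.
by under eq_bigr do rewrite card_ord.
Qed.

(** Meant for [G] of bounded support, where only finitely many terms survive; summing over all of
    Z^n keeps the kernel independent of the box used to enumerate them. *)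
Definition kern a G y : C :=
  \sum_(k \in [set: Zn]) G (scale_cV (fun i => (a i)^-1) (int_vec k)) * expk k y.

Definition freqbox a (r : R) : {fset Zn} := intbox (fun i => Num.trunc (r * `|a i|)).

Lemma notin_freqbox a (r : R) (k : Zn) : 0 <= r -> (forall i, a i != 0) ->
  k \notin freqbox a r ->
  exists i, r < `|scale_cV (fun i => (a i)^-1) (int_vec k) i ord0|.
Proof.
move=> r0 a0 kr; apply: contrapT => h; move/negP: kr; apply.
apply: in_intbox => i; apply: contrapT => ki; apply: h; exists i.
rewrite !mxE mulrC normrM normfV ltr_pdivlMr ?normr_gt0//.
have := truncnS_gt (r * `|a i|) => /lt_le_trans; apply.
rewrite -intr_norm pmulrn ler_int.
by rewrite -add1n PoszD lez1D ltNge; exact/negP.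
Qed.

Lemma kernE a G (r r' : R) y : 0 <= r -> r <= r' -> (forall i, a i != 0) ->
  (forall x, (exists l, r < `|x l ord0|) -> G x = 0) ->
  kern a G y =
  trig (freqbox a r') (fun k => G (scale_cV (fun i => (a i)^-1) (int_vec k))) y.
Proof.
move=> r0 rr a0 Gr; rewrite /kern (fsbigTE (freqbox a r'))// => k kS.
have [i ki] := notin_freqbox (le_trans r0 rr) a0 kS.
by rewrite Gr ?mul0r//; exists i; exact: le_lt_trans ki.
Qed.

(** Since 2 - 2 cos t = |e^{it} - 1|^2, this is a periodic substitute for 1 + (2 pi a_i y_i)^2. *)
Definition wt a i y : R := 1 + a i ^+ 2 * (2 - 2 * cos (2 * pi * y i ord0)).

Lemma wt_ge1 a i y : 1 <= wt a i y.
Proof.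
by rewrite /wt lerDl mulr_ge0 ?sqr_ge0// subr_ge0 -[leRHS]mulr1 ler_pM2l// cos_le1.
Qed.

Lemma expk_delta i y :
  expk (- delta_mx i ord0) y + expk (delta_mx i ord0 : Zn) y =
  (2 * cos (2 * pi * y i ord0))%:C.
Proof.
have e (c : int) : dotp (c *: (delta_mx i ord0 : Zn)) y = c%:~R * y i ord0.
  rewrite /dotp (bigD1 i)//= big1 ?addr0 ?mxE ?eqxx ?mulr1// => j ji.
  by rewrite !mxE (negbTE ji) mulr0 mul0r.
have e1 := e 1; have e2 := e (-1); rewrite scale1r in e1; rewrite scaleN1r in e2.
rewrite !expkE e1 e2 /cis mulNr mul1r mulrN cosN sinN.
by apply/eqP; rewrite eq_complex/= addNr eqxx andbT; apply/eqP; ring.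
Qed.

(** Summation by parts: moving the shift from the symbol to the character multiplies the sum by
    e^{+-2 pi i y_i}, and the two shifts together give 2 cos (2 pi y_i). *)
Lemma kern_sdiff a i G (r eps : R) y : 0 <= r -> 0 < eps -> (forall i, eps <= `|a i|) ->
  (forall x, (exists l, r < `|x l ord0|) -> G x = 0) ->
  kern a (sdiff a i G) y = (wt a i y)%:C * kern a G y.
Proof.
move=> r0 e0 ea Gr.
have a0 l : a l != 0 by rewrite -normr_gt0 (lt_le_trans e0).
pose z (k : Zn) := scale_cV (fun i => (a i)^-1) (int_vec k).
pose e : Zn := delta_mx i ord0.
have ei : 0 <= eps^-1 by rewrite invr_ge0 ltW.
have zD k : z k + (a i)^-1 *: delta_mx i ord0 = z (k + e).
  apply/colP => l; rewrite !mxE eqxx andbT rmorphD/= mulrDr; congr (_ + _).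
  by case: eqP => [->|_]; rewrite ?mulr0.
have zB k : z k - (a i)^-1 *: delta_mx i ord0 = z (k - e).
  apply/colP => l; rewrite !mxE eqxx andbT rmorphB/= mulrBr; congr (_ - _).
  by case: eqP => [->|_]; rewrite ?mulr0.
(* A box large enough for the supports of the symbol and of both of its shifts, so all reindexings
   stay within one finite set. *)
set S := freqbox a (r + eps^-1).
have far k : k \notin S -> forall c : R, `|c| <= eps^-1 ->
    G (z k + c *: delta_mx i ord0) = 0.
  move=> kS c ce; have [l kl] := notin_freqbox (addr_ge0 r0 ei) a0 kS.
  apply: Gr; exists l.
  have -> : (z k + c *: delta_mx i ord0) l ord0 = z k l ord0 + c * (l == i)%:R.
    by rewrite !mxE eqxx andbT.
  have : `|c * (l == i)%:R| <= eps^-1.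
    by case: (l == i); rewrite ?mulr1// mulr0 normr0.
  have := lerB_dist (z k l ord0) (- (c * (l == i)%:R)); rewrite opprK normrN.
  by move: kl; rewrite -/(z k); lra.
have ai : `|(a i)^-1| <= eps^-1 by rewrite normfV lef_pV2// posrE// (lt_le_trans e0).
have S0 k : k \notin S -> G (z k) = 0.
  by move=> /far/(_ 0); rewrite normr0 scale0r addr0; apply.
have SD k : k \notin S -> G (z (k + e)) = 0.
  by move=> /far/(_ _ ai); rewrite zD.
have SB k : k \notin S -> G (z (k - e)) = 0.
  by move=> /far/(_ (- (a i)^-1)); rewrite normrN scaleNr zB; apply.
have sumD : \sum_(k <- S) G (z (k + e)) * expk k y =
    expk (- e) y * \sum_(k <- S) G (z k) * expk k y.
  rewrite -(@fsbigTE _ _ _ _ S (fun k => G (z (k + e)) * expk k y)); last first.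
    by move=> k /SD ->; rewrite mul0r.
  rewrite (@reindex_fsbigT _ _ _ _ _ (fun k => k - e)); last first.
    by exists (fun k => k + e) => k; rewrite ?subrK ?addrK.
  rewrite (fsbigTE S); last by move=> k /S0; rewrite subrK => ->; rewrite mul0r.
  by rewrite mulr_sumr; apply: eq_bigr => k _; rewrite subrK expkDl; ring.
have sumB : \sum_(k <- S) G (z (k - e)) * expk k y =
    expk e y * \sum_(k <- S) G (z k) * expk k y.
  rewrite -(@fsbigTE _ _ _ _ S (fun k => G (z (k - e)) * expk k y)); last first.
    by move=> k /SB ->; rewrite mul0r.
  rewrite (@reindex_fsbigT _ _ _ _ _ (fun k => k + e)); last first.
    by exists (fun k => k - e) => k; rewrite ?subrK ?addrK.
  rewrite (fsbigTE S); last by move=> k /S0; rewrite addrK => ->; rewrite mul0r.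
  by rewrite mulr_sumr; apply: eq_bigr => k _; rewrite addrK expkDl; ring.
rewrite (@kernE a G r (r + eps^-1) y r0 _ a0 Gr) ?lerDl// -/S -/z /kern (fsbigTE S); last first.
  by move=> k kS; rewrite -/(z k) /sdiff zD zB S0// SD// SB// !(mulr0, addr0) mul0r.
have -> : \sum_(k <- S) sdiff a i G (z k) * expk k y =
    \sum_(k <- S) G (z k) * expk k y + (- a i ^+ 2)%:C *
     (\sum_(k <- S) G (z (k + e)) * expk k y +
      ((-2)%:C * (\sum_(k <- S) G (z k) * expk k y) +
       \sum_(k <- S) G (z (k - e)) * expk k y)).
  rewrite [(-2)%:C * _]mulr_sumr -!big_split/= mulr_sumr -big_split/=.
  by apply: eq_bigr => k _; rewrite /sdiff zD zB; ring.
rewrite sumD sumB /trig -/z; set T := \sum_(k <- S) G (z k) * expk k y.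
have := expk_delta i y; rewrite -/e => ed.
have -> : T + (- a i ^+ 2)%:C * (expk (- e) y * T + ((-2)%:C * T + expk e y * T)) =
  (1 + (- a i ^+ 2)%:C * ((expk (- e) y + expk e y) + (-2)%:C)) * T by ring.
rewrite ed; congr (_ * T); rewrite -rmorphD -rmorphM -(rmorph1 (real_complex R)) -rmorphD.
by congr (_%:C); rewrite /wt; ring.
Qed.

Lemma kern_sdiffs a L G (r eps : R) y : 0 <= r -> 0 < eps -> (forall i, eps <= `|a i|) ->
  (forall x, (exists l, r < `|x l ord0|) -> G x = 0) ->
  kern a (sdiffs a L G) y = (\prod_(i <- L) wt a i y)%:C * kern a G y.
Proof.
move=> r0 e0 ea Gr; elim: L => [|i L IH]; first by rewrite big_nil mul1r.
rewrite big_cons rmorphM/= -mulrA -IH.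
apply: (@kern_sdiff a i _ _ eps y _ e0 ea (@sdiffs_supp a L G r eps e0 ea Gr)).
by rewrite addr_ge0// mulr_ge0// invr_ge0 ltW.
Qed.

(** Multiplying the kernel by the weights amounts to differencing its symbol. The differenced symbol
    is bounded, and the sum is estimated trivially by its number of terms, which is of the order of
    the product of the |a_i|. *)
Lemma kernel_bound G (r eps : R) (N : nat) : 0 <= r -> 0 < eps ->
  (forall m, nice m r G) ->
  exists2 K, 0 <= K & forall a, (forall i, eps <= `|a i|) -> forall y,
    (\prod_i wt a i y) ^+ N * normc (kern a G y) <= K * \prod_i `|a i|.
Proof.
move=> r0 e0 nG.
have [K hK] := sdiffs_bound (nG (n * N).*2).
have Gr : forall x, (exists l, r < `|x l ord0|) -> G x = 0 := (nice_supp (nG 0)).2.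
pose r' := r + (n * N)%:R / eps.
have r'0 : 0 <= r' by rewrite addr_ge0// mulr_ge0// invr_ge0 ltW.
(* A box side holds at most 2 r' |a_i| + 1 integers, and 1 <= |a_i| / eps absorbs the last one. *)
pose c := 2 * r' + eps^-1.
have c0 : 0 <= c by rewrite addr_ge0 ?mulr_ge0// invr_ge0 ltW.
exists (c ^+ n * `|K|); first by rewrite mulr_ge0// exprn_ge0.
move=> a ea y.
have a0 l : a l != 0 by rewrite -normr_gt0 (lt_le_trans e0).
(* Every coordinate is repeated [N] times, to produce the [N]-th power of the full weight. *)
pose L := [seq i | i <- enum 'I_n, _ <- iota 0 N].
have sL : size L = (n * N)%N by rewrite size_allpairs size_enum_ord size_iota.
have pL : \prod_(i <- L) wt a i y = (\prod_i wt a i y) ^+ N.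
  rewrite /L big_allpairs_dep -prodrXl enumT; apply: eq_bigr => i _.
  by rewrite big_const_seq count_predT size_iota iter_mulr_1.
have W0 : 0 <= \prod_i wt a i y.
  by apply: prodr_ge0 => i _; exact: le_trans (wt_ge1 a i y).
have := kern_sdiffs L y r0 e0 ea Gr; rewrite pL => E.
have -> : (\prod_i wt a i y) ^+ N * normc (kern a G y) = normc (kern a (sdiffs a L G) y).
  by rewrite E normcM normc_real ger0_norm// exprn_ge0.
have := @sdiffs_supp a L G r eps e0 ea Gr; rewrite sL -/r' => sG.
rewrite (kernE y r'0 (lexx _) a0 sG); apply: le_trans (normc_trig _ _ _) _.
set S := freqbox a r'.
apply: (@le_trans _ _ (\sum_(k <- S) `|K|)).
  apply: ler_sum => k _; apply: le_trans (ler_norm _).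
  by apply: hK => //; rewrite sL.
rewrite big_const_seq count_predT iter_addr_0 -mulr_natl mulrAC ler_wpM2r//.
apply: (@le_trans _ _ ((\prod_i (Num.trunc (r' * `|a i|)).*2.+1)%:R)).
  by rewrite ler_nat; exact: card_intbox.
rewrite natr_prod -[X in _ ^+ X]card_ord -prodr_const -big_split/=.
apply: ler_prod => i _; rewrite ler0n/= -addn1 natrD -muln2 natrM.
have h1 : (Num.trunc (r' * `|a i|))%:R <= r' * `|a i|.
  by rewrite truncn_le// mulr_ge0.
have h2 : 1 <= eps^-1 * `|a i| by rewrite mulrC ler_pdivlMr// mul1r.
have -> : c * `|a i| = 2 * (r' * `|a i|) + eps^-1 * `|a i| by rewrite /c; ring.
by apply: lerD => //; rewrite mulrC ler_pM2l.
Qed.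

End kernel.

(** * L_p norms *)

Section Lp_tools.
Context {R : realType} {n : nat}.
Local Notation Rn := 'cV[R]_n.
Local Notation C := R[i].
Implicit Types (f g : Rn -> C) (u v : Rn -> \bar R) (p q : \bar R).
Local Open Scope ereal_scope.

Lemma torus_gt0 : 0 < (torus : set Rn -> \bar R) setT.
Proof. by rewrite torusT lte01. Qed.

Lemma Lnorm_oo u : Lnorm (torus : {measure set Rn -> \bar R}) +oo u = ess_sup torus (abse \o u).
Proof. by rewrite unlock torus_gt0. Qed.

Lemma Lnorm_fin (r : R) u : Lnorm (torus : {measure set Rn -> \bar R}) r%:E u =
  (\int[torus]_x `|u x| `^ r) `^ r^-1.
Proof. by rewrite unlock. Qed.

Lemma measurable_poweR d (T : measurableType d) (h : T -> \bar R) (r : R) :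
  measurable_fun setT h -> measurable_fun setT (fun x => h x `^ r).
Proof. by move=> mh; exact: (measurableT_comp (measurable_poweR r)). Qed.

Lemma ge0_le_poweR (r : R) (x y : \bar R) : (0 <= r)%R -> 0 <= x -> x <= y ->
  x `^ r <= y `^ r.
Proof.
move=> r0 x0 xy; apply: gt0_ler_poweR => //; rewrite in_itv/= ?leey ?andbT//.
exact: le_trans xy.
Qed.

Lemma Lnorm_mono p u v : 1 <= p -> measurable_fun setT u -> measurable_fun setT v ->
  (forall x, `|u x| <= `|v x|) ->
  Lnorm (torus : {measure set Rn -> \bar R}) p u <= Lnorm torus p v.
Proof.
case: p => [r| |]//; last first.
  move=> _ mu mv uv; rewrite !Lnorm_oo; apply: le_ess_sup.
  by apply: aeW => x /=; exact: uv.
rewrite lee_fin => r1 mu mv uv; rewrite !Lnorm_fin.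
have r0 : (0 <= r)%R by lra.
apply: ge0_le_poweR; first by rewrite invr_ge0.
  by apply: integral_ge0 => x _; exact: poweR_ge0.
apply: ge0_le_integral => //.
- by move=> x _; exact: poweR_ge0.
- by apply: measurable_poweR; exact: measurableT_comp.
- by apply: measurable_poweR; exact: measurableT_comp.
- by move=> x _; apply: ge0_le_poweR.
Qed.

Lemma lpnorm_ge0 p f : 0 <= lpnorm p f.
Proof. exact: Lnorm_ge0. Qed.

Lemma lpnorm_mono p f g : 1 <= p -> cmeas f -> cmeas g ->
  (forall x, normc (f x) <= normc (g x))%R -> lpnorm p f <= lpnorm p g.
Proof.
move=> p1 mf mg fg; apply: Lnorm_mono => //; try exact: emeas_normc.
by move=> x; rewrite !gee0_abs ?lee_fin ?normc_ge0// fg.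
Qed.

Lemma LnormZ p (c : R) u : 1 <= p -> (0 <= c)%R -> measurable_fun setT u ->
  Lnorm (torus : {measure set Rn -> \bar R}) p (fun x => c%:E * u x) =
  c%:E * Lnorm torus p u.
Proof.
case: p => [r| |]//; last first.
  move=> _ c0 mu; rewrite !Lnorm_oo -ess_supZl//; last exact: torus_gt0.
  by congr ess_sup; apply/funext => x /=; rewrite abseM gee0_abs.
rewrite lee_fin => r1 c0 mu; rewrite !Lnorm_fin.
have r0 : (0 < r)%R by lra.
under eq_integral do rewrite abseM gee0_abs// poweRM//.
rewrite ge0_integralZl//.
- rewrite poweRM ?poweR_ge0//; last first.
    by apply: integral_ge0 => x _; exact: poweR_ge0.
  by rewrite -poweRrM mulfV ?gt_eqF// poweRe1.
- by apply: measurable_poweR; exact: measurableT_comp.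
- by move=> x _; exact: poweR_ge0.
- exact: poweR_ge0.
Qed.

Lemma lpnormZ p (c : C) f : 1 <= p -> cmeas f ->
  lpnorm p (fun x => c * f x)%R = (normc c)%:E * lpnorm p f.
Proof.
move=> p1 mf; rewrite /lpnorm -LnormZ ?normc_ge0//; last exact: emeas_normc.
by congr Lnorm; apply/funext => x; rewrite normcM EFinM.
Qed.

Lemma lpnormN p f : lpnorm p (fun x => - f x)%R = lpnorm p f.
Proof. by rewrite /lpnorm; under eq_fun do rewrite normcN. Qed.

Lemma lpnormD p f g : 1 <= p -> cmeas f -> cmeas g ->
  lpnorm p (fun x => f x + g x)%R <= lpnorm p f + lpnorm p g.
Proof.
move=> p1 mf mg.
have := @eminkowski _ _ R torus (fun x => normc (f x)) (fun x => normc (g x)) p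
  (cmeas_normc mf) (cmeas_normc mg) p1.
apply: le_trans; apply: Lnorm_mono => //.
- by apply: emeas_normc; exact: cmeasD.
- by apply/measurable_EFinP; apply: measurable_funD; exact: cmeas_normc.
- move=> x /=; rewrite lee_fin !ger0_norm ?addr_ge0 ?normc_ge0//; exact: normcD.
Qed.

Lemma lpnormB p f g : 1 <= p -> cmeas f -> cmeas g ->
  lpnorm p (fun x => f x - g x)%R <= lpnorm p f + lpnorm p g.
Proof.
by move=> p1 mf mg; rewrite -(lpnormN p g); apply: lpnormD => //; exact: cmeasN.
Qed.

Lemma lpnorm0 p : 1 <= p -> lpnorm p (fun _ : Rn => 0%R : C) = 0.
Proof.
move=> p1; rewrite (_ : (fun=> _) = (fun x => 0 * (fun=> 0) x)%R); last first.
  by apply/funext => x; rewrite mulr0.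
by rewrite lpnormZ ?normc0 ?mul0e//; exact: cmeas_cst.
Qed.

Lemma lpnorm_sum p (I : Type) (s : seq I) (P : pred I) (F : I -> Rn -> C) : 1 <= p ->
  (forall i, cmeas (F i)) ->
  lpnorm p (fun x => \sum_(i <- s | P i) F i x)%R <= \sum_(i <- s | P i) lpnorm p (F i).
Proof.
move=> p1 mF; elim: s => [|i s IH].
  by under eq_fun do rewrite big_nil; rewrite big_nil lpnorm0.
under eq_fun do rewrite big_cons; rewrite big_cons; case: ifP => // _.
by apply: le_trans (lpnormD _ _ _) _ => //; [exact: cmeas_sum|exact: leeD2l].
Qed.

Lemma lpnorm_cst p (c : C) : 1 <= p -> lpnorm p (fun _ : Rn => c) = (normc c)%:E.
Proof.
case: p => [r| |]//.
  rewrite lee_fin => r1; rewrite /lpnorm Lnorm_fin ge0_integral_torus_cst ?poweR_ge0//.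
  by rewrite gee0_abs ?lee_fin ?normc_ge0// -poweRrM mulfV ?poweRe1 ?lee_fin ?normc_ge0// gt_eqF//; lra.
move=> _; rewrite /lpnorm Lnorm_oo (@ess_sup_ae_cst _ _ _ _ _ (normc c)%:E)//; first exact: torus_gt0.
by apply: aeW => x /=; rewrite ger0_norm// normc_ge0.
Qed.

Lemma lpnorm_le_bound p f (K : R) : 1 <= p -> cmeas f ->
  (forall x, normc (f x) <= K)%R -> lpnorm p f <= K%:E.
Proof.
move=> p1 mf fK.
have K0 : (0 <= K)%R by apply: le_trans (fK 0%R); exact: normc_ge0.
apply: (@le_trans _ _ (lpnorm p (fun _ : Rn => K%:C))).
  apply: (lpnorm_mono p1 mf (cmeas_cst _)) => x.
  by rewrite normc_real ger0_norm.
by rewrite lpnorm_cst// normc_real ger0_norm.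
Qed.

(** For finite p the invariance is applied to |u|^p. For p = oo it is applied to indicators of
    superlevel sets, which then have equal measure before and after [tau]. *)
Lemma Lnorm_tau p u (tau : Rn -> Rn) : measurable_fun setT tau ->
  (forall F : Rn -> \bar R, measurable_fun setT F -> (forall x, 0 <= F x) ->
     eperiodic F -> \int[torus]_x F (tau x) = \int[torus]_x F x) ->
  1 <= p -> measurable_fun setT u -> eperiodic u ->
  Lnorm (torus : {measure set Rn -> \bar R}) p (u \o tau) = Lnorm torus p u.
Proof.
move=> mtau inv p1 mu pu; case: p p1 => [r| |]//.
  move=> _; rewrite !Lnorm_fin; congr (_ `^ _).
  apply: (inv (fun x => `|u x| `^ r)).
  - by apply: measurable_poweR; exact: measurableT_comp.
  - by move=> x; exact: poweR_ge0.
  - by move=> x k; rewrite pu.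
move=> _; rewrite !Lnorm_oo.
have mau : measurable_fun setT (abse \o u) by exact: measurableT_comp.
have maut : measurable_fun setT (abse \o (u \o tau)).
  by apply: measurableT_comp => //; exact: measurableT_comp.
rewrite !ess_supEmu0//; congr ereal_inf; apply/funext => y; congr (_ = _).
pose A := (abse \o u) @^-1` `]y, +oo[.
have mA : measurable A by rewrite -[A]setTI; apply: mau => //; exact: emeasurable_itv.
have mtA : measurable (tau @^-1` A) by rewrite -[X in measurable X]setTI; exact: mtau.
have := inv (fun x => (\1_A x)%:E).
rewrite (_ : \int[torus]_x (\1_A (tau x))%:E = \int[torus]_x (\1_(tau @^-1` A) x)%:E)//.
rewrite !integral_indic// !setIT; apply.
- by apply/measurable_EFinP.
- by move=> x; rewrite lee_fin.
- move=> x k; congr (_%:E); rewrite !indicE; congr (_%:R); congr nat_of_bool.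
  by apply/idP/idP; rewrite !inE /A /= pu.
Qed.

Lemma lpnorm_shift p f h : 1 <= p -> cmeas f -> Defs.periodic f ->
  lpnorm p (fun x => f (x + h))%R = lpnorm p f.
Proof.
move=> p1 mf pf.
apply: (@Lnorm_tau p (fun x => (normc (f x))%:E) (fun x => x + h)%R) => //.
- exact: measurable_funD_cV.
- exact: ge0_integral_torusD.
- exact: emeas_normc.
- by move=> x k; rewrite pf.
Qed.

Lemma ae_lpnorm_oo f : \forall x \ae torus, (normc (f x))%:E <= lpnorm +oo f.
Proof.
rewrite /lpnorm Lnorm_oo; apply: filterS (ess_sup_ge torus (abse \o (fun x => (normc (f x))%:E))) => x /=.
by rewrite ger0_norm// normc_ge0.
Qed.

(** The torus has mass 1; for finite p the pointwise bound t <= 1 + t^p suffices. *)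
Lemma Lp_cintegrable p f : 1 <= p -> Lp p f -> cintegrable f.
Proof.
case: p => [r| |]// p1 [pf mf fp]; split => //.
  move: p1; rewrite lee_fin => r1.
  have r0 : (0 < r)%R by lra.
  have Fr : \int[torus]_x (normc (f x))%:E `^ r < +oo.
    move: fp; rewrite /lpnorm Lnorm_fin.
    under eq_integral do rewrite gee0_abs ?lee_fin ?normc_ge0//.
    by move/lty_poweRy; apply; rewrite invr_eq0 gt_eqF.
  apply: (@le_lt_trans _ _ (\int[torus]_x (1%:E + (normc (f x))%:E `^ r))).
    apply: ge0_le_integral => //.
    - by move=> x _; rewrite lee_fin normc_ge0.
    - exact: emeas_normc.
    - by apply: emeasurable_funD => //; apply: measurable_poweR; exact: emeas_normc.
    - move=> x _; rewrite poweR_EFin -EFinD lee_fin.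
      have := normc_ge0 (f x); set t := normc _ => t0.
      have [t1|t1] := leP 1%R t.
        by apply: le_trans (le1r_powR t1 r1) _; rewrite lerDr.
      by rewrite (le_trans (ltW t1))// lerDl powR_ge0.
  rewrite ge0_integralD//; first by rewrite ge0_integral_torus_cst ?lee_fin// lte_add_pinfty ?ltry.
  - by move=> x _; exact: poweR_ge0.
  - by apply: measurable_poweR; exact: emeas_normc.
move: fp => fp.
have fin : lpnorm +oo f \is a fin_num by rewrite ge0_fin_numE// lpnorm_ge0.
apply: (@le_lt_trans _ _ (\int[torus]_(x in [set: Rn]) (lpnorm +oo f))); last first.
  by rewrite ge0_integral_torus_cst ?lpnorm_ge0.
apply: ae_ge0_le_integral => //.
- by move=> x _; rewrite lee_fin normc_ge0.
- exact: emeas_normc.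
- by move=> x _; exact: lpnorm_ge0.
- by apply: filterS (ae_lpnorm_oo f).
Qed.

(** The relation is written with inverses of extended reals, where the inverse of +oo is 0; this
    unfolds it into the two endpoints and the real case. *)
Lemma conjugate_cases p q : 1 <= p -> p^-1 + q^-1 = 1 ->
  [\/ p = 1 /\ q = +oo, p = +oo /\ q = 1 |
    exists r s : R, [/\ p = r%:E, q = s%:E, (1 < r)%R, (1 < s)%R & (r^-1 + s^-1 = 1)%R]].
Proof.
case: p => [r| |]//; last first.
  move=> _; rewrite invey add0e => /(congr1 inve); rewrite inveK.
  by rewrite inver oner_eq0 invr1 => ->; apply: Or32.
rewrite lee_fin le_eqVlt => /predU1P[<-|r1].
  rewrite inver oner_eq0 invr1 => h; apply: Or31; split => //.
  apply/eqP; rewrite -inve_eq0; apply/eqP.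
  case: (q^-1) h => [t| |]//; rewrite -EFinD => -[]; move=> /eqP.
  by rewrite -subr_eq0 addrAC subrr add0r => /eqP ->.
rewrite inver gt_eqF; last by lra.
have rV : (r^-1 < 1)%R by rewrite invf_lt1//; lra.
case: q => [s| |]//; last first.
- by rewrite invey adde0 => -[h]; move: rV; rewrite h ltxx.
rewrite inver; case: eqP => [->|/eqP s0]; first by [].
rewrite -EFinD => -[rs]; apply: Or33; exists r, s; split => //.
have sV : (s^-1 = 1 - r^-1)%R by lra.
have rV0 : (0 < r^-1)%R by rewrite invr_gt0; lra.
by rewrite -[s]invrK sV invf_gt1; lra.
Qed.

Lemma Lnorm_hoelder p q (u v : Rn -> R) : 1 <= p -> p^-1 + q^-1 = 1 ->
  measurable_fun setT u -> measurable_fun setT v ->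
  \int[torus]_x (`|u x * v x|)%:E <=
  Lnorm torus p (EFin \o u) * Lnorm torus q (EFin \o v).
Proof.
move=> p1 pq mu mv.
have key (a b : Rn -> R) : measurable_fun setT a -> measurable_fun setT b ->
    \int[torus]_x (`|a x * b x|)%:E <=
    Lnorm torus 1 (EFin \o a) * Lnorm torus +oo (EFin \o b).
  move=> ma mb; rewrite Lnorm1 Lnorm_oo.
  have E0 : 0 <= ess_sup torus (abse \o (EFin \o b)).
    by rewrite -Lnorm_oo; exact: Lnorm_ge0.
  rewrite muleC -ge0_integralZl//; last by apply: measurableT_comp => //; exact/measurable_EFinP.
  apply: ae_ge0_le_integral => //.
  - by apply/measurable_EFinP; apply: measurableT_comp => //; exact: measurable_funM.
  - by move=> x _; exact: mule_ge0.
  - apply: emeasurable_funM => //.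
    by apply: measurableT_comp => //; exact/measurable_EFinP.
  - apply: filterS (ess_sup_ge torus (abse \o (EFin \o b))) => x /= bx _.
    by rewrite normrM EFinM muleC; apply: lee_wpmul2r.
case: (conjugate_cases p1 pq) => [[-> ->]|[-> ->]|[r [s [-> -> r1 s1 rs]]]].
- exact: key.
- rewrite muleC; under eq_integral do rewrite mulrC; exact: key.
- have := @hoelder _ _ R torus u v r s mu mv _ _ rs.
  by rewrite Lnorm1; apply; lra.
Qed.

Lemma hoelder_lpnorm p q f g : 1 <= p -> p^-1 + q^-1 = 1 -> cmeas f -> cmeas g ->
  \int[torus]_x (normc (f x * g x))%:E <= lpnorm p f * lpnorm q g.
Proof.
move=> p1 pq mf mg.
have := Lnorm_hoelder p1 pq (cmeas_normc mf) (cmeas_normc mg).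
apply: le_trans; apply: ge0_le_integral => //.
- by move=> x _; rewrite lee_fin normc_ge0.
- by apply: emeas_normc; exact: cmeasM.
- apply/measurable_EFinP; apply: measurableT_comp => //.
  by apply: measurable_funM; exact: cmeas_normc.
- by move=> x _; rewrite lee_fin normcM ger0_norm// mulr_ge0// normc_ge0.
Qed.

End Lp_tools.

(** * Weighted kernel bounds *)

Section periodic_weight.
Context {R : realType}.

Lemma sin_mvt (u : R) : 0 <= u -> exists2 t, 0 <= t <= u & sin u = cos t * u.
Proof.
move=> u0.
have cs : {within `[0, u], continuous (@sin R)}.
  by apply: continuous_subspaceT; exact: continuous_sin.
have [t] := MVT_segment u0 (fun x _ => is_derive_sin x) cs.
by rewrite in_itv/= sin0 !subr0 => tu ->; exists t.
Qed.

Lemma cos_double_sin (u : R) : 2 - 2 * cos (u *+ 2) = 4 * sin u ^+ 2.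
Proof. by rewrite cos_mulr2n sin2cos2; ring. Qed.

Lemma sin_sqr_le (u : R) : sin u ^+ 2 <= u ^+ 2.
Proof.
wlog u0 : u / 0 <= u => [h|].
  have [/h//|u0] := leP 0 u.
  by have := h (- u); rewrite sinN !sqrrN; apply; rewrite oppr_ge0 ltW.
have [t _ ->] := sin_mvt u0.
by rewrite exprMn ler_piMl ?sqr_ge0// -real_normK ?num_real// expr_le1// cos_max.
Qed.

Lemma two_cos_le (t : R) : 2 - 2 * cos (2 * pi * t) <= 4 * pi ^+ 2 * t ^+ 2.
Proof.
rewrite (_ : 2 * pi * t = (pi * t) *+ 2); last by ring.
by rewrite cos_double_sin -mulrA -exprMn ler_pM2l// sin_sqr_le.
Qed.

(** The left-hand quantity is 4 sin (pi t)^2 and pi t may reach pi/2, where the cosine degenerates.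
    Halving the angle keeps both cosines in the double-angle formula above cos (pi/4), whence the
    fourth power in the constant. *)
Lemma two_cos_ge : exists2 c : R, 0 < c &
  forall t, `|t| <= 2^-1 -> c * t ^+ 2 <= 2 - 2 * cos (2 * pi * t).
Proof.
pose k : R := cos (pi / 4).
have p0 : 0 < pi :> R := pi_gt0 R.
have k0 : 0 < k by apply: cos_gt0_pihalf; lra.
exists (4 * pi ^+ 2 * k ^+ 4); first by rewrite !mulr_gt0 ?exprn_gt0.
have kl u : 0 <= u <= pi / 4 -> k <= cos u.
  move=> /andP[u0 u1]; rewrite leNgt ltr_cos ?in_itv/= -?leNgt//; apply/andP; split; lra.
move=> t; wlog t0 : t / 0 <= t => [h|].
  have [/h//|t0 tl] := leP 0 t.
  by rewrite -[t]opprK mulrN cosN sqrrN h// ?oppr_ge0 ?(ltW t0)// normrN.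
rewrite ger0_norm// => t1.
rewrite (_ : 2 * pi * t = (pi * t) *+ 2); last by ring.
rewrite cos_double_sin -!mulrA ler_pM2l//.
have pt0 : 0 <= pi * t / 2 by rewrite !mulr_ge0// ltW.
have pt1 : pi * t / 2 <= pi / 4 by nra.
have [x /andP[x0 x1] hx] := sin_mvt pt0.
rewrite (_ : pi * t = (pi * t / 2) *+ 2); last by field.
rewrite sin_mulr2n hx.
have kx : k <= cos x by apply: kl; rewrite x0 (le_trans x1).
have ky : k <= cos (pi * t / 2) by apply: kl; rewrite pt0.
rewrite [leLHS](_ : _ = (pi * t * (k * k)) ^+ 2); last by ring.
rewrite ler_sqr ?nnegrE.
- rewrite (_ : _ *+ 2 = (pi * t) * (cos (pi * t / 2) * cos x)); last by field.
  by apply: ler_wpM2l; [rewrite mulr_ge0// ltW|apply: ler_pM => //; exact: ltW].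
- by rewrite !mulr_ge0// ltW.
- by rewrite mulrn_wge0// !mulr_ge0// ltW// (lt_le_trans k0).
Qed.

(** Parallelogram law for e^{iu} - 1 and e^{i(u+v)} - e^{iu}: the difference of the two sides is |1
    - 2 e^{iu} + e^{i(u+v)}|^2, written as a sum of two squares. *)
Lemma two_cosD (u v : R) :
  2 - 2 * cos (u + v) <= 2 * (2 - 2 * cos u) + 2 * (2 - 2 * cos v).
Proof.
rewrite cosD -subr_ge0.
have := cos2Dsin2 u; have := cos2Dsin2 v.
set cu := cos u; set su := sin u; set cv := cos v; set sv := sin v => hv hu.
have -> : 2 * (2 - 2 * cu) + 2 * (2 - 2 * cv) - (2 - 2 * (cu * cv - su * sv)) =
  (1 - 2 * cu + (cu * cv - su * sv)) ^+ 2 + (su * cv + cu * sv - 2 * su) ^+ 2.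
  have -> : sv ^+ 2 = 1 - cv ^+ 2 -> su ^+ 2 = 1 - cu ^+ 2 ->
    (1 - 2 * cu + (cu * cv - su * sv)) ^+ 2 + (su * cv + cu * sv - 2 * su) ^+ 2 =
    2 * (2 - 2 * cu) + 2 * (2 - 2 * cv) - (2 - 2 * (cu * cv - su * sv)).
    move=> h1 h2.
    have -> : (1 - 2 * cu + (cu * cv - su * sv)) ^+ 2 + (su * cv + cu * sv - 2 * su) ^+ 2 =
      1 + 4 * cu ^+ 2 - 4 * cu + 2 * (cu * cv - su * sv) - 4 * cu ^+ 2 * cv
      + cu ^+ 2 * cv ^+ 2 + su ^+ 2 * sv ^+ 2 + su ^+ 2 * cv ^+ 2 + cu ^+ 2 * sv ^+ 2
      - 4 * su ^+ 2 * cv + 4 * su ^+ 2 by ring.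
    by rewrite h1 h2; ring.
  - by [].
  - by rewrite -hv; ring.
  - by rewrite -hu; ring.
by rewrite addr_ge0// sqr_ge0.
Qed.

End periodic_weight.

Section kernel_weights.
Context {R : realType} {n : nat}.
Local Notation Rn := 'cV[R]_n.
Implicit Types (a : 'I_n -> R) (y t : Rn).

Lemma wt_ge : exists2 c : R, 0 < c & forall a i y, `|y i ord0| <= 2^-1 ->
  c * (1 + (a i * y i ord0) ^+ 2) <= wt a i y.
Proof.
have [c c0 hc] := @two_cos_ge R.
exists (Num.min 1 c); first by rewrite lt_min ltr01.
move=> a i y /hc yc; rewrite /wt mulrDr mulr1; apply: lerD; first by rewrite ge_min lexx.
rewrite exprMn mulrCA ler_wpM2l ?sqr_ge0//; apply: le_trans yc.
by rewrite ler_wpM2r ?sqr_ge0// ge_min lexx orbT.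
Qed.

(** By [two_cosD] and 2 - 2 cos (2 pi t) <= 4 pi^2 t^2, the increment contributes at most 2 * 4 pi^2
    * 4, since a_i^2 t_i^2 <= 4. *)
Lemma wt_slow a i y t : `|a i * t i ord0| <= 2 ->
  wt a i (y + t) <= (2 + 32 * pi ^+ 2) * wt a i y.
Proof.
move=> h.
have a20 : 0 <= a i ^+ 2 by exact: sqr_ge0.
have h2 : a i ^+ 2 * t i ord0 ^+ 2 <= 4.
  rewrite -exprMn -real_normK ?num_real// (_ : 4 = 2 ^+ 2); last by ring.
  by rewrite lerXn2r// ?nnegrE.
have w1 := wt_ge1 a i y.
rewrite [leLHS]/wt mxE [2 * pi * (_ + _)]mulrDr.
have := ler_wpM2l a20 (two_cosD (2 * pi * y i ord0) (2 * pi * t i ord0)).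
have := ler_wpM2l a20 (two_cos_le (t i ord0)).
have : 8 * pi ^+ 2 * (a i ^+ 2 * t i ord0 ^+ 2) <= 8 * pi ^+ 2 * 4.
  by rewrite ler_wpM2l// mulr_ge0// sqr_ge0.
have : 0 <= 32 * pi ^+ 2 * (wt a i y - 1).
  by apply: mulr_ge0; [rewrite mulr_ge0 ?sqr_ge0|rewrite subr_ge0].
move: w1; rewrite /wt; set cy := cos _; set ct := cos (2 * pi * t i ord0).
set cyt := cos _; set p2 := pi ^+ 2; set A := a i ^+ 2; set T := t i ord0 ^+ 2.
move=> w1 h3 h4 h5 h6; lra.
Qed.

(** Two comparable majorants: [pwt] is periodic, so it survives translation on the torus, while
    [cwt] has an explicit integral but dominates [pwt], up to a constant, only on the cube. *)
Definition pwt a y : R := \prod_i (`|a i| / wt a i y).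
Definition cwt a y : R := \prod_i (`|a i| / (1 + a i ^+ 2 * y i ord0 ^+ 2)).

Lemma cauchy_den_gt0 (u v : R) : 0 < 1 + u ^+ 2 * v ^+ 2.
Proof. by rewrite ltr_pwDl// mulr_ge0// sqr_ge0. Qed.

Lemma cwt_gt0 a y : (forall i, a i != 0) -> 0 < cwt a y.
Proof.
move=> a0; rewrite prodr_gt0// => i _.
by rewrite divr_gt0 ?normr_gt0// cauchy_den_gt0.
Qed.

Lemma pwt_ge0 a y : 0 <= pwt a y.
Proof.
rewrite prodr_ge0// => i _; rewrite divr_ge0//.
exact: le_trans ler01 (wt_ge1 _ _ _).
Qed.

Lemma measurable_cauchy (u : R) : measurable_fun setT (fun t : R => `|u| / (1 + u ^+ 2 * t ^+ 2)).
Proof.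
apply: continuous_measurable_fun => t; apply: cvgM; first exact: cvg_cst.
apply: cvgV; first by rewrite gt_eqF// cauchy_den_gt0.
apply: cvgD; first exact: cvg_cst.
by apply: cvgM; [exact: cvg_cst|exact: exprn_continuous].
Qed.

Lemma measurable_cwt a : measurable_fun setT (cwt a).
Proof.
apply: measurable_prod => i _.
exact: (measurableT_comp (measurable_cauchy (a i)) (measurable_coord i)).
Qed.

Lemma integral_cwt_le a : (forall i, a i != 0) ->
  (\int[torus]_y (cwt a y)%:E <= (pi ^+ n)%:E)%E.
Proof.
move=> a0; rewrite /cwt.
have := @ge0_integral_torus_prod R n (fun i (t : R) => `|a i| / (1 + a i ^+ 2 * t ^+ 2)) pi.
apply.
- by move=> i; exact: measurable_cauchy.
- by move=> i t; rewrite divr_ge0// ltW// cauchy_den_gt0.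
- move=> i; have := @integral_cauchy_le R `|a i|.
  by rewrite normr_gt0 real_normK ?num_real//; apply.
Qed.

Lemma measurable_pwt a : measurable_fun setT (pwt a).
Proof.
apply: measurable_prod => i _.
have c : continuous (fun t : R => `|a i| / (1 + a i ^+ 2 * (2 - 2 * cos (2 * pi * t)))).
  move=> t; apply: cvgM; first exact: cvg_cst.
  apply: cvgV.
    have : 0 <= 2 - 2 * cos (2 * pi * t) by have := cos_le1 (2 * pi * t); lra.
    by move=> h; rewrite gt_eqF// ltr_pwDl// mulr_ge0 ?sqr_ge0.
  apply: cvgD; first exact: cvg_cst.
  apply: cvgM; first exact: cvg_cst.
  apply: cvgB; first exact: cvg_cst.
  apply: cvgM; first exact: cvg_cst.
  apply: (@continuous_comp _ _ _ (fun t : R => 2 * pi * t) cos); last exact: continuous_cos.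
  by apply: cvgM; [exact: cvg_cst|exact: cvg_id].
exact: (measurableT_comp (continuous_measurable_fun c) (measurable_coord i)).
Qed.

Lemma le_integral_torus_cube (F H : Rn -> \bar R) :
  measurable_fun setT F -> measurable_fun setT H ->
  (forall y, 0 <= F y)%E -> (forall y, 0 <= H y)%E ->
  (forall y, cube y -> F y <= H y)%E ->
  (\int[torus]_y F y <= \int[torus]_y H y)%E.
Proof.
move=> mF mH F0 H0 FH; rewrite !ge0_integral_torus//.
apply: ge0_le_integral => //; [exact: measurable_cube|exact: measurable_funTS..].
Qed.

Lemma cube_le_half y i : cube y -> `|y i ord0| <= 2^-1.
Proof. by move=> /(_ i) /andP[h1 h2]; rewrite ler_norml h1 ltW. Qed.

Lemma pwt_le_cwt : exists2 K, 0 <= K & forall a y, cube y -> pwt a y <= K * cwt a y.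
Proof.
have [c c0 hc] := wt_ge.
exists (c^-1 ^+ n); first by rewrite exprn_ge0// invr_ge0 ltW.
move=> a y cy.
rewrite -[X in _ ^+ X]card_ord -prodr_const -big_split/=; apply: ler_prod => i _.
rewrite divr_ge0 ?(le_trans ler01 (wt_ge1 _ _ _))//= mulrCA ler_wpM2l//.
rewrite -invfM lef_pV2 ?posrE ?(lt_le_trans ltr01 (wt_ge1 _ _ _)) ?mulr_gt0 ?cauchy_den_gt0//.
by rewrite -exprMn; exact: hc (cube_le_half i cy).
Qed.

Lemma integral_pwt_le : exists2 K : R, 0 <= K & forall a, (forall i, a i != 0) ->
  (\int[torus]_y (pwt a y)%:E <= K%:E)%E.
Proof.
have [K K0 hK] := pwt_le_cwt.
exists (K * pi ^+ n); first by rewrite mulr_ge0// exprn_ge0// ltW// pi_gt0.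
move=> a a0.
have cw0 y : 0 <= cwt a y by rewrite ltW// cwt_gt0.
apply: (@le_trans _ _ (\int[torus]_y (K%:E * (cwt a y)%:E))%E).
  apply: le_integral_torus_cube.
  - by apply/measurable_EFinP; exact: measurable_pwt.
  - by apply: measurable_funeM; apply/measurable_EFinP; exact: measurable_cwt.
  - by move=> y; rewrite lee_fin pwt_ge0.
  - by move=> y; rewrite -EFinM lee_fin mulr_ge0.
  - by move=> y cy; rewrite -EFinM lee_fin hK.
rewrite ge0_integralZl//.
- by rewrite EFinM lee_wpmul2l// integral_cwt_le.
- by apply/measurable_EFinP; exact: measurable_cwt.
- by move=> y _; rewrite lee_fin.
Qed.

(** The weight is essentially constant at the scale of one cell, which allows a value at a node to
    be replaced by an average over a cell. *)
Lemma pwt_slow a y t : (forall i, `|a i * t i ord0| <= 2) ->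
  pwt a y <= (2 + 32 * pi ^+ 2) ^+ n * pwt a (y + t).
Proof.
move=> h; rewrite -[X in _ ^+ X]card_ord -prodr_const -big_split/=; apply: ler_prod => i _.
have w0 z := lt_le_trans ltr01 (wt_ge1 a i z).
rewrite divr_ge0 ?(ltW (w0 _))//= mulrCA ler_wpM2l// ler_pdivlMr// mulrC.
by rewrite ler_pdivrMr// wt_slow.
Qed.

Lemma pwtN a y : pwt a (- y) = pwt a y.
Proof. by apply: eq_bigr => i _; rewrite /wt mxE mulrN cosN. Qed.

Lemma pwt_periodic a (k : 'cV[int]_n) y : pwt a (y + int_vec k) = pwt a y.
Proof.
apply: eq_bigr => i _; rewrite /wt !mxE.
have /(congr1 (@complex.Re R)) : cis (y i ord0 + (k i ord0)%:~R) = cis (y i ord0).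
  by rewrite cisD cis_int mulr1.
by rewrite /cis /= => ->.
Qed.

Lemma normc_kern_le_pwt (G : Rn -> R[i]) (r eps : R) : 0 <= r -> 0 < eps ->
  (forall m, nice m r G) ->
  exists2 K, 0 <= K & forall a, (forall i, eps <= `|a i|) -> forall y,
    normc (kern a G y) <= K * pwt a y.
Proof.
move=> r0 e0 nG; have [K K0 hK] := kernel_bound 1 r0 e0 nG.
exists K => // a ea y.
have w0 : 0 < \prod_i wt a i y.
  by rewrite prodr_gt0// => i _; exact: lt_le_trans ltr01 (wt_ge1 _ _ _).
rewrite /pwt big_split/= prodfV mulrA ler_pdivlMr// mulrC.
by have := hK a ea y; rewrite expr1.
Qed.

(** The decay exponent is [s.+1]: [s] powers of the weight pay for the moment and the remaining one
    leaves an integrable majorant. *)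
Lemma normc_kern_moment (G : Rn -> R[i]) (r eps : R) (s : nat) : 0 <= r -> 0 < eps ->
  (forall m, nice m r G) ->
  exists2 K, 0 <= K & forall a, (forall i, eps <= `|a i|) -> forall y, cube y ->
    (\prod_i (1 + `|a i * y i ord0|)) ^+ s * normc (kern a G y) <= K * cwt a y.
Proof.
move=> r0 e0 nG; have [K K0 hK] := kernel_bound s.+1 r0 e0 nG.
have [c c0 hc] := wt_ge.
have [K1 K10 hK1] := pwt_le_cwt.
pose b : R := 2 / c.
have b0 : 0 <= b by rewrite divr_ge0// ltW.
exists ((b ^+ n) ^+ s * K * K1); first by rewrite !mulr_ge0// !exprn_ge0.
move=> a ea y cy.
have w0 : 0 < \prod_i wt a i y.
  by rewrite prodr_gt0// => i _; exact: lt_le_trans ltr01 (wt_ge1 _ _ _).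
have step : \prod_i (1 + `|a i * y i ord0|) <= b ^+ n * \prod_i wt a i y.
  rewrite -[X in _ ^+ X]card_ord -prodr_const -big_split/=; apply: ler_prod => i _.
  rewrite addr_ge0//=; apply: le_trans (_ : 2 * (1 + (a i * y i ord0) ^+ 2) <= _).
    rewrite -[X in X ^+ 2]/(a i * y i ord0) -[(a i * _) ^+ 2]real_normK ?num_real//.
    have aux (u : R) : 0 <= u -> 1 + u <= 2 * (1 + u ^+ 2) by nra.
    exact: aux.
  rewrite /b -mulrA ler_pM2l// ler_pdivlMl//; exact: hc (cube_le_half i cy).
apply: le_trans (_ : ((b ^+ n) ^+ s * K) * pwt a y <= _); last first.
  by rewrite -[leRHS]mulrA; apply: ler_wpM2l; [rewrite mulr_ge0// !exprn_ge0|exact: hK1].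
apply: le_trans (_ : (b ^+ n * \prod_i wt a i y) ^+ s * normc (kern a G y) <= _).
  apply: ler_wpM2r; first exact: normc_ge0.
  by apply: lerXn2r => //; rewrite nnegrE ?mulr_ge0 ?exprn_ge0 ?(ltW w0)// prodr_ge0.
rewrite exprMn -!mulrA; apply: ler_wpM2l; first by rewrite !exprn_ge0.
rewrite /pwt big_split/= prodfV mulrA ler_pdivlMr//.
by have := hK a ea y; rewrite exprS; apply: le_trans; rewrite le_eqVlt; apply/orP; left; apply/eqP; ring.
Qed.

End kernel_weights.

(** * The Minkowski inequality and moduli of smoothness *)

Section minkowski_integral.
Context {R : realType} {n : nat}.
Local Notation Rn := 'cV[R]_n.
Local Notation C := R[i].
Local Open Scope ereal_scope.

(** Hölder applied to the factors h w^{1/r} and w^{1/s}. The mass bound [c] enters with exponent r /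
    s = r - 1. *)
Lemma jensen_weight (r c : R) (h w : Rn -> R) : (1 <= r)%R ->
  measurable_fun setT h -> measurable_fun setT w ->
  (forall x, 0 <= h x)%R -> (forall x, 0 <= w x)%R ->
  \int[torus]_x (w x)%:E <= c%:E ->
  (\int[torus]_x (h x * w x)%:E) `^ r <=
  (c `^ (r - 1))%:E * \int[torus]_x (h x `^ r * w x)%:E.
Proof.
move=> r1 mh mw h0 w0 wc.
have c0 : (0 <= c)%R.
  by rewrite -lee_fin; apply: le_trans wc; apply: integral_ge0 => x _; rewrite lee_fin.
move: r1; rewrite le_eqVlt => /predU1P[<-|r1].
  rewrite subrr powRr0 mul1e poweRe1; last first.
    by apply: integral_ge0 => x _; rewrite lee_fin mulr_ge0.
  by under [leRHS]eq_integral do rewrite powRr1//.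
have r0 : (r != 0)%R by apply/eqP => h1; move: r1; rewrite h1 ltr10.
have rm0 : (r - 1 != 0)%R by rewrite subr_eq0 gt_eqF.
pose s := (r / (r - 1))%R.
have s0 : (s != 0)%R by rewrite mulf_neq0// invr_eq0.
have rs : (r^-1 + s^-1 = 1)%R by rewrite /s; field; rewrite r0 rm0.
have mp (e : R) : measurable_fun setT (fun x => w x `^ e)%R.
  exact: (measurableT_comp (measurable_powR e) mw).
pose u x := (h x * w x `^ r^-1)%R.
pose v x := (w x `^ s^-1)%R.
have mu : measurable_fun setT u by exact: measurable_funM.
have mv : measurable_fun setT v by exact: mp.
have pq : r%:E^-1 + s%:E^-1 = 1 :> \bar R.
  by rewrite !inver (negbTE r0) (negbTE s0) -EFinD rs.
have := @Lnorm_hoelder R n r%:E s%:E u v (ltW r1) pq mu mv.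
rewrite (eq_integral (fun x => (h x * w x)%:E)); last first.
  move=> x _; rewrite ger0_norm; last by rewrite !mulr_ge0 ?powR_ge0.
  congr EFin; rewrite /u /v -mulrA -powRD rs ?powRr1//.
  by rewrite oner_eq0.
move=> H; apply: le_trans (ge0_le_poweR (r := r) _ _ H) _.
- by rewrite ltW// (lt_trans ltr01).
- by apply: integral_ge0 => x _; rewrite lee_fin mulr_ge0.
rewrite poweRM ?Lnorm_ge0// !Lnorm_fin -!poweRrM mulVf//.
rewrite poweRe1; last by apply: integral_ge0 => x _; exact: poweR_ge0.
rewrite muleC; apply: lee_pmul; rewrite ?poweR_ge0//.
- by apply: integral_ge0 => x _; exact: poweR_ge0.
- rewrite (_ : s^-1 * r = r - 1)%R; last by rewrite /s; field; rewrite r0 rm0.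
  rewrite -poweR_EFin; apply: ge0_le_poweR; first by rewrite subr_ge0 ltW.
    by apply: integral_ge0 => x _; exact: poweR_ge0.
  apply: le_trans wc; rewrite le_eqVlt; apply/orP; left; apply/eqP/eq_integral => x _ /=.
  by rewrite ger0_norm ?powR_ge0// /v -powRrM mulVf// powRr1.
- rewrite le_eqVlt; apply/orP; left; apply/eqP/eq_integral => x _ /=.
  rewrite ger0_norm ?mulr_ge0 ?powR_ge0// /u powRM ?powR_ge0//.
  by rewrite -powRrM mulVf// powRr1.
Qed.

Lemma measurable_int_torus1 (g : Rn * Rn -> R) : measurable_fun setT g ->
  (forall z, 0 <= g z)%R -> measurable_fun setT (fun y => \int[torus]_x (g (y, x))%:E).
Proof.
move=> /measurable_EFinP mg g0.
exact: (@measurable_fun_fubini_tonelli_F _ _ _ _ _ torus (EFin \o g) mg (fun z => g0 z)).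
Qed.

Lemma measurable_int_torus2 (g : Rn * Rn -> R) : measurable_fun setT g ->
  (forall z, 0 <= g z)%R -> measurable_fun setT (fun x => \int[torus]_y (g (y, x))%:E).
Proof.
move=> /measurable_EFinP mg g0.
exact: (@measurable_fun_fubini_tonelli_G _ _ _ _ _ torus (EFin \o g) mg (fun z => g0 z)).
Qed.

(** For finite p, [jensen_weight] followed by Tonelli. Norm bounds are asked only for [y] in the
    cube, where the kernel moments are available. *)
Lemma minkowski_weight p (h : Rn -> Rn -> R) (w : Rn -> R) (c om : R) : 1 <= p ->
  measurable_fun setT (fun z : Rn * Rn => h z.1 z.2) -> measurable_fun setT w ->
  (forall y x, 0 <= h y x)%R -> (forall y, 0 <= w y)%R -> (0 <= om)%R ->
  \int[torus]_y (w y)%:E <= c%:E ->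
  (forall y, cube y -> Lnorm torus p (fun x => (h y x)%:E) <= om%:E) ->
  Lnorm torus p (fun x => \int[torus]_y (h y x * w y)%:E) <= (c * om)%:E.
Proof.
move=> p1 mh mw h0 w0 om0 wc hom.
have c0 : (0 <= c)%R.
  by rewrite -lee_fin; apply: le_trans wc; apply: integral_ge0 => x _; rewrite lee_fin.
have mh1 y : measurable_fun setT (h y) by exact: (measurableT_comp mh (pair1_measurable y)).
have mh2 x : measurable_fun setT (h^~ x) by exact: (measurableT_comp mh (pair2_measurable x)).
have mhw : measurable_fun setT (fun z : Rn * Rn => h z.1 z.2 * w z.1)%R.
  by apply: measurable_funM => //; exact: (measurableT_comp mw).
have mE : measurable_fun setT (fun x => \int[torus]_y (h y x * w y)%:E).
  by apply: (measurable_int_torus2 mhw) => z; rewrite mulr_ge0.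
have I0 x : 0 <= \int[torus]_y (h y x * w y)%:E.
  by apply: integral_ge0 => y _; rewrite lee_fin mulr_ge0.
case: p p1 hom => [r| |]//.
  rewrite lee_fin => r1 hom.
  have r0 : (0 < r)%R by rewrite (lt_le_trans ltr01).
  have rN0 : (r != 0)%R by rewrite gt_eqF.
  rewrite Lnorm_fin.
  rewrite [leRHS](_ : _ = ((c * om) `^ r)%:E `^ r^-1); last first.
    by rewrite poweR_EFin -powRrM mulfV// powRr1// mulr_ge0.
  apply: ge0_le_poweR; first by rewrite invr_ge0 ltW.
    by apply: integral_ge0 => x _; exact: poweR_ge0.
  have mhr : measurable_fun setT (fun z : Rn * Rn => h z.1 z.2 `^ r * w z.1)%R.
    apply: measurable_funM; last exact: (measurableT_comp mw).
    exact: (measurableT_comp (measurable_powR r) mh).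
  have hr0 z : (0 <= h z.1 z.2 `^ r * w z.1)%R by rewrite mulr_ge0// powR_ge0.
  apply: (@le_trans _ _ (\int[torus]_x ((c `^ (r - 1))%:E *
      \int[torus]_y (h y x `^ r * w y)%:E))).
    apply: ge0_le_integral => //.
    - by move=> x _; exact: poweR_ge0.
    - by apply: measurable_poweR; apply: measurableT_comp.
    - by apply: measurable_funeM; exact: (measurable_int_torus2 mhr).
    - move=> x _; rewrite gee0_abs//.
      by apply: jensen_weight => // y; exact: h0.
  rewrite ge0_integralZl//; last 3 first.
  - exact: (measurable_int_torus2 mhr).
  - by move=> x _; apply: integral_ge0 => y _; exact: (hr0 (y, x)).
  - by rewrite lee_fin powR_ge0.
  rewrite -(fubini_tonelli (m1 := torus) (m2 := torus)
    (fun z => (h z.1 z.2 `^ r * w z.1)%:E))//=; last exact/measurable_EFinP.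
  rewrite [leRHS](_ : _ = (c `^ (r - 1))%:E * (c * om `^ r)%:E); last first.
    by rewrite -EFinM powRM// mulrA; congr (_ * _)%:E; rewrite mulrC mulr_powRB1.
  apply: lee_wpmul2l; first by rewrite lee_fin powR_ge0.
  apply: (@le_trans _ _ (\int[torus]_y ((om `^ r)%:E * (w y)%:E))); last first.
    rewrite ge0_integralZl//; last 3 first.
    - exact/measurable_EFinP.
    - by move=> y _; rewrite lee_fin.
    - by rewrite lee_fin powR_ge0.
    by rewrite mulrC EFinM lee_wpmul2l// lee_fin powR_ge0.
  apply: le_integral_torus_cube.
  - exact: (measurable_int_torus1 mhr).
  - by apply: measurable_funeM; exact/measurable_EFinP.
  - by move=> y; apply: integral_ge0 => x _; exact: (hr0 (y, x)).
  - by move=> y; rewrite -EFinM lee_fin mulr_ge0// powR_ge0.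
  move=> y cy; under eq_integral do rewrite EFinM muleC.
  rewrite ge0_integralZl//; last 3 first.
  - by apply/measurable_EFinP; exact: (measurableT_comp (measurable_powR r) (mh1 y)).
  - by move=> x _; rewrite lee_fin powR_ge0.
  - by rewrite lee_fin.
  rewrite muleC; apply: lee_wpmul2r; first by rewrite lee_fin.
  have := hom y cy; rewrite Lnorm_fin => hy.
  have := ge0_le_poweR (r := r) (ltW r0) (poweR_ge0 _ _) hy.
  rewrite -poweRrM mulVf// poweRe1; last first.
    by apply: integral_ge0 => x _; exact: poweR_ge0.
  rewrite poweR_EFin; apply: le_trans; rewrite le_eqVlt; apply/orP; left; apply/eqP.
  by apply: eq_integral => x _; rewrite gee0_abs ?lee_fin// poweR_EFin.
move=> _ hom; rewrite Lnorm_oo.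
(* For p = oo the exceptional null set in [x] depends on [y]. Integrating the positive part [D] of
   the excess in the other order yields one null set of [x] outside which the excess has zero
   integral in [y]. *)
pose D (z : Rn * Rn) : R := Num.max 0%R (h z.1 z.2 * w z.1 - om * w z.1)%R.
have mD : measurable_fun setT D.
  apply: measurable_maxr => //; apply: measurable_funB => //.
  by apply: measurable_funM => //; exact: (measurableT_comp mw).
have D0 z : 0 <= (D z)%:E by rewrite lee_fin le_max lexx.
have mDE : measurable_fun setT (EFin \o D) by exact/measurable_EFinP.
have mG := @measurable_fun_fubini_tonelli_G _ _ _ _ _ torus (EFin \o D) mDE D0.
have Dx0 y : cube y -> \int[torus]_x (D (y, x))%:E = 0.
  move=> cy.
  have mDy : measurable_fun setT (fun x => (D (y, x))%:E).
    by apply/measurable_EFinP; exact: (measurableT_comp mD (pair1_measurable y)).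
  rewrite (eq_integral (fun x => `|(D (y, x))%:E|)); last by move=> x _; rewrite gee0_abs.
  apply/(ae_eq_integral_abs torus measurableT mDy).
  have := hom y cy; rewrite Lnorm_oo => /ess_supP; apply: filterS => x /=.
  rewrite ger0_norm// lee_fin => hx _; congr EFin; rewrite /D/=.
  by apply/max_idPl; rewrite subr_le0 ler_wpM2r.
have : \int[torus]_x `| \int[torus]_y (D (y, x))%:E | = 0.
  under eq_integral do rewrite gee0_abs ?integral_ge0//.
  rewrite -(fubini_tonelli (m1 := torus) (m2 := torus) (EFin \o D))//=.
  apply/eqP; rewrite eq_le; apply/andP; split; last first.
    by apply: integral_ge0 => y _; exact: integral_ge0.
  rewrite -[leRHS](@ge0_integral_torus_cst R n 0)//.
  apply: le_integral_torus_cube => //.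
  - exact: (@measurable_fun_fubini_tonelli_F _ _ _ _ _ torus (EFin \o D) mDE D0).
  - by move=> y; exact: integral_ge0.
  - by move=> y /Dx0 ->.
move/(ae_eq_integral_abs torus measurableT mG) => ae0.
apply/ess_supP; apply: filterS ae0 => x /(_ Logic.I) /= Dx.
rewrite gee0_abs//.
apply: (@le_trans _ _ (\int[torus]_y ((om * w y)%:E + (D (y, x))%:E))).
  apply: ge0_le_integral => //.
  - by move=> y _; rewrite lee_fin mulr_ge0.
  - by apply/measurable_EFinP; exact: measurable_funM.
  - apply: emeasurable_funD; apply/measurable_EFinP; first exact: measurable_funM.
    exact: (measurableT_comp mD (pair2_measurable x)).
  - move=> y _; rewrite -EFinD lee_fin -lerBlDl le_max lexx orbT//.
rewrite ge0_integralD//; last 3 first.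
- by move=> y _; rewrite lee_fin mulr_ge0.
- by apply/measurable_EFinP; exact: measurable_funM.
- by apply/measurable_EFinP; exact: (measurableT_comp mD (pair2_measurable x)).
have -> : \int[torus]_y (D (y, x))%:E = 0 := Dx.
rewrite adde0.
under eq_integral do rewrite EFinM.
rewrite ge0_integralZl//; last 2 first.
- exact/measurable_EFinP.
- by move=> y _; rewrite lee_fin.
by rewrite mulrC EFinM lee_wpmul2l// lee_fin.
Qed.

Lemma lpnorm_Cint_weight p (F : Rn -> Rn -> C) (h : Rn -> Rn -> R) (w : Rn -> R) (c om : R) :
  1 <= p -> (forall x, cintegrable (F^~ x)) -> cmeas (fun x => Cint (F^~ x)) ->
  measurable_fun setT (fun z : Rn * Rn => h z.1 z.2) -> measurable_fun setT w ->
  (forall y x, 0 <= h y x)%R -> (forall y, 0 <= w y)%R -> (0 <= om)%R ->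
  \int[torus]_y (w y)%:E <= c%:E ->
  (forall y x, cube y -> normc (F y x) <= h y x * w y)%R ->
  (forall y, cube y -> Lnorm torus p (fun x => (h y x)%:E) <= om%:E) ->
  lpnorm p (fun x => Cint (F^~ x)) <= (2 * (c * om))%:E.
Proof.
move=> p1 Fi mC mh mw h0 w0 om0 wc Fh hom.
have mhw : measurable_fun setT (fun z : Rn * Rn => h z.1 z.2 * w z.1)%R.
  by apply: measurable_funM => //; exact: (measurableT_comp mw).
have mE : measurable_fun setT (fun x => \int[torus]_y (h y x * w y)%:E).
  by apply: (measurable_int_torus2 mhw) => z; rewrite mulr_ge0.
have I0 x : 0 <= \int[torus]_y (h y x * w y)%:E.
  by apply: integral_ge0 => y _; rewrite lee_fin mulr_ge0.
apply: (@le_trans _ _ (Lnorm torus p (fun x => 2%:E * \int[torus]_y (h y x * w y)%:E))).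
  apply: Lnorm_mono => //; [exact: emeas_normc|exact: measurable_funeM|].
  move=> x; rewrite !gee0_abs ?lee_fin ?normc_ge0 ?mule_ge0//.
  apply: le_trans (normc_Cint (Fi x)) _; apply: lee_wpmul2l => //.
  apply: le_integral_torus_cube.
  - exact: emeas_normc (proj1 (Fi x)).
  - by apply/measurable_EFinP; exact: (measurableT_comp mhw (pair2_measurable x)).
  - by move=> y; rewrite lee_fin normc_ge0.
  - by move=> y; rewrite lee_fin mulr_ge0.
  - by move=> y cy; rewrite lee_fin Fh.
rewrite LnormZ// EFinM; apply: lee_wpmul2l => //.
exact: minkowski_weight.
Qed.

End minkowski_integral.

(** * Finite differences and the modulus of smoothness *)

Section differences.
Context {R : realType} {n : nat}.
Local Notation Rn := 'cV[R]_n.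
Local Notation C := R[i].
Implicit Types (f g : Rn -> C) (h y x : Rn).

Lemma fdiff0 h f : fdiff 0 h f = f.
Proof.
by apply/funext => x; rewrite /fdiff big_ord1 expr0 bin0 !mul1r mulr0n addr0.
Qed.

Lemma fdiffS s h f : fdiff s.+1 h f = fdiff s h (fun x => f x - f (x + h)).
Proof.
apply/funext => x; rewrite /fdiff.
under [RHS]eq_bigr do rewrite mulrBr -addrA -mulrSr.
rewrite sumrB big_ord_recl/= [in RHS]big_ord_recl/= -addrA; congr (_ + _).
  by rewrite !bin0.
rewrite big_ord_recr/= [in RHS]big_ord_recr/= opprD addrA; congr (_ + _).
  rewrite -sumrB; apply: eq_bigr => i _.
  rewrite /bump leq0n add1n binS natrD mulrDr mulrDl; congr (_ + _).
  by rewrite exprS !mulN1r !mulNr.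
by rewrite /bump leq0n add1n binS bin_small// add0n !binn exprS !mulN1r !mulNr.
Qed.

Lemma fdiff_sum s h (I : Type) (r : seq I) (F : I -> Rn -> C) :
  fdiff s h (fun x => \sum_(i <- r) F i x) = fun x => \sum_(i <- r) fdiff s h (F i) x.
Proof.
apply/funext => x; rewrite /fdiff exchange_big/=; apply: eq_bigr => nu _.
by rewrite mulr_sumr.
Qed.

Lemma fdiff_shift s h f y : fdiff s h (fun x => f (x + y)) = fun x => fdiff s h f (x + y).
Proof. by apply/funext => x; apply: eq_bigr => nu _; rewrite addrAC. Qed.

Lemma cmeas_shift f h : cmeas f -> cmeas (fun x => f (x + h)).
Proof.
by move=> [mr mi]; split; [exact: (measurableT_comp mr (measurable_funD_cV h))
  |exact: (measurableT_comp mi (measurable_funD_cV h))].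
Qed.

Lemma cmeas_fdiff s h f : cmeas f -> cmeas (fdiff s h f).
Proof.
move=> mf; apply: cmeas_sum => nu; apply: cmeasM; first exact: cmeas_cst.
exact: cmeas_shift.
Qed.

Lemma periodic_fdiff s h f : Defs.periodic f -> Defs.periodic (fdiff s h f).
Proof.
by move=> pf k x; apply: eq_bigr => nu _; rewrite addrAC pf.
Qed.

(** A first difference of step m h telescopes into [m] translates of the difference of step h;
    iterating [s] times gives m^s. *)
Lemma lpnorm_fdiff_mulrn p s h f m : (1 <= p)%E -> Defs.periodic f -> cmeas f ->
  (lpnorm p (fdiff s (h *+ m) f) <= (m%:R ^+ s)%:E * lpnorm p (fdiff s h f))%E.
Proof.
move=> p1; elim: s f => [|s IH] f pf mf; first by rewrite !fdiff0 expr0 mul1e.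
have pd u : Defs.periodic (fun x => f x - f (x + u)).
  by move=> k x; rewrite addrAC !pf.
have md u : cmeas (fun x => f x - f (x + u)) by apply: cmeasB => //; exact: cmeas_shift.
rewrite !fdiffS.
have tel : (fun x => f x - f (x + h *+ m)) =
    fun x => \sum_(i <- iota 0 m) (fun x => f x - f (x + h)) (x + h *+ i).
  apply/funext => x; elim: m {IH} => [|m IHm]; first by rewrite big_nil mulr0n addr0 subrr.
  have -> : iota 0 m.+1 = iota 0 m ++ [:: m] by rewrite -addn1 iotaD.
  by rewrite big_cat/= big_seq1 -IHm addrA subrK -addrA -mulrSr.
apply: le_trans (IH _ (pd _) (md _)) _.
rewrite exprSr EFinM -muleA; apply: lee_wpmul2l; first by rewrite lee_fin exprn_ge0.
rewrite tel fdiff_sum.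
apply: le_trans (lpnorm_sum _ _ _ _) _ => //.
  by move=> i; apply: cmeas_fdiff; exact: cmeas_shift (md h).
rewrite (eq_bigr (fun _ => lpnorm p (fdiff s h (fun x => f x - f (x + h))))); last first.
  move=> i _; rewrite -[RHS](@lpnorm_shift _ _ p (fdiff s h (fun x => f x - f (x + h))) (h *+ i))//.
  - by congr lpnorm; rewrite -fdiff_shift.
  - exact: cmeas_fdiff.
  - exact: periodic_fdiff.
rewrite big_const_seq count_predT size_iota.
set X := lpnorm _ _; have X0 : (0 <= X)%E by exact: lpnorm_ge0.
elim: (m) => [|k IHk]; first by rewrite mul0e.
by rewrite iterS mulrS EFinD ge0_muleDl// mul1e; exact: leeD2l.
Qed.

Lemma lpnorm_fdiff_le2 p s h f : (1 <= p)%E -> Defs.periodic f -> cmeas f ->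
  (lpnorm p (fdiff s h f) <= (2 ^+ s)%:E * lpnorm p f)%E.
Proof.
move=> p1; elim: s f => [|s IH] f pf mf; first by rewrite fdiff0 expr0 mul1e.
rewrite fdiffS; apply: le_trans (IH _ _ _) _.
- by move=> k x; rewrite addrAC !pf.
- by apply: cmeasB => //; exact: cmeas_shift.
rewrite exprSr EFinM -muleA; apply: lee_wpmul2l; first by rewrite lee_fin exprn_ge0.
apply: le_trans (lpnormB _ _ _) _ => //; first exact: cmeas_shift.
by rewrite lpnorm_shift// -[2%:E]/(2%:R%:E) mule_natl mule2n.
Qed.

Lemma modulus_ge0 s f (A : 'M[R]_n) p : (0 <= modulus s f A p)%E.
Proof.
apply: le_trans (lpnorm_ge0 p (fdiff s 0 f)) _; apply: ereal_sup_ubound.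
exists 0 => //=; rewrite mulmx0 /enorm big1 ?sqrtr0// => i _.
by rewrite mxE expr0n.
Qed.

Lemma modulus_fin_num s f (A : 'M[R]_n) p : (1 <= p)%E -> Lp p f ->
  (modulus s f A p \is a fin_num)%E.
Proof.
move=> p1 [pf mf fp]; rewrite ge0_fin_numE ?modulus_ge0//.
apply: le_lt_trans (_ : ((2 ^+ s)%:E * lpnorm p f < +oo)%E).
  by apply: ub_ereal_sup => _ [h _ <-]; exact: lpnorm_fdiff_le2.
by rewrite lte_mul_pinfty// lee_fin exprn_ge0.
Qed.

Lemma enorm_le_sum x : enorm x <= \sum_i `|x i ord0|.
Proof.
have S0 : 0 <= \sum_i `|x i ord0| by exact: sumr_ge0.
rewrite /enorm -[leRHS]ger0_norm// -sqrtr_sqr ler_wsqrtr//.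
rewrite expr2 mulr_suml; apply: ler_sum => i _.
rewrite -real_normK ?num_real// expr2 ler_wpM2l// (bigD1 i)//= lerDl.
exact: sumr_ge0.
Qed.

Lemma sum_le_prod1 (u : 'I_n -> R) : (forall i, 0 <= u i) ->
  1 + \sum_i u i <= \prod_i (1 + u i).
Proof.
move=> u0; rewrite -!(big_enum _ _)/=; elim: (enum 'I_n) => [|i l IH].
  by rewrite !big_nil addr0.
rewrite !big_cons; apply: le_trans (_ : (1 + u i) * (1 + \sum_(j <- l) u j) <= _).
  have := u0 i; have : 0 <= \sum_(j <- l) u j by exact: sumr_ge0.
  nra.
by rewrite ler_wpM2l// addr_ge0.
Qed.

Lemma enormZ (c : R) x : 0 <= c -> enorm (c *: x) = c * enorm x.
Proof.
move=> c0; rewrite /enorm -[c in RHS]ger0_norm// -sqrtr_sqr -sqrtrM ?sqr_ge0// mulr_sumr.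
by congr Num.sqrt; apply: eq_bigr => i _; rewrite mxE exprMn.
Qed.

(* Split [y] into more than [|A y|] equal steps. *)
Lemma lpnorm_fdiff_modulus p s f (A : 'M[R]_n) (a : 'I_n -> R) y : (1 <= p)%E ->
  Defs.periodic f -> cmeas f -> (forall x, A *m x = scale_cV a x) ->
  (lpnorm p (fdiff s y f) <=
   ((\prod_i (1 + `|a i * y i ord0|)) ^+ s)%:E * modulus s f A p)%E.
Proof.
move=> p1 pf mf Aa.
pose m := (Num.trunc (enorm (A *m y))).+1.
have en0 : 0 <= enorm (A *m y) by rewrite sqrtr_ge0.
have m0 : 0 < m%:R :> R by rewrite ltr0n.
rewrite [in leLHS](_ : y = (m%:R^-1 *: y) *+ m); last first.
  by rewrite -scaler_nat scalerA mulfV ?scale1r// gt_eqF.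
apply: le_trans (lpnorm_fdiff_mulrn _ _ _ _ _ _) _ => //.
apply: lee_pmul.
- by rewrite lee_fin exprn_ge0.
- exact: lpnorm_ge0.
- rewrite lee_fin lerXn2r ?nnegrE ?prodr_ge0//.
  (* The number of steps is at most 1 + |A y|; it is relaxed to a product over coordinates because
     the kernel weights are products. *)
  apply: le_trans (sum_le_prod1 (fun i => normr_ge0 _)).
  rewrite /m mulrS lerD2l; apply: le_trans (_ : enorm (A *m y) <= _).
    by have := truncn_itv en0 => /andP[].
  rewrite Aa; apply: le_trans (enorm_le_sum _) _.
  by under eq_bigr do rewrite mxE.
- apply: ereal_sup_ubound; exists (m%:R^-1 *: y) => //=.
  rewrite -scalemxAr enormZ ?invr_ge0 ?ltW// mulrC ltr_pdivrMr// mul1r.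
  exact: truncnS_gt.
Qed.

End differences.

(** * Continuous periodic functions are bounded and measurable *)

Section continuous_periodic.
Context {R : realType} {n : nat}.
Local Notation Rn := 'cV[R]_n.
Local Notation Zn := 'cV[int]_n.
Local Notation C := R[i].

Lemma cube_translate (x : Rn) : exists k : Zn, cube (x + int_vec k).
Proof.
exists (\col_i - Num.floor (x i ord0 + 2^-1)) => i; rewrite !mxE rmorphN/=.
have := ge_floor (x i ord0 + 2^-1); have := lt_succ_floor (x i ord0 + 2^-1).
rewrite intrD; lra.
Qed.

Lemma bounded_periodic (g : Rn -> R) : continuous g ->
  (forall (k : Zn) x, g (x + int_vec k) = g x) -> exists K, forall x, `|g x| <= K.
Proof.
move=> cg pg; have [K hK] := continuous_bounded_box 2^-1 cg.
exists K => x; have [k ck] := cube_translate x.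
by rewrite -(pg k); apply: hK => i; exact: cube_le_half.
Qed.

Definition grid_round (N : nat) (x : Rn) : Rn :=
  \col_i ((Num.floor (x i ord0 * N.+1%:R))%:~R / N.+1%:R).

Lemma grid_round_cvg x : grid_round ^~ x @ \oo --> x.
Proof.
move=> B [P xP PB].
have : \forall N \near \oo, forall i, P i ord0 (grid_round N x i ord0).
  apply: filter_forall => i.
  have /(_ _ (xP i ord0)) : (fun N => grid_round N x i ord0) @ \oo --> x i ord0.
    apply/cvgrPdist_lt => e e0; near=> N.
    rewrite mxE; set t := x i ord0.
    have N0 : 0 < N.+1%:R :> R by rewrite ltr0n.
    rewrite -[X in `|X - _|](mulfK (lt0r_neq0 N0)) -mulrBl normrM normfV (gtr0_norm N0).
    rewrite ltr_pdivrMr//; apply: le_lt_trans (_ : 1 < _).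
      have := ge_floor (t * N.+1%:R); have := lt_succ_floor (t * N.+1%:R).
      by rewrite intrD => h1 h2; rewrite ger0_norm; lra.
    rewrite mulrC -ltr_pdivrMr// mul1r.
    near: N; have [k _ hk] := near_infty_natSinv_lt (PosNum e0).
    exists k => // m /hk /=; rewrite invf_plt ?posrE//.
  by [].
by apply: filterS => N h; apply: PB => i j; rewrite (ord1 j); exact: h.
Unshelve. all: by end_near. Qed.

(** The sigma-algebra is defined through coordinates, so [g] is exhibited as the pointwise limit of
    its values at grid points, each approximant being constant on countably many measurable
    cells. *)
Lemma measurable_continuous_cV (g : Rn -> R) : continuous g -> measurable_fun setT g.
Proof.
move=> cg; apply: (@measurable_fun_cvg _ _ _ _ (fun N x => g (grid_round N x))) => [N|x _].
  move=> _ Y mY; rewrite setTI.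
  pose cell (k : Zn) : set Rn := [set x | forall i, k i ord0 = Num.floor (x i ord0 * N.+1%:R)].
  pose pt (k : Zn) : Rn := \col_i ((k i ord0)%:~R / N.+1%:R).
  rewrite (_ : _ @^-1` Y = \bigcup_m (if (choice.unpickle m : option Zn) is Some k then
      if `[< Y (g (pt k)) >] then cell k else set0 else set0)).
    apply: bigcup_measurable => m _; case: (choice.unpickle m) => [k|//]; case: ifP => // _.
    rewrite (_ : cell k = box (fun i => [set t | (k i ord0)%:~R / N.+1%:R <= t < (k i ord0 + 1)%:~R / N.+1%:R])).
      apply: measurable_box => i.
      rewrite (_ : [set t | _] = `[(k i ord0)%:~R / N.+1%:R, (k i ord0 + 1)%:~R / N.+1%:R[%classic).
        exact: measurable_itv.
      by apply/seteqP; split => t /=; rewrite in_itv.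
    apply/seteqP; split => x /= h i; have N0 : 0 < N.+1%:R :> R by rewrite ltr0n.
      by rewrite /= ler_pdivrMr// ltr_pdivlMr// (h i) ge_floor lt_succ_floor.
    have := h i; rewrite /= ler_pdivrMr// ltr_pdivlMr// => /floor_def ->//.
  apply/seteqP; split=> x /=.
    move=> Yx; pose k : Zn := \col_i Num.floor (x i ord0 * N.+1%:R).
    exists (choice.pickle k) => //; rewrite choice.pickleK.
    have -> : pt k = grid_round N x by apply/colP => i; rewrite !mxE.
    by rewrite asboolT// => i; rewrite mxE.
  move=> [m _]; case: (choice.unpickle m) => [k|//]; case: ifP => // /asboolP Yk kx.
  by have -> : grid_round N x = pt k by apply/colP => i; rewrite !mxE kx.
by apply: (@cvg_comp _ _ _ (fun N => grid_round N x) g); [exact: grid_round_cvg|exact: cg].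
Qed.

Lemma Xp_Lp p (f : Rn -> C) : (1 <= p)%E -> Xp p f -> Lp p f.
Proof.
move=> p1; rewrite /Xp; case: eqP => [->|//] [pf [cr ci]].
have mf : cmeas f by split; exact: measurable_continuous_cV.
have [K1 h1] := bounded_periodic cr (fun k x => congr1 _ (pf k x)).
have [K2 h2] := bounded_periodic ci (fun k x => congr1 _ (pf k x)).
split => //; apply: le_lt_trans (_ : _ <= (K1 + K2)%:E)%E _; last exact: ltry.
apply: (lpnorm_le_bound (leey _) mf) => x; apply: le_trans (normc_ReIm _) _; exact: lerD.
Qed.

End continuous_periodic.

(** * Nodes and frequencies *)

Section grid.
Context {R : realType} {n : nat}.
Local Notation Rn := 'cV[R]_n.
Local Notation Zn := 'cV[int]_n.
Local Notation C := R[i].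
Implicit Types (a : 'I_n -> R) (b : 'I_n -> int) (k l : Zn) (x y : Rn).

(* The node [A^-1 k] for [A = diag a]. *)
Definition gnode a k : Rn := scale_cV (fun i => (a i)^-1) (int_vec k).

Lemma gnodeE a k i : gnode a k i ord0 = (k i ord0)%:~R / a i.
Proof. by rewrite !mxE mulrC. Qed.

Lemma gnodeD a k l : gnode a (k + l) = gnode a k + gnode a l.
Proof. by apply/colP => i; rewrite [in RHS]mxE !gnodeE mxE intrD mulrDl. Qed.

(* [D(A)] for [A = diag a]. *)
Definition Dset a : {fset Zn} :=
  [fset k in freqbox a 1 | `[< cube (gnode a k) >]]%fset.

Lemma in_Dset a k : (forall i, a i != 0) -> (k \in Dset a) = `[< cube (gnode a k) >].
Proof.
move=> a0; rewrite !inE; case: asboolP => ck; rewrite ?andbT ?andbF//.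
apply: contrapT => /negP kn; have [i ]:= notin_freqbox ler01 a0 kn.
have := cube_le_half i ck; rewrite /gnode => h1 h2; move: h1; rewrite leNgt.
by rewrite (lt_trans _ h2)// invf_lt1// ltr1n.
Qed.

Definition zmul b l : Zn := \col_i (b i * l i ord0).

Lemma gnode_zmul b l : (forall i, b i != 0) ->
  gnode (fun i => (b i)%:~R) (zmul b l) = int_vec l.
Proof.
move=> b0; apply/colP => i; rewrite gnodeE !mxE intrM mulrAC mulfV ?mul1r//.
by rewrite intr_eq0.
Qed.

(** Adding 1/2 before taking the floor rounds to the nearest integer with ties upwards, which
    matches the half-open cube. *)
Definition gfloor b k : Zn := \col_i Num.floor ((k i ord0)%:~R / (b i)%:~R + 2^-1 : R).

(* The representative of [k] modulo [A Z^n] in [D(A)]. *)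
Definition resid b k : Zn := k - zmul b (gfloor b k).

Lemma resid_in b k : (forall i, b i != 0) -> resid b k \in Dset (fun i => (b i)%:~R).
Proof.
move=> b0; have a0 i : (b i)%:~R != 0 :> R by rewrite intr_eq0.
rewrite in_Dset//; apply/asboolP => i.
rewrite gnodeE !mxE rmorphB/= intrM mulrBl mulrAC mulfV// mul1r.
set t := _ / _; have := ge_floor (t + 2^-1); have := lt_succ_floor (t + 2^-1).
rewrite intrD; lra.
Qed.

(** Two points of a half-open unit cube that differ by an integer vector coincide. *)
Lemma Dset_inj b k l : (forall i, b i != 0) -> k \in Dset (fun i => (b i)%:~R : R) ->
  k + zmul b l \in Dset (fun i => (b i)%:~R : R) -> l = 0.
Proof.
move=> b0; have a0 i : (b i)%:~R != 0 :> R by rewrite intr_eq0.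
rewrite !in_Dset// => /asboolP h1 /asboolP; rewrite gnodeD gnode_zmul// => h2.
apply/colP => i; rewrite mxE.
have := h1 i; have := h2 i; rewrite !mxE => /andP[u1 u2] /andP[v1 v2].
have h3 : -1 < l i ord0 by rewrite -(ltr_int R) rmorphN1; lra.
have h4 : l i ord0 < 1 by rewrite -(ltr_int R); lra.
rewrite -[LHS]/(l i ord0); lia.
Qed.

Lemma zmulD b l l' : zmul b (l + l') = zmul b l + zmul b l'.
Proof. by apply/colP => i; rewrite !mxE mulrDr. Qed.

Lemma zmulN b l : zmul b (- l) = - zmul b l.
Proof. by apply/colP => i; rewrite !mxE mulrN. Qed.

(** The map k -> [resid b (k + l)] is injective from the finite set [D] to itself, hence permutes
    it. *)
Lemma sum_Dset_shift (V : nmodType) b (F : Zn -> V) l : (forall i, b i != 0) ->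
  (forall k l', F (k + zmul b l') = F k) ->
  \sum_(k <- Dset (fun i => (b i)%:~R : R)) F (k + l) =
  \sum_(k <- Dset (fun i => (b i)%:~R : R)) F k.
Proof.
move=> b0 FZ; set D := Dset _.
pose s k := resid b (k + l).
have sF k : F (s k) = F (k + l) by rewrite /s /resid -zmulN FZ.
have sinj : {in D &, injective s}.
  move=> k k' kD k'D ss.
  have e : k' + zmul b (gfloor b (k + l) - gfloor b (k' + l)) = k.
    move: ss; rewrite /s /resid; move: (gfloor b _) (gfloor b _) => p q /colP ss.
    apply/colP => i; have /= := ss i; rewrite !mxE mulrBr.
    set u := k i _; set v := k' i _; set w := l i _; set x := b i * _; set y := b i * _.
    lia.
  have := @Dset_inj b k' (gfloor b (k + l) - gfloor b (k' + l)) b0 k'D.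
  rewrite e => /(_ kD) h; rewrite -e h.
  by apply/colP => i; rewrite !mxE mulr0 addr0.
under eq_bigr do rewrite -sF.
suff E : [fset s k | k in D]%fset = D.
  by rewrite -[in RHS]E (@big_imfset _ _ _ _ _ _ s).
apply/eqP; rewrite eqEfcard; apply/andP; split.
  by apply/fsubsetP => _ /imfsetP[k /= kD ->]; exact: resid_in.
by rewrite (@card_in_imfset _ _ _ s).
Qed.

Lemma card_Dset b : (forall i, b i != 0) ->
  #|` Dset (fun i => (b i)%:~R : R)| = (\prod_i `|b i|)%N.
Proof.
move=> b0; set D := Dset _.
(* [D] is enumerated by the residues 0, ..., |b_i| - 1 in each coordinate; the index type is written
   as a successor so that [inord] applies. *)
pose g (u : {dffun forall i : 'I_n, 'I_(`|b i|.-1.+1)}) := resid b (\col_i (u i : nat)%:Z).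
have ginj : injective g.
  move=> u v /colP uv; apply/ffunP => i; apply/val_inj => /=.
  have := uv i; rewrite !mxE.
  have bi := b0 i.
  have V1 : (v i < `|b i|)%N by apply: leq_trans (ltn_ord (v i)) _; rewrite prednK// absz_gt0.
  have U1 : (u i < `|b i|)%N by apply: leq_trans (ltn_ord (u i)) _; rewrite prednK// absz_gt0.
  move: U1 V1.
  set p := Num.floor _; set q := Num.floor _; set U := nat_of_ord (u i); set V := nat_of_ord (v i).
  move=> U1 V1 h.
  have /dvdzP[z hz] : (b i %| (U%:Z - V%:Z))%Z.
    by apply/dvdzP; exists (p - q); rewrite mulrBl [p * _]mulrC [q * _]mulrC; lia.
  have : z = 0 by nia.
  by move=> z0; rewrite z0 mul0r in hz; lia.
have -> : D = [fset g u | u in {: {dffun forall i : 'I_n, 'I_(`|b i|.-1.+1)}}]%fset.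
  apply/fsetP => k; apply/idP/imfsetP => [kD|[u _ ->]]; last exact: resid_in.
  exists [ffun i => inord `|(k i ord0 %% b i)%Z|%N] => //.
  set u := finfun _.
  have e : k + zmul b (- (\col_i (k i ord0 %/ b i)%Z) - gfloor b (\col_i (u i : nat)%:Z)) = g u.
    rewrite /g /resid zmulD !zmulN addrA; congr (_ - _).
    apply/colP => i; rewrite !mxE ffunE inordK.
      rewrite gez0_abs ?modz_ge0// -[k i 0]/(k i ord0) {1}(divz_eq (k i ord0) (b i)).
      by rewrite [b i * _]mulrC addrAC subrr add0r.
    rewrite prednK ?absz_gt0// -ltz_nat gez0_abs ?modz_ge0//; exact: ltz_mod.
  have := @Dset_inj b k (- (\col_i (k i ord0 %/ b i)%Z) - gfloor b (\col_i (u i : nat)%:Z)) b0 kD.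
  rewrite e => /(_ (resid_in _ b0)) h.
  rewrite -e h; apply/colP => i; by rewrite !mxE mulr0 addr0.
rewrite card_in_imfset; last by move=> u v _ _; exact: ginj.
rewrite -cardE card_dep_ffun foldrE big_image/=; apply: eq_bigr => i _.
by rewrite card_ord prednK// absz_gt0.
Qed.

(** Discrete version of [Cint_twist]: shifting the nodes by one step along a coordinate multiplies
    the sum by a number different from 1. *)
Lemma sum_expk_gnode b l : (forall i, b i != 0) ->
  (forall l', l <> zmul b l') ->
  \sum_(k <- Dset (fun i => (b i)%:~R : R)) expk l (gnode (fun i => (b i)%:~R) k) = 0 :> C.
Proof.
move=> b0 nl; have a0 i : (b i)%:~R != 0 :> R by rewrite intr_eq0.
have [i li] : exists i, forall z : int, l i ord0 <> b i * z.
  apply: contrapT => h; apply: (nl (\col_i (l i ord0 %/ b i)%Z)).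
  apply/colP => i; rewrite !mxE.
  apply: contrapT => ki; apply: h; exists i => z lz; apply: ki.
  by rewrite -[LHS]/(l i ord0) lz [b i * z]mulrC mulzK// mulrC.
set S := \sum_(_ <- _) _.
have := @sum_Dset_shift C b (fun k => expk l (gnode (fun i => (b i)%:~R) k)) (delta_mx i ord0) b0.
under eq_bigr do rewrite gnodeD expkDr.
rewrite -mulr_suml -/S => h.
have {h} : S * expk l (gnode (fun i => (b i)%:~R) (delta_mx i ord0)) = S.
  by apply: h => k l'; rewrite gnodeD gnode_zmul// expkDr expk_int mulr1.
have -> : gnode (fun i => (b i)%:~R) (delta_mx i ord0) =
    \col_j (if j == i then (b i)%:~R^-1 else 0) :> Rn.
  by apply/colP => j; rewrite gnodeE !mxE eqxx andbT; case: eqP => [->|_]; rewrite ?mul1r ?mul0r.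
rewrite expkE dotp_delta => /eqP; rewrite -subr_eq0 -{2}[S]mulr1 -mulrBr mulf_eq0.
move=> /orP[/eqP//|]; rewrite subr_eq0 => h.
have : cis ((l i ord0)%:~R * (b i)%:~R^-1 : R) != 1.
  apply: cis_neq1_notint => z /(congr1 (fun t => t * (b i)%:~R)).
  by rewrite mulfVK// -intrM => /intr_inj; rewrite mulrC; exact: li.
by rewrite h.
Qed.

End grid.

(** * Powers of the dilation matrix in coordinates *)

Section dilation.
Context {R : realType} {n : nat}.
Context (mu : 'rV[int]_n) (j : nat).
Local Notation Rn := 'cV[R]_n.
Local Notation Zn := 'cV[int]_n.
Local Notation C := R[i].
Local Notation M := (dilation mu : 'M[R]_n).
Context (mu0 : forall i, mu ord0 i != 0).

Definition dilb (i : 'I_n) : int := mu ord0 i ^+ j.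
Definition dila (i : 'I_n) : R := (dilb i)%:~R.

Lemma dilb_neq0 i : dilb i != 0.
Proof. by rewrite expf_neq0. Qed.

Lemma dila_neq0 i : dila i != 0.
Proof. by rewrite intr_eq0 dilb_neq0. Qed.

Lemma dilationX : M ^+ j = diag_mx (\row_i dila i).
Proof.
rewrite /dila /dilb; elim: j => [|k IH].
  rewrite expr0; apply/matrixP => i l; rewrite !mxE.
  by case: eqP => //= _; rewrite expr0.
rewrite exprS IH -[LHS]/(_ *m _) mulmx_diag; congr diag_mx; apply/rowP => i.
by rewrite !mxE exprS intrM.
Qed.

Lemma dilationX_mul (x : Rn) : M ^+ j *m x = scale_cV dila x.
Proof.
rewrite dilationX mul_diag_mx; apply/colP => i; rewrite !mxE; congr (_ * x _ _).
Qed.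

Lemma dilationX_unit : M ^+ j \in unitmx.
Proof.
rewrite dilationX unitmxE det_diag unitfE; apply/prodf_neq0 => i _.
by rewrite mxE dila_neq0.
Qed.

Lemma invmx_dilationX (x : Rn) : invmx (M ^+ j) *m x = scale_cV (fun i => (dila i)^-1) x.
Proof.
apply: (canLR (mulKmx dilationX_unit)); rewrite dilationX_mul scale_cVK//.
exact: dila_neq0.
Qed.

Lemma node_gnode k : node M j k = gnode dila k.
Proof. exact: invmx_dilationX. Qed.

Lemma det_dilationX : `|\det M| ^+ j = \prod_i `|dila i|.
Proof.
rewrite /dilation det_diag normr_prod -prodrXl; apply: eq_bigr => i _.
by rewrite mxE /dila /dilb rmorphXn/= normrX.
Qed.

Lemma card_Dset_dilation : #|` Dset dila|%:R = `|\det M| ^+ j :> R.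
Proof.
rewrite det_dilationX card_Dset; last exact: dilb_neq0.
by rewrite natr_prod; apply: eq_bigr => i _; rewrite natr_absz intr_norm.
Qed.

Lemma freq_dilation (c : R) k : c != 0 ->
  freq (c *: M ^+ j) k <-> cube (gnode (fun i => c * dila i) k).
Proof.
move=> c0; have ca0 i : c * dila i != 0 by rewrite mulf_neq0// dila_neq0.
have E u : (c *: M ^+ j) *m u = scale_cV (fun i => c * dila i) u.
  by rewrite -scalemxAl dilationX_mul; apply/colP => i; rewrite !mxE mulrA.
split=> [[u cu]|ck].
  by rewrite E => ku; rewrite /gnode ku scale_cVVK.
by exists (gnode (fun i => c * dila i) k) => //; rewrite E scale_cVK.
Qed.

Lemma in_Dset_freq (c : R) k : c != 0 ->
  (k \in Dset (fun i => c * dila i)) = `[< freq (c *: M ^+ j) k >].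
Proof.
move=> c0; rewrite in_Dset; last by move=> i; rewrite mulf_neq0// dila_neq0.
by apply/asboolP/asboolP => /(freq_dilation _ c0).
Qed.

Lemma trig_poly_dilation (c : R) (t : Rn -> C) : c != 0 ->
  trig_poly (c *: M ^+ j) t -> exists w, t = trig (Dset (fun i => c * dila i)) w.
Proof.
move=> c0 [w ->]; exists w; apply/funext => x; rewrite /trig.
rewrite (fsbigE (Dset (fun i => c * dila i)))//.
- by rewrite big_seq_cond [RHS]big_seq; apply: eq_bigl => k; apply/andP/idP => [[]//|kD]; split => //; rewrite inE; apply/asboolP; rewrite -in_Dset_freq.
- by move=> k /=; rewrite in_Dset_freq// => /asboolP.
- by move=> k kf; rewrite in_Dset_freq// asboolT.
Qed.

Lemma sum_freq_dilation (V : nmodType) (F : Zn -> V) :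
  \sum_(k \in freq (M ^+ j)) F k = \sum_(k <- Dset dila) F k.
Proof.
have E k : (k \in Dset dila) = `[< freq (M ^+ j) k >].
  have := in_Dset_freq k (oner_neq0 R); rewrite scale1r => <-.
  by congr (k \in Dset _); apply/funext => i; rewrite mul1r.
rewrite (fsbigE (Dset dila))//.
- by rewrite big_seq_cond [RHS]big_seq; apply: eq_bigl => k; apply/andP/idP => [[]//|kD]; split => //; rewrite inE; apply/asboolP; rewrite -E.
- by move=> k /=; rewrite E => /asboolP.
- by move=> k kf; rewrite E asboolT.
Qed.

Lemma quasi_interpE (g phi : Rn -> C) x : quasi_interp M j g phi x =
  ((\prod_i `|dila i|)^-1)%:C *
  \sum_(k <- Dset dila) g (gnode dila k) * phi (x - gnode dila k).
Proof.
by rewrite /quasi_interp det_dilationX sum_freq_dilation; congr (_ * _); apply: eq_bigr => k _; rewrite !node_gnode.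
Qed.

End dilation.

(** * Approximation by smooth Fourier multipliers *)

Section convolution_operators.
Context {R : realType} {n : nat}.
Local Notation Rn := 'cV[R]_n.
Local Notation Zn := 'cV[int]_n.
Local Notation C := R[i].
Implicit Types (a : 'I_n -> R) (f G : Rn -> C) (k l : Zn) (x y : Rn) (r : R).

Lemma freqbox_supp a G r k : 0 <= r -> (forall i, a i != 0) -> bounded_support r G ->
  k \notin freqbox a r -> G (gnode a k) = 0.
Proof. by move=> r0 a0 [_ Gr] kS; rewrite Gr//; exact: notin_freqbox. Qed.

Lemma kern_trig a G r : 0 <= r -> (forall i, a i != 0) -> bounded_support r G ->
  kern a G = trig (freqbox a r) (fun k => G (gnode a k)).
Proof. by move=> r0 a0 [_ Gr]; apply/funext => y; exact: (kernE y r0 (lexx r) a0 Gr). Qed.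

Lemma gnode0 a : gnode a 0 = 0.
Proof. by apply/colP => i; rewrite gnodeE !mxE mul0r. Qed.

Lemma gnodeMn a k m : gnode a (k *+ m) = gnode a k *+ m.
Proof. by elim: m => [|m IH]; rewrite ?mulr0n ?gnode0// !mulrS gnodeD IH. Qed.

Lemma gnode_mulrn_notin a G r l nu : 0 <= r -> (forall i, a i != 0) ->
  bounded_support r G -> (0 < nu)%N -> l \notin freqbox a r -> G (gnode a (l *+ nu)) = 0.
Proof.
move=> r0 a0 [_ Gr] nu0 /(notin_freqbox r0 a0)[i ri]; apply: Gr; exists i.
rewrite gnodeMn mulmxnE normrMn; apply: lt_le_trans ri _.
by rewrite -[leRHS]mulr_natl ler_peMl// ler1n.
Qed.

(* The Fourier multiplier with symbol [k |-> G (A^-1 k)], for [A = diag a]. *)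
Definition conv_op a G f : Rn -> C := fun x => Cint (fun y => kern a G y * f (x - y)).

Lemma conv_opE a G r f : 0 <= r -> (forall i, a i != 0) -> bounded_support r G ->
  Defs.periodic f -> cintegrable f ->
  conv_op a G f = trig (freqbox a r) (fun l => G (gnode a l) * fcoef f l).
Proof.
move=> r0 a0 Gr pf fi; apply/funext => x; rewrite /conv_op (kern_trig r0 a0 Gr).
have := @conv_trig R n (freqbox a r) (fun k => G (gnode a k)) f x 1 (freqbox a r) isT pf fi.
under eq_fun do rewrite mulr1n; apply.
- by move=> k; exact: freqbox_supp.
- by move=> k; rewrite mulr1n; exact: freqbox_supp.
Qed.

(* The symbol of [f |-> \int G^ Delta_{-y}^s f] away from [nu = 0]. *)
Definition dsym s G x : C :=
  \sum_(1 <= nu < s.+1) (-1) ^+ nu * 'C(s, nu)%:R * G (x *+ nu).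

Lemma cintegrable_kern_conv a G r f x nu : 0 <= r -> (forall i, a i != 0) ->
  bounded_support r G -> Defs.periodic f -> cintegrable f ->
  cintegrable (fun y => kern a G y * f (x - y *+ nu)).
Proof.
move=> r0 a0 Gr pf fi; rewrite (kern_trig r0 a0 Gr).
apply: cintegrableMb (normc_trig _ _) => //; last exact: cmeas_trig.
case: nu => [|nu]; last exact: cintegrable_conv.
under eq_fun do rewrite mulr0n subr0.
by apply: cintegrable_bounded (cmeas_cst _) (fun=> lexx _).
Qed.

Lemma kern_fdiff_expand a G s f x y : kern a G y * fdiff s (- y) f x =
  \sum_(nu < s.+1) (-1) ^+ nu * 'C(s, nu)%:R * (kern a G y * f (x - y *+ nu)).
Proof.
rewrite /fdiff mulr_sumr; apply: eq_bigr => nu _.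
by rewrite mulNrn mulrCA.
Qed.

Lemma cintegrable_kern_fdiff a G r s f x : 0 <= r -> (forall i, a i != 0) ->
  bounded_support r G -> Defs.periodic f -> cintegrable f ->
  cintegrable (fun y => kern a G y * fdiff s (- y) f x).
Proof.
move=> r0 a0 Gr pf fi; under eq_fun do rewrite kern_fdiff_expand.
by apply: cintegrable_sum => nu; apply: cintegrableZ; exact: (cintegrable_kern_conv _ _ r0 a0 Gr).
Qed.

(** The difference has step -y, so its terms are f (x - nu y). The term nu = 0 factors out f (x) and
    leaves the mean of the kernel, which is G 0; the others are trigonometric polynomials by
    [conv_trig]. *)
Lemma kern_fdiffE a G r s f : 0 <= r -> (forall i, a i != 0) -> bounded_support r G ->
  Defs.periodic f -> cintegrable f ->
  (fun x => Cint (fun y => kern a G y * fdiff s (- y) f x)) =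
  (fun x => G 0 * f x + trig (freqbox a r) (fun l => dsym s G (gnode a l) * fcoef f l) x).
Proof.
move=> r0 a0 Gr pf fi; apply/funext => x.
under [X in Cint X]eq_fun do rewrite kern_fdiff_expand.
have ci nu : cintegrable (fun y => kern a G y * f (x - y *+ nu)).
  exact: (cintegrable_kern_conv _ _ r0 a0 Gr).
rewrite Cint_sum; last by move=> nu; exact: cintegrableZ.
under eq_bigr do rewrite CintZ//.
rewrite -(big_mkord xpredT (fun nu => (-1) ^+ nu * 'C(s, nu)%:R *
  Cint (fun y => kern a G y * f (x - y *+ nu)))) big_ltn//; congr (_ + _).
  rewrite expr0 bin0 !mul1r.
  under [X in Cint X]eq_fun do rewrite mulr0n subr0 mulrC.
  rewrite CintZ; last by rewrite (kern_trig r0 a0 Gr); exact: cintegrable_trig.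
  rewrite mulrC; congr (_ * _).
  have := fcoef_trig (freqbox a r) (fun k => G (gnode a k)) 0.
  rewrite /fcoef (kern_trig r0 a0 Gr).
  under [X in Cint X = _]eq_fun do rewrite oppr0 expk0l mulr1.
  move=> ->; rewrite gnode0; case: ifPn => // /(freqbox_supp r0 a0 Gr).
  by rewrite gnode0.
transitivity (\sum_(1 <= nu < s.+1) (-1) ^+ nu * 'C(s, nu)%:R *
    trig (freqbox a r) (fun l => G (gnode a (l *+ nu)) * fcoef f l) x).
  rewrite big_nat_cond [RHS]big_nat_cond; apply: eq_bigr => nu /andP[/andP[nu0 _] _].
  congr (_ * _); rewrite (kern_trig r0 a0 Gr).
  apply: (@conv_trig R n (freqbox a r) (fun k => G (gnode a k)) f x nu (freqbox a r)) => //.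
  - by move=> k; exact: freqbox_supp.
  - by move=> k; exact: gnode_mulrn_notin.
rewrite /trig; under eq_bigr do rewrite mulr_sumr.
rewrite exchange_big/=; apply: eq_bigr => l _.
rewrite /dsym !mulr_suml; apply: eq_bigr => nu _.
by rewrite gnodeMn !mulrA.
Qed.

Lemma measurable_prod_affine (nu : nat) :
  measurable_fun setT (fun z : Rn * Rn => z.2 - z.1 *+ nu).
Proof.
apply: measurable_fun_cV => i; under eq_fun do rewrite !mxE mulmxnE.
apply: measurable_funB; first exact: (measurableT_comp (measurable_coord i)).
under eq_fun do rewrite -mulr_natl.
by apply: measurable_funM => //; exact: (measurableT_comp (measurable_coord i)).
Qed.

Lemma cmeas_comp (T1 T2 : Type) d1 d2 (U1 : measurableType d1) (U2 : measurableType d2)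
  (g : U2 -> C) (t : U1 -> U2) : cmeas g -> measurable_fun setT t -> cmeas (g \o t).
Proof. by move=> [mr mi] mt; split; [exact: (measurableT_comp mr)|exact: (measurableT_comp mi)]. Qed.

Lemma conv_op_bound G r (eps : R) : 0 <= r -> 0 < eps -> (forall m, nice m r G) ->
  exists2 K, 0 <= K & forall a, (forall i, eps <= `|a i|) -> forall p f, (1 <= p)%E ->
    Lp p f -> (lpnorm p (conv_op a G f) <= K%:E * lpnorm p f)%E.
Proof.
move=> r0 e0 nG; have [K K0 hK] := normc_kern_moment 0 r0 e0 nG.
have Gr := nice_supp (nG 0%N).
exists (2 * (K * pi ^+ n)); first by rewrite !mulr_ge0// exprn_ge0// pi_ge0.
move=> a ea p f p1 fp; have [pf mf foo] := fp.
have a0 i : a i != 0 by rewrite -normr_gt0 (lt_le_trans e0).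
have fi := Lp_cintegrable p1 fp.
have fn : (lpnorm p f \is a fin_num)%E by rewrite ge0_fin_numE// lpnorm_ge0.
rewrite [leRHS](_ : _ = (2 * ((K * pi ^+ n) * fine (lpnorm p f)))%:E); last first.
  by rewrite -[in LHS](fineK fn) -EFinM !mulrA.
apply: (@lpnorm_Cint_weight R n p (fun y x => kern a G y * f (x - y))
  (fun y x => normc (f (x - y))) (fun y => K * cwt a y) (K * pi ^+ n) (fine (lpnorm p f)) p1).
- move=> x; have := @cintegrable_kern_conv a G r f x 1 r0 a0 Gr pf fi.
  by under eq_fun do rewrite mulr1n.
- by rewrite -/(conv_op a G f) (conv_opE r0 a0 Gr pf fi); exact: cmeas_trig.
- have := cmeas_normc (cmeas_comp (t := fun z : Rn * Rn => z.2 - z.1 *+ 1) Rn Rn mf (measurable_prod_affine 1)).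
  by rewrite /=; under eq_fun do rewrite mulr1n.
- by apply: measurable_funM => //; exact: measurable_cwt.
- by move=> y x; exact: normc_ge0.
- by move=> y; rewrite mulr_ge0// ltW// cwt_gt0.
- by rewrite fine_ge0// lpnorm_ge0.
- under eq_integral do rewrite EFinM.
  rewrite ge0_integralZl//; last 2 first.
  + by apply/measurable_EFinP; exact: measurable_cwt.
  + by move=> y _; rewrite lee_fin ltW// cwt_gt0.
  by rewrite EFinM lee_wpmul2l ?lee_fin// integral_cwt_le.
- move=> y x cy; rewrite normcM mulrC ler_wpM2l ?normc_ge0//.
  by have := hK a ea y cy; rewrite expr0 mul1r.
- move=> y _; rewrite fineK//.
  by have := lpnorm_shift (- y) p1 mf pf; rewrite /lpnorm => ->.
Qed.

(** The integrand is split as (|difference| / P) times (P |kernel|), where P is the growth allowed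
    by [lpnorm_fdiff_modulus]. The first factor has norm at most the modulus, the second a bounded
    integral by the moment estimate. *)
Lemma kern_fdiff_bound G r (c : R) s : 0 <= r -> 0 < c -> (forall m, nice m r G) ->
  exists2 K, 0 <= K & forall a (A : 'M[R]_n), (forall i, 1 <= `|a i|) ->
    (forall x, A *m x = scale_cV a x) -> forall p f, (1 <= p)%E -> Lp p f ->
    (lpnorm p (fun x => Cint (fun y => kern (fun i => c * a i) G y * fdiff s (- y) f x)%R)
     <= K%:E * modulus s f A p)%E.
Proof.
move=> r0 c0 nG; have [K K0 hK] := normc_kern_moment s r0 c0 nG.
have Gr := nice_supp (nG 0%N).
(* The kernel lives at scale c a and the modulus at scale a; 1 + u <= (1 + 1/c) (1 + c u) compares
   the two in each coordinate. *)
pose K' := ((1 + c^-1) ^+ n) ^+ s * K.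
have cV0 : 0 <= 1 + c^-1 by rewrite addr_ge0// invr_ge0 ltW.
have K'0 : 0 <= K' by rewrite mulr_ge0// !exprn_ge0.
exists (2 * (K' * pi ^+ n)).
  by apply: mulr_ge0 => //; apply: mulr_ge0 => //; exact: exprn_ge0 (pi_ge0 R).
move=> a A a1 Aa p f p1 fp; have [pf mf foo] := fp.
pose a' i := c * a i.
have ca i : c <= `|a' i| by rewrite normrM (gtr0_norm c0) ler_peMr// ltW.
have a'0 i : a' i != 0 by rewrite -normr_gt0 (lt_le_trans c0).
have fi := Lp_cintegrable p1 fp.
have fn := modulus_fin_num s A p1 fp.
pose P (y : Rn) := (\prod_i (1 + `|a i * y i ord0|)) ^+ s.
have P0 y : 0 < P y by rewrite exprn_gt0// prodr_gt0// => i _; rewrite ltr_pwDl.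
have mfd : cmeas (fun z : Rn * Rn => fdiff s (- z.1) f z.2).
  apply: cmeas_sum => nu; apply: cmeasM; first exact: cmeas_cst.
  have := cmeas_comp (t := fun z : Rn * Rn => z.2 - z.1 *+ nu) Rn Rn mf (measurable_prod_affine nu).
  by rewrite /comp; under eq_fun do rewrite -mulNrn.
have mP : measurable_fun setT (fun z : Rn * Rn => (P z.1)^-1).
  apply: (measurableT_comp (f := fun y => (P y)^-1)) => //.
  have -> : (fun y => (P y)^-1) = fun y => (\prod_i (1 + `|a i * y i ord0|)^-1) ^+ s.
    by apply/funext => y; rewrite /P -exprVn prodfV.
  apply: measurable_funX; apply: measurable_prod => i _.
  have ct : continuous (fun t : R => (1 + `|a i * t|)^-1).
    move=> t; apply: cvgV; first by rewrite gt_eqF// ltr_pwDl.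
    apply: cvgD; first exact: cvg_cst.
    by apply: cvg_norm; apply: cvgM; [exact: cvg_cst|exact: cvg_id].
  exact: (measurableT_comp (continuous_measurable_fun ct) (measurable_coord i)).
rewrite [leRHS](_ : _ = (2 * ((K' * pi ^+ n) * fine (modulus s f A p)))%:E); last first.
  by rewrite -[in LHS](fineK fn) -EFinM !mulrA.
apply: (@lpnorm_Cint_weight R n p (fun y x => kern a' G y * fdiff s (- y) f x)
  (fun y x => normc (fdiff s (- y) f x) / P y) (fun y => K' * cwt a' y) (K' * pi ^+ n)
  (fine (modulus s f A p)) p1).
- by move=> x; exact: (cintegrable_kern_fdiff _ _ r0 a'0 Gr).
- rewrite (kern_fdiffE _ r0 a'0 Gr pf fi).
  by apply: cmeasD; [apply: cmeasM => //; exact: cmeas_cst|exact: cmeas_trig].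
- by apply: measurable_funM => //; exact: cmeas_normc.
- by apply: measurable_funM => //; exact: measurable_cwt.
- by move=> y x; rewrite divr_ge0 ?normc_ge0// ltW.
- by move=> y; rewrite mulr_ge0// ltW// cwt_gt0.
- by rewrite fine_ge0// modulus_ge0.
- under eq_integral do rewrite EFinM.
  rewrite ge0_integralZl//; last 2 first.
  + by apply/measurable_EFinP; exact: measurable_cwt.
  + by move=> y _; rewrite lee_fin ltW// cwt_gt0.
  by rewrite [leRHS]EFinM lee_wpmul2l ?lee_fin// integral_cwt_le.
- move=> y x cy; rewrite normcM mulrC -mulrA ler_wpM2l ?normc_ge0//.
  rewrite ler_pdivlMl//; apply: le_trans (_ : ((1 + c^-1) ^+ n) ^+ s *
      ((\prod_i (1 + `|a' i * y i ord0|)) ^+ s * normc (kern a' G y)) <= _); last first.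
    by rewrite /K' -mulrA ler_wpM2l ?exprn_ge0//; exact: hK.
  rewrite mulrA ler_wpM2r ?normc_ge0// -exprMn lerXn2r ?nnegrE ?prodr_ge0//.
    by rewrite mulr_ge0 ?exprn_ge0 ?prodr_ge0.
  rewrite -[X in _ ^+ X]card_ord -prodr_const -big_split/=; apply: ler_prod => i _.
  rewrite addr_ge0//= /a' -mulrA [X in _ * (1 + X)]normrM (gtr0_norm c0).
  set u := `|_|; have u0 : 0 <= u by exact: normr_ge0.
  have -> : (1 + c^-1) * (1 + c * u) = 1 + c * u + c^-1 + u by field; rewrite gt_eqF.
  have : 0 <= c * u by rewrite mulr_ge0// ltW.
  have : 0 <= c^-1 by rewrite invr_ge0 ltW.
  lra.
- move=> y _; rewrite fineK//.
  have -> : (fun x => (normc (fdiff s (- y) f x) / P y)%:E) =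
      (fun x => ((P y)^-1)%:E * (normc (fdiff s (- y) f x))%:E)%E.
    by apply/funext => x; rewrite -EFinM mulrC.
  rewrite LnormZ ?invr_ge0 ?(ltW (P0 _))//; last by apply: emeas_normc; exact: cmeas_fdiff.
  rewrite lee_pdivrMl//.
  have := lpnorm_fdiff_modulus s (- y) p1 pf mf Aa.
  rewrite (_ : \prod_i _ = \prod_i (1 + `|a i * y i ord0|))//.
  by apply: eq_bigr => i _; rewrite mxE mulrN normrN.
Qed.

End convolution_operators.

(** * Alternating binomial sums *)

Section alternating_sum.
Context (T : comPzRingType).

(** This is, up to sign, the s-th difference of t^k at 0. The induction uses nu C(s+1, nu) = (s+1)
    C(s, nu-1) and expands the remaining power of nu by the binomial theorem. *)
Lemma alternating_binomial_sum s k : (k <= s)%N ->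
  \sum_(nu < s.+1) (-1) ^+ nu * 'C(s, nu)%:R * nu%:R ^+ k =
  (if k == s then (-1) ^+ s * s`!%:R else 0) :> T.
Proof.
elim: s k => [|s IH] k.
  by rewrite leqn0 => /eqP ->; rewrite big_ord1 /= expr0 bin0 !mulr1.
case: k => [_|k ks].
  rewrite -[RHS](_ : (1 - 1) ^+ s.+1 = _); last by rewrite subrr expr0n.
  rewrite exprBn_comm; last exact: commr1.
  by apply: eq_bigr => i _; rewrite !expr1n expr0 !mulr1 mulr_natr.
rewrite big_ord_recl/= exprS !mul0r mulr0 add0r.
transitivity (- s.+1%:R * \sum_(i < k.+1) 'C(k, i)%:R *
    (\sum_(nu < s.+1) (-1) ^+ nu * 'C(s, nu)%:R * nu%:R ^+ i) : T).
  under [in RHS]eq_bigr do rewrite mulr_sumr.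
  rewrite exchange_big/= mulr_sumr; apply: eq_bigr => nu _.
  rewrite /bump leq0n add1n.
  have -> : \sum_(i < k.+1) 'C(k, i)%:R * ((-1) ^+ nu * 'C(s, nu)%:R * nu%:R ^+ i) =
      (-1) ^+ nu * 'C(s, nu)%:R * nu.+1%:R ^+ k :> T.
    rewrite -[nu.+1]add1n natrD exprDn mulr_sumr; apply: eq_bigr => i _.
    by rewrite expr1n mul1r -[nu%:R ^+ i *+ _]mulr_natl [RHS]mulrCA.
  have e : nu.+1%:R * 'C(s.+1, nu.+1)%:R = s.+1%:R * 'C(s, nu)%:R :> T.
    by rewrite -!natrM mul_bin_diag.
  rewrite !exprS mulN1r !mulNr; congr (- _).
  by rewrite -mulrA [X in _ * X]mulrA ['C(_, _)%:R * _]mulrC e; ring.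
rewrite big_ord_recr/= big1 ?add0r; last first.
  move=> i _; rewrite IH; last by rewrite ltnW// (leq_trans (ltn_ord i)).
  rewrite ifF ?mulr0//; apply/negbTE; rewrite neq_ltn.
  by rewrite (leq_trans (ltn_ord i)).
rewrite binn mul1r IH// eqSS; case: eqP => [_|_]; last by rewrite mulr0.
by rewrite factS natrM exprS; ring.
Qed.

End alternating_sum.

(** * Jackson estimate and the homogeneous polynomial as a multiplier *)

Section approximation.
Context {R : realType} {n : nat}.
Local Notation Rn := 'cV[R]_n.
Local Notation Zn := 'cV[int]_n.
Local Notation C := R[i].
Implicit Types (a : 'I_n -> R) (f G : Rn -> C) (k l : Zn) (x y : Rn) (r c : R) (S : {fset Zn}).

Lemma eq_trig S S' w w' : (forall k, k \notin S -> w k = 0) ->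
  (forall k, k \notin S' -> w' k = 0) -> w =1 w' -> trig S w = trig S' w' :> (Rn -> C).
Proof.
move=> wS wS' ww; apply/funext => x; rewrite /trig.
rewrite -(@fsbigTE _ _ _ _ S (fun k => w k * expk k x)); last by move=> k /wS ->; rewrite mul0r.
rewrite -(@fsbigTE _ _ _ _ S' (fun k => w' k * expk k x)); last by move=> k /wS' ->; rewrite mul0r.
by apply: eq_fsbigr => k _; rewrite ww.
Qed.

Lemma trigD S w w' x : trig S w x + trig S w' x = trig S (fun k => w k + w' k) x :> C.
Proof. by rewrite -big_split; apply: eq_bigr => k _; rewrite mulrDl. Qed.

Lemma trigN S w x : - trig S w x = trig S (fun k => - w k) x :> C.
Proof. by rewrite -sumrN; apply: eq_bigr => k _; rewrite mulNr. Qed.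

Lemma Lp_trig p S w : (1 <= p)%E -> Lp p (trig S w : Rn -> C).
Proof.
move=> p1; split; [exact: trig_periodic|exact: cmeas_trig|].
apply: le_lt_trans (ltry (\sum_(k <- S) normc (w k))).
apply: lpnorm_le_bound => //; [exact: cmeas_trig|exact: normc_trig].
Qed.

Lemma LpD p f g : (1 <= p)%E -> Lp p f -> Lp p g -> Lp p (fun x => f x + g x).
Proof.
move=> p1 [pf mf f1] [pg mg g1]; split.
- by move=> k x; rewrite pf pg.
- exact: cmeasD.
- by apply: le_lt_trans (lpnormD p1 mf mg) _; exact: lte_add_pinfty.
Qed.

Lemma LpZ p (z : C) f : (1 <= p)%E -> Lp p f -> Lp p (fun x => z * f x).
Proof.
move=> p1 [pf mf f1]; split.
- by move=> k x; rewrite pf.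
- by apply: cmeasM => //; exact: cmeas_cst.
- by rewrite lpnormZ// lte_mul_pinfty// lee_fin normc_ge0.
Qed.

Lemma LpB p f g : (1 <= p)%E -> Lp p f -> Lp p g -> Lp p (fun x => f x - g x).
Proof.
move=> p1 fp gp; have := LpD p1 fp (LpZ (-1) p1 gp).
by under eq_fun do rewrite mulN1r.
Qed.

Lemma gnodeZ c a k : gnode (fun i => c * a i) k = c^-1 *: gnode a k.
Proof. by apply/colP => i; rewrite gnodeE mxE gnodeE invfM mulrCA. Qed.

Lemma conv_op_linear a G r (z : C) f g : 0 <= r -> (forall i, a i != 0) ->
  bounded_support r G ->
  Defs.periodic f -> Defs.periodic g -> cintegrable f -> cintegrable g ->
  conv_op a G (fun x => f x + z * g x) = fun x => conv_op a G f x + z * conv_op a G g x.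
Proof.
move=> r0 a0 Gr pf pg fi gi.
have zg : cintegrable (fun x => z * g x) by exact: cintegrableZ.
have fgi : cintegrable (fun x => f x + z * g x) by exact: cintegrableD.
have pfg : Defs.periodic (fun x => f x + z * g x) by move=> k x; rewrite pf pg.
rewrite !(conv_opE r0 a0 Gr)//; apply/funext => x.
rewrite /trig mulr_sumr -big_split/=; apply: eq_bigr => k _.
by rewrite fcoefD// fcoefZ//; ring.
Qed.

(** Normalising by a norm fails when the norm is 0; scaling by an arbitrary positive upper bound [B]
    and letting [B] decrease to the norm covers that case too. *)
Lemma homogeneous_bound (N : R) (X Y : \bar R) : 0 <= N -> (0 <= X)%E ->
  X \is a fin_num ->
  (forall B : R, 0 < B -> (X <= B%:E)%E -> (Y <= N%:E * B%:E)%E) -> (Y <= N%:E * X)%E.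
Proof.
move=> N0 X0 Xf key; have F0 : 0 <= fine X by rewrite fine_ge0.
apply/lee_addgt0Pr => e e0.
apply: le_trans (key (fine X + e / (N + 1)) _ _) _.
- by rewrite ltr_wpDl// divr_gt0// ltr_wpDl.
- by rewrite EFinD fineK// leeDl// lee_fin divr_ge0 ?ltW// ltr_wpDl.
- rewrite -[X in (_ <= _ * X + _)%E](fineK Xf) -!EFinM -EFinD lee_fin mulrDr lerD2l.
  rewrite mulrCA ger_pMr// ler_pdivrMr ?mul1r ?lerDl// ltr_wpDl//.
Qed.

(** The supremum [multiplier_norm] ranges over every g with the prescribed coefficients, so it
    applies to the chosen one after rescaling. *)
Lemma multiplier_bound p (lam : Zn -> C) (N : R) F : (1 <= p)%E -> multiplier p lam ->
  (multiplier_norm p lam <= N%:E)%E -> Lp p F ->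
  exists g, [/\ Lp p g, multiplies lam F g & (lpnorm p g <= N%:E * lpnorm p F)%E].
Proof.
move=> p1 ml mN Fp; have [g gp lg] := ml _ Fp.
have [pF mF F1] := Fp; have [pg mg g1] := gp.
have Fi := Lp_cintegrable p1 Fp; have gi := Lp_cintegrable p1 gp.
exists g; split => //.
have key (B : R) : 0 < B -> (lpnorm p F <= B%:E)%E -> (lpnorm p g <= N%:E * B%:E)%E.
  move=> B0 FB; rewrite muleC -lee_pdivrMl//.
  have BE : normc (B^-1)%:C = B^-1 by rewrite normc_real gtr0_norm// invr_gt0.
  rewrite -[X in (X%:E * _)%E]BE -lpnormZ//; apply: le_trans mN; apply: ereal_sup_ubound.
  exists (fun x => (B^-1)%:C * F x), (fun x => (B^-1)%:C * g x); split => //.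
  - exact: LpZ.
  - by rewrite lpnormZ// BE lee_pdivrMl// mule1.
  - exact: LpZ.
  - by move=> k; rewrite !fcoefZ// lg mulrCA.
have N0 : 0 <= N.
  rewrite -lee_fin; apply: le_trans mN.
  apply: (@le_trans _ _ (lpnorm p (fun _ : Rn => 0 : C))); first exact: lpnorm_ge0.
  apply: ereal_sup_ubound.
  have z : Lp p (fun _ : Rn => 0 : C).
    by split; [by []|exact: cmeas_cst|rewrite lpnorm0// ltry].
  exists (fun=> 0), (fun=> 0); split => //; first by rewrite lpnorm0.
  move=> k; rewrite (_ : fcoef _ k = 0) ?mulr0// /fcoef.
  by under [X in Cint X]eq_fun do rewrite mul0r; exact: Cint0.
apply: (homogeneous_bound N0 _ _ key); first exact: lpnorm_ge0.
by rewrite ge0_fin_numE// lpnorm_ge0.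
Qed.

(** The sum of all monomials of degree [s]; [power_sum] is this polynomial at a node. The form on
    arbitrary vectors gives access to homogeneity. *)
Definition hompoly s x : R :=
  \sum_(b : {ffun 'I_n -> 'I_s.+1} | (\sum_i b i)%N == s) \prod_i x i ord0 ^+ b i.

Lemma hompolyZ s c x : hompoly s (c *: x) = c ^+ s * hompoly s x.
Proof.
rewrite /hompoly mulr_sumr; apply: eq_bigr => b /eqP bs.
under eq_bigr do rewrite mxE exprMn.
by rewrite big_split/= prodrXr bs.
Qed.

Lemma hompoly0 s : (0 < s)%N -> hompoly s 0 = 0.
Proof. by move=> s0; rewrite -[0 in LHS](scale0r 0) hompolyZ expr0n gtn_eqF// mul0r. Qed.

Lemma nice_hompoly s m r G : nice m r (fun _ : Rn => 0) -> nice m r G ->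
  nice m r (fun x => (hompoly s x)%:C * G x).
Proof.
move=> n0 nG.
have -> : (fun x => (hompoly s x)%:C * G x) =
  (fun x => \sum_(b : {ffun 'I_n -> 'I_s.+1} | (\sum_i b i)%N == s)
     ((\prod_i x i ord0 ^+ b i)%:C * G x)).
  by apply/funext => x; rewrite /hompoly rmorph_sum/= mulr_suml.
by apply: nice_sum => // b; exact: (nice_coord_prod (fun i => b i)).
Qed.

Context (v : Rn -> C) (v_smooth : smooth v)
  (v_eq1 : forall x, (forall i, - (1 / 4) <= x i ord0 < 1 / 4) -> v x = 1)
  (v_eq0 : forall x, ~ (forall i, - (3 / 8) <= x i ord0 < 3 / 8) -> v x = 0).

Lemma v_out x : (exists i, 3 / 8 < `|x i ord0|) -> v x = 0.
Proof.
move=> [i xi]; apply: v_eq0 => /(_ i) /andP[x1 x2]; move: xi; rewrite ltNge ler_norml.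
by rewrite x1 ltW.
Qed.

Lemma v_supp x i : v x != 0 -> `|x i ord0| <= 3 / 8.
Proof. by apply: contra_neqT; rewrite -ltNge => xi; apply: v_out; exists i. Qed.

Lemma v_one x : (forall i, `|x i ord0| < 1 / 4) -> v x = 1.
Proof.
move=> x4; apply: v_eq1 => i; have := x4 i; rewrite ltr_norml => /andP[h1 h2].
by rewrite h2 ltW.
Qed.

Lemma v_nice m : nice m (3 / 8) v.
Proof. by apply: smooth_nice => // x; exact: v_out. Qed.

Lemma zero_nice m : nice m (3 / 8) (fun _ : Rn => 0 : C).
Proof.
have := niceZ 0 (v_nice m).
by under eq_fun do rewrite rmorph0 mul0r.
Qed.

Let r38 : 0 <= 3 / 8 :> R. Proof. by lra. Qed.

Lemma dsym_supp s x i : dsym s v x != 0 -> `|x i ord0| <= 3 / 8.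
Proof.
apply: contra_neqT; rewrite -ltNge => xi; rewrite /dsym big_nat_cond big1// => nu.
move=> /andP[/andP[nu0 _] _]; rewrite v_out ?mulr0//; exists i; apply: lt_le_trans xi _.
by rewrite mulmxnE normrMn -[leRHS]mulr_natl ler_peMl// ler1n.
Qed.

(** The averaged difference D at scale c/2 equals f + T, with T a polynomial on which the cutoff at
    scale c acts as the identity. Hence f - V f = D - V D, and the norm of D is bounded by the
    modulus. *)
Lemma approx_bound s c : 0 < c ->
  exists2 K, 0 <= K & forall a (A : 'M[R]_n), (forall i, 1 <= `|a i|) ->
    (forall x, A *m x = scale_cV a x) -> forall p f, (1 <= p)%E -> Lp p f ->
    (lpnorm p (fun x => f x - conv_op (fun i => c * a i) v f x)%R
     <= K%:E * modulus s f A p)%E.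
Proof.
move=> c0; have c20 : 0 < c / 2 by rewrite divr_gt0.
have [K1 K10 hK1] := kern_fdiff_bound s r38 c20 v_nice.
have [K2 K20 hK2] := conv_op_bound r38 c0 v_nice.
have Gr := nice_supp (v_nice 0).
exists ((1 + K2) * K1); first by rewrite mulr_ge0// addr_ge0.
move=> a A a1 Aa p f p1 fp; have [pf mf foo] := fp; have fi := Lp_cintegrable p1 fp.
have ca c' i : 0 < c' -> c' <= `|c' * a i|.
  by move=> c'0; rewrite normrM gtr0_norm// ler_peMr// ltW.
have ca0 c' i : 0 < c' -> c' * a i != 0.
  by move=> c'0; rewrite -normr_gt0 (lt_le_trans c'0)// ca.
set b := fun i => c / 2 * a i; set b' := fun i => c * a i.
have b0 i : b i != 0 by exact: ca0.
have b'0 i : b' i != 0 by exact: ca0.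
have := hK1 a A a1 Aa p f p1 fp; rewrite -/b.
rewrite (kern_fdiffE s r38 b0 Gr pf fi).
set w := (X in trig _ X); set D := (fun x => _ + _) => hD.
have v00 : v 0 = 1 by apply: v_one => i; rewrite mxE normr0 divr_gt0.
pose T := trig (freqbox b (3 / 8)) w.
have DE : D = fun x => f x + 1 * T x by apply/funext => x; rewrite /D v00 !mul1r.
have Ti : cintegrable T by exact: cintegrable_trig.
have Dp : Lp p D by rewrite DE; apply: LpD => //; apply: LpZ => //; exact: Lp_trig.
(* The symbol of [T] lives where |x_i| <= 3/8 at scale c/2, that is |x_i| <= 3/16 < 1/4 at scale c,
   where [v] is 1. *)
have TE : conv_op b' v T = T.
  rewrite (conv_opE r38 b'0 Gr (trig_periodic _ _) Ti) /T.
  transitivity (trig (freqbox b (3 / 8)) (fun k => if k \in freqbox b (3 / 8) then w k else 0)).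
    apply: eq_trig => k.
    - by move=> /(freqbox_supp r38 b'0 Gr) ->; rewrite mul0r.
    - by move=> /negbTE ->.
    - rewrite fcoef_trig; case: ifP => _; last by rewrite mulr0.
      have [->|wk] := eqVneq (w k) 0; first by rewrite mulr0.
      rewrite v_one ?mul1r// => i.
      have /(@dsym_supp s _ i) : dsym s v (gnode b k) != 0.
        by apply: contra_neq wk => e; rewrite /w e mul0r.
      rewrite !gnodeE /b' /b !normrM !normfV !normrM normfV.
      rewrite (gtr0_norm c0) [ `|2|]gtr0_norm// !invfM invrK.
      set u := `|a i|^-1; set z := `|_|; set g := c^-1.
      have -> : z * (g * 2 * u) = 2 * (z * (g * u)) by ring.
      lra.
  by rewrite /trig; apply/funext => x; rewrite big_seq [RHS]big_seq; apply: eq_bigr => k ->.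
have fE : (fun x => f x - conv_op b' v f x) = (fun x => D x - conv_op b' v D x).
  apply/funext => x; rewrite [in RHS]DE (conv_op_linear 1 r38 b'0 Gr pf (trig_periodic _ _) fi Ti).
  by rewrite TE; ring.
rewrite fE.
apply: le_trans (lpnormB p1 _ _) _; first by case: Dp.
  rewrite (conv_opE r38 b'0 Gr); [exact: cmeas_trig|by case: Dp|exact: Lp_cintegrable Dp].
apply: (@le_trans _ _ ((1 + K2)%:E * lpnorm p D)%E).
  rewrite EFinD ge0_muleDl// mul1e leeD2l//; apply: hK2 => // i; exact: ca.
by rewrite EFinM -muleA lee_wpmul2l// lee_fin addr_ge0.
Qed.

(** The differences are averaged against the kernel of P v at the large scale d = 4 s c. Then v = 1
    at all multiples nu <= s of the relevant points, so homogeneity reduces the symbol to P times an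
    alternating binomial sum; P 0 = 0 removes the term f itself. *)
Lemma hompoly_part s c : (0 < s)%N -> 0 < c ->
  exists2 K, 0 <= K & forall a (A : 'M[R]_n), (forall i, 1 <= `|a i|) ->
    (forall x, A *m x = scale_cV a x) -> forall p f, (1 <= p)%E -> Lp p f ->
    exists F, [/\ Lp p F, (lpnorm p F <= K%:E * modulus s f A p)%E &
      forall l, v (gnode (fun i => c * a i) l) != 0 ->
        fcoef F l = (hompoly s (gnode a l))%:C * fcoef f l].
Proof.
move=> s0 c0; pose d := 4 * s%:R * c.
have s0R : 0 < s%:R :> R by rewrite ltr0n.
have d0 : 0 < d by rewrite !mulr_gt0.
pose w x := (hompoly s x)%:C * v x.
have wn m : nice m (3 / 8) w by apply: nice_hompoly; [exact: zero_nice|exact: v_nice].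
have [K K0 hK] := kern_fdiff_bound s r38 d0 wn.
have Gr := nice_supp (wn 0%N).
(* It undoes both the factor (-1)^s s! of the binomial sum and the factor d^-s from evaluating P at
   scale d. *)
pose z : C := ((d ^+ s)%:C * (-1) ^+ s) / s`!%:R.
exists (normc z * K); first by rewrite mulr_ge0// normc_ge0.
move=> a A a1 Aa p f p1 fp; have [pf mf foo] := fp; have fi := Lp_cintegrable p1 fp.
set b := fun i => d * a i.
have b0 i : b i != 0.
  by apply: mulf_neq0; [rewrite gt_eqF|rewrite -normr_gt0 (lt_le_trans ltr01)].
have := hK a A a1 Aa p f p1 fp; rewrite -/b.
rewrite (kern_fdiffE s r38 b0 Gr pf fi).
have w0 : w 0 = 0 by rewrite /w hompoly0// mul0r.
set W := (X in trig _ X) => hD.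
pose T := trig (freqbox b (3 / 8)) W.
have TE : (fun x => w 0 * f x + trig (freqbox b (3 / 8)) W x) = T.
  by apply/funext => x; rewrite w0 mul0r add0r.
rewrite TE in hD.
exists (fun x => z * T x); split.
- by apply: LpZ => //; exact: Lp_trig.
- rewrite lpnormZ//; last exact: cmeas_trig.
  by rewrite EFinM -muleA lee_wpmul2l// lee_fin normc_ge0.
- move=> l vl; rewrite fcoefZ; last exact: cintegrable_trig.
  have gl i : `|gnode b l i ord0| * (4 * s%:R) <= 3 / 8.
    have := v_supp i vl; rewrite !gnodeE /b /d !normrM !normfV !normrM.
    rewrite (gtr0_norm c0) (gtr0_norm s0R) [ `|4|]gtr0_norm// !invfM.
    set u := `|a i|^-1; set y := `|_|; set g := c^-1.
    have -> : y * (4^-1 * s%:R^-1 * g * u) * (4 * s%:R) = y * (g * u) by field; rewrite gt_eqF.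
    by [].
  rewrite fcoef_trig ifT; last first.
    apply: contrapT => /negP /(notin_freqbox r38 b0)[i ]; rewrite -/(gnode b l) ltNge => /negP; apply.
    apply: le_trans (gl i); rewrite ler_peMr//.
    have : 1 <= s%:R :> R by rewrite ler1n.
    lra.
  rewrite /W mulrA; congr (_ * _).
  (* At scale d a coordinate is at most 3 / (32 s), so its multiples up to [s] stay below 1/4. *)
  have vnu (nu : nat) : (nu < s.+1)%N -> v (gnode b l *+ nu) = 1.
    move=> nus; apply: v_one => i; rewrite mulmxnE normrMn -[_ *+ nu]mulr_natr.
    apply: (@le_lt_trans _ _ (`|gnode b l i ord0| * s%:R)).
      by apply: ler_wpM2l => //; rewrite ler_nat.
    have := gl i; rewrite mulrCA; set t := _ * s%:R; lra.
  have -> : dsym s w (gnode b l) = (hompoly s (gnode b l))%:C * ((-1) ^+ s * s`!%:R).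
    have := alternating_binomial_sum C (leqnn s); rewrite eqxx => <-.
    rewrite -(big_mkord xpredT (fun nu => (-1) ^+ nu * 'C(s, nu)%:R * nu%:R ^+ s)).
    rewrite big_ltn// expr0n gtn_eqF// mulr0 add0r mulr_sumr /dsym.
    rewrite big_nat_cond [RHS]big_nat_cond; apply: eq_bigr => nu /andP[/andP[_ nus] _].
    rewrite /w vnu// mulr1 -(scaler_nat nu (gnode b l)) hompolyZ rmorphM/= rmorphXn/=.
    by rewrite rmorph_nat; ring.
  rewrite (_ : gnode b l = d^-1 *: gnode a l); last exact: gnodeZ.
  rewrite hompolyZ rmorphM/= /z.
  have s1 : (-1) ^+ s * (-1) ^+ s = 1 :> C by rewrite -exprMn mulrNN mulr1 expr1n.
  have d1 : (d ^+ s)%:C * (d^-1 ^+ s)%:C = 1.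
    by rewrite -rmorphM/= -exprMn mulfV ?expr1n// gt_eqF.
  have f1 : s`!%:R^-1 * s`!%:R = 1 :> C by rewrite mulVf// pnatr_eq0 -lt0n fact_gt0.
  transitivity (((d ^+ s)%:C * (d^-1 ^+ s)%:C) * ((-1) ^+ s * (-1) ^+ s) *
     (s`!%:R^-1 * s`!%:R) * (hompoly s (gnode a l))%:C); first by ring.
  by rewrite s1 d1 f1 !mul1r.
Qed.

End approximation.

(** * Discrete norms and sampling inequalities *)

Section discrete_norm.
Context {R : realType} {K : choiceType}.
Implicit Types (p q : \bar R) (D : {fset K}) (u c : K -> R) (A B : R).

(* The normalised discrete [L_p] norm of [u] over [D] is at most [B]. *)
Definition mean_le p D u B : Prop :=
  match p with
  | r%:E => \sum_(k <- D) u k `^ r <= #|` D|%:R * B `^ r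
  | _ => forall k, k \in D -> u k <= B
  end.

Lemma sum_seq_le_card D u B : (forall k, k \in D -> u k <= B) ->
  \sum_(k <- D) u k <= #|` D|%:R * B.
Proof.
move=> uB; rewrite mulr_natl -[_ *+ _]addr0 -iter_addr -[X in iter X]count_predT -big_const_seq.
by rewrite big_seq [leRHS]big_seq; apply: ler_sum.
Qed.

(** Young's inequality on normalised sequences; a vanishing [A] or [B] cannot be normalised by, but
    then forces the sequence itself to vanish on [D]. *)
Lemma mean_hoelder p q D u c A B : (1 <= p)%E -> (p^-1 + q^-1 = 1)%E ->
  (forall k, 0 <= u k) -> (forall k, 0 <= c k) -> 0 <= A -> 0 <= B ->
  mean_le p D u A -> mean_le q D c B ->
  \sum_(k <- D) u k * c k <= #|` D|%:R * (A * B).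
Proof.
move=> p1 pq u0 c0 A0 B0.
have one (v w : K -> R) (E F : R) : (forall k, 0 <= v k) -> (forall k, 0 <= w k) ->
    0 <= E -> 0 <= F -> mean_le 1%E D v E -> mean_le +oo%E D w F ->
    \sum_(k <- D) v k * w k <= #|` D|%:R * (E * F).
  move=> v0 w0 E0 F0 /=; rewrite powRr1// => vE wF.
  rewrite mulrA; apply: (@le_trans _ _ ((\sum_(k <- D) v k) * F)).
    rewrite mulr_suml big_seq [leRHS]big_seq; apply: ler_sum => k kD.
    by rewrite ler_wpM2l// wF.
  rewrite ler_wpM2r//; apply: le_trans vE.
  by rewrite le_eqVlt; apply/orP; left; apply/eqP/eq_bigr => k _; rewrite powRr1.
case: (conjugate_cases p1 pq) => [[-> ->]|[-> ->]|[r [s [-> -> r1 s1 rs]]]].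
- exact: one.
- by move=> uA cB; under eq_bigr do rewrite mulrC; rewrite [A * B]mulrC; exact: one.
have r0 : 0 < r by rewrite (lt_trans ltr01).
have s0 : 0 < s by rewrite (lt_trans ltr01).
have zero (v : K -> R) (t : R) : 0 < t -> (forall k, 0 <= v k) ->
    \sum_(k <- D) v k `^ t <= #|` D|%:R * 0 `^ t -> forall k, k \in D -> v k = 0.
  move=> t0 v0; rewrite powR0 ?gt_eqF// mulr0 => h k kD.
  apply/eqP; suff : v k `^ t == 0 by rewrite powR_eq0 (gt_eqF t0) andbT.
  have : \sum_(k <- D) v k `^ t == 0 by rewrite eq_le h sumr_ge0// => *; exact: powR_ge0.
  rewrite psumr_eq0; last by move=> *; exact: powR_ge0.
  by move/allP => /(_ k kD).
move=> /= uA cB.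
have [A00|A00] := eqVneq A 0.
  rewrite A00 in uA *; rewrite mul0r mulr0 big_seq big1// => k kD.
  by rewrite (zero u r r0 u0 uA k kD) mul0r.
have [B00|B00] := eqVneq B 0.
  rewrite B00 in cB *; rewrite !mulr0 big_seq big1// => k kD.
  by rewrite (zero c s s0 c0 cB k kD) mulr0.
have Ap : 0 < A by rewrite lt_neqAle eq_sym A00.
have Bp : 0 < B by rewrite lt_neqAle eq_sym B00.
apply: (@le_trans _ _ (A * B * \sum_(k <- D) ((u k / A) `^ r / r + (c k / B) `^ s / s))).
  rewrite mulr_sumr; apply: ler_sum => k _.
  have -> : u k * c k = A * B * ((u k / A) * (c k / B)).
    by rewrite mulrACA [A * _]mulrC [B * _]mulrC !divfK.
  by rewrite ler_wpM2l ?mulr_ge0// conjugate_powR// divr_ge0// ltW.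
rewrite mulrC ler_wpM2r ?mulr_ge0// big_split/= -!mulr_suml.
have norm (v : K -> R) (t E : R) : 0 < t -> 0 < E -> (forall k, 0 <= v k) ->
    \sum_(k <- D) v k `^ t <= #|` D|%:R * E `^ t ->
    \sum_(k <- D) (v k / E) `^ t / t <= #|` D|%:R * t^-1.
  move=> t0 E0 v0 vE; rewrite -mulr_suml ler_wpM2r ?invr_ge0 ?(ltW t0)//.
  under eq_bigr do rewrite powRM ?invr_ge0 ?(ltW E0)//.
  rewrite -mulr_suml.
  have -> : E^-1 `^ t = (E `^ t)^-1 by rewrite -powR_inv1 ?(ltW E0)// -powRrM mulN1r powRN.
  by rewrite ler_pdivrMr// powR_gt0.
apply: le_trans (lerD (_ : _ <= #|` D|%:R * r^-1) (_ : _ <= #|` D|%:R * s^-1)) _.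
- by rewrite mulr_suml; exact: norm.
- by rewrite mulr_suml; exact: norm.
- by rewrite -mulrDr rs mulr1.
Qed.

(** Converse of Hölder with explicit extremal sequences: the constant 1 for p = 1, a point mass for
    p = oo, and u^{r-1} otherwise. *)
Lemma mean_dual p q D u A : (1 <= p)%E -> (p^-1 + q^-1 = 1)%E ->
  (0 < #|` D|)%N -> (forall k, 0 <= u k) -> 0 <= A ->
  (forall c B, (forall k, 0 <= c k) -> 0 <= B -> mean_le q D c B ->
    \sum_(k <- D) u k * c k <= #|` D|%:R * (A * B)) ->
  mean_le p D u A.
Proof.
move=> p1 pq D0 u0 A0 H; have DR : 0 < #|` D|%:R :> R by rewrite ltr0n.
case: (conjugate_cases p1 pq) => [[-> qE]|[-> qE]|[r [s [-> qE r1 s1 rs]]]]; rewrite qE in H.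
- have := H (fun=> 1) 1 (fun=> ler01) ler01 (fun _ _ => lexx _).
  rewrite mulr1 /= powRr1//; apply: le_trans.
  by rewrite le_eqVlt; apply/orP; left; apply/eqP/eq_bigr => k _; rewrite powRr1// mulr1.
(* The mass is the cardinal of [D], so that the normalised l_1 norm of the test sequence is 1. *)
- move=> k kD; pose c l : R := if l == k then #|` D|%:R else 0.
  have E (F : K -> R -> R) : (forall l, F l 0 = 0) ->
      \sum_(l <- D) F l (c l) = F k #|` D|%:R.
    move=> F0; rewrite (big_fsetD1 k)//= /c eqxx big_seq big1 ?addr0// => l.
    by rewrite !inE => /andP[/negbTE-> _].
  have : mean_le 1%E D c 1.
    by rewrite /= (E (fun _ x => x `^ 1)) ?powRr1 ?mulr1// => l; rewrite powR0// oner_eq0.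
  move=> /(H c 1 _ ler01); rewrite (E (fun l x => u l * x)); last by move=> l; rewrite mulr0.
  by rewrite mulr1 mulrC ler_pM2l//; apply => l; rewrite /c; case: ifP.
- have r0 : 0 < r by rewrite (lt_trans ltr01).
  have s0 : 0 < s by rewrite (lt_trans ltr01).
  pose X := (\sum_(k <- D) u k `^ r) / #|` D|%:R.
  have X0 : 0 <= X by rewrite divr_ge0// sumr_ge0// => *; exact: powR_ge0.
  have SE : \sum_(k <- D) u k `^ r = #|` D|%:R * X by rewrite /X mulrC divfK// gt_eqF.
  have e1 : (r - 1) * s = r.
    have sE : s^-1 = 1 - r^-1 by rewrite -rs addrAC subrr add0r.
    rewrite -[s]invrK sE; field; rewrite gt_eqF//=; apply/eqP => h.
    by move: r1; rewrite -subr_gt0 h ltxx.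
  have := H (fun k => u k `^ (r - 1)) (X `^ s^-1) (fun k => powR_ge0 _ _) (powR_ge0 _ _).
  rewrite /= -powRrM mulVf ?gt_eqF// powRr1//.
  under eq_bigr do rewrite -powRrM e1.
  have -> : \sum_(k <- D) u k * u k `^ (r - 1) = \sum_(k <- D) u k `^ r.
    by apply: eq_bigr => k _; rewrite mulr_powRB1.
  rewrite SE => /(_ (lexx _)); rewrite !ler_pM2l// => XA.
  have [X00|X00] := eqVneq X 0; first by rewrite X00 powR_ge0.
  have Xp : 0 < X by rewrite lt_neqAle eq_sym X00.
  have : X `^ r^-1 <= A.
    have rE : r^-1 = 1 - s^-1 by rewrite -rs addrK.
    rewrite rE powRB; last by rewrite X00 implybT.
    by rewrite powRr1// ler_pdivrMr ?powR_gt0.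
  move=> /(ge0_ler_powR (ltW r0)) -/(_ (powR_ge0 _ _) A0).
  by rewrite -powRrM mulVf ?gt_eqF// powRr1.
Qed.

End discrete_norm.

Section marcinkiewicz_zygmund.
Context {R : realType} {n : nat}.
Local Notation Rn := 'cV[R]_n.
Local Notation Zn := 'cV[int]_n.
Local Notation C := R[i].
Implicit Types (a : 'I_n -> R) (b : 'I_n -> int) (f P : Rn -> C) (k l : Zn) (x y : Rn).

(** The condition uses the closed symmetric box, which contains D(A), and concerns only frequencies
    that actually occur. *)
Definition bandlimited a P := exists (S : {fset Zn}) (w : Zn -> C),
  P = trig S w /\ forall k, k \in S -> w k != 0 -> forall i, `|gnode a k i ord0| <= 2^-1.

Lemma bandlimited_Dset a w : (forall i, a i != 0) -> bandlimited a (trig (Dset a) w).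
Proof.
move=> a0; exists (Dset a), w; split => // k; rewrite in_Dset// => /asboolP ck _ i.
exact: cube_le_half.
Qed.

Lemma bandlimited_Lp p a P : (1 <= p)%E -> bandlimited a P -> Lp p P.
Proof. by move=> p1 [S [w [-> _]]]; exact: Lp_trig. Qed.

(** A Riemann sum compared with its integral: by [pwt_slow] the sum at the nodes is at most a
    constant times its value at any shift within a cell, and by periodicity the average over a cell
    is the average over the torus. *)
Lemma pwt_mean_le : exists2 K : R, 0 <= K & forall (c : R) b, 0 < c <= 4 ->
  (forall i, b i != 0) -> forall y,
  \sum_(k <- Dset (fun i => (b i)%:~R : R))
     pwt (fun i => c * (b i)%:~R) (gnode (fun i => (b i)%:~R) k + y)
  <= K * #|` Dset (fun i => (b i)%:~R : R)|%:R.
Proof.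
have [K K0 hK] := @integral_pwt_le R n.
pose c0 : R := (2 + 32 * pi ^+ 2) ^+ n.
have c00 : 0 <= c0 by rewrite exprn_ge0// addr_ge0// mulr_ge0// sqr_ge0.
exists (c0 * K); first by rewrite mulr_ge0.
move=> c b /andP[cp c4] b0 y.
set a : 'I_n -> R := fun i => (b i)%:~R; set D := Dset a; set a' := fun i => c * a i.
have a0 i : a i != 0 by rewrite intr_eq0.
have a'0 i : a' i != 0 by rewrite mulf_neq0// gt_eqF.
have mp (z : Rn) : measurable_fun setT (fun t : Rn => pwt a' (z + t)).
  apply: (measurableT_comp (measurable_pwt a')).
  rewrite (_ : +%R z = fun t => t + z); last by apply/funext => t; exact: addrC.
  exact: measurable_funD_cV.
pose F (t : Rn) : \bar R := (\sum_(k <- D) pwt a' (gnode a k + (y + t)))%:E.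
have F0 t : (0 <= F t)%E by rewrite lee_fin sumr_ge0// => k _; exact: pwt_ge0.
have mF : measurable_fun setT F.
  apply/measurable_EFinP; apply: measurable_sum => k.
  by under eq_fun do rewrite addrA; exact: mp.
have FA (t : Rn) l : F (t + gnode a l) = F t.
  rewrite /F; congr _%:E.
  rewrite -(@sum_Dset_shift R n _ b (fun k => pwt a' (gnode a k + (y + t))) l b0).
    by apply: eq_bigr => k _; congr (pwt _ _); rewrite gnodeD -[RHS]addrA; congr (_ + _); rewrite addrA addrC.
  by move=> k l'; rewrite gnodeD gnode_zmul// addrAC pwt_periodic.
pose cell := [set scale_cV (fun i => (b i)%:~R^-1 : R) t | t in @cube R n].
have cellE : cell = scale_cV a @^-1` cube.
  apply/seteqP; split => [_ [t ct <-]|t ct] /=; first by rewrite (scale_cVK a0).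
  by exists (scale_cV a t) => //; rewrite (scale_cVVK a0).
have mcell : measurable cell.
  rewrite cellE -[X in measurable X]setTI.
  by apply: measurable_scale_cV => //; exact: measurable_cube.
have F00 : F 0 = (\sum_(k <- D) pwt a' (gnode a k + y))%:E.
  by rewrite /F; congr _%:E; apply: eq_bigr => k _; rewrite addr0.
have mcF : measurable_fun setT (fun t => c0%:E * F t)%E by exact: measurable_funeM.
have cF0 t : (0 <= c0%:E * F t)%E by rewrite mule_ge0.
rewrite -lee_fin -F00 -[leLHS](@ge0_integral_torus_cst R n)//.
rewrite -(@ge0_integral_cell R n b (fun=> F 0) b0)//.
apply: (@le_trans _ _ (\int[torus]_t (c0%:E * F t))%E).
  rewrite -(@ge0_integral_cell R n b (fun t => c0%:E * F t)%E b0)//; last first.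
    by move=> t l; have := FA t l; rewrite /gnode => ->.
  apply: lee_wpmul2l; first by rewrite lee_fin prodr_ge0.
  apply: ge0_le_integral => //; first exact: measurable_funTS mcF.
  move=> t; rewrite -/cell cellE => ct.
  rewrite /F -EFinM lee_fin mulr_sumr; apply: ler_sum => k _.
  (* In a cell |a_i t_i| <= 1/2, so c <= 4 gives exactly the bound 2 that [pwt_slow] asks for. *)
  rewrite addr0 addrA; apply: pwt_slow => i.
  rewrite /a' -mulrA normrM (gtr0_norm cp).
  have := cube_le_half i ct; rewrite mxE => h.
  have : 0 <= `|a i * t i ord0| by exact: normr_ge0.
  nra.
rewrite ge0_integralZl//.
rewrite -mulrA EFinM; apply: lee_wpmul2l; first by rewrite lee_fin.
under eq_integral do rewrite /F -sumEFin.
rewrite ge0_integral_sum//; last 2 first.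
- by move=> k; apply/measurable_EFinP; under eq_fun do rewrite addrA; exact: mp.
- by move=> k t _; rewrite lee_fin pwt_ge0.
apply: (@le_trans _ _ (\sum_(k <- D) K%:E)%E).
  apply: lee_sum => k _; under eq_integral do rewrite addrA addrC.
  rewrite (@ge0_integral_torusD R n _ (fun t => (pwt a' t)%:E))//.
  - exact: hK.
  - by apply/measurable_EFinP; exact: measurable_pwt.
  - by move=> t; rewrite lee_fin pwt_ge0.
  - by move=> t l; rewrite pwt_periodic.
rewrite sumEFin lee_fin mulrC.
by apply: sum_seq_le_card.
Qed.

End marcinkiewicz_zygmund.

(** * Reflections, convolution norms and duality *)

Section reflection.
Context {R : realType} {n : nat}.
Local Notation Rn := 'cV[R]_n.
Local Notation Zn := 'cV[int]_n.
Local Notation C := R[i].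
Implicit Types (f g : Rn -> C) (x y z : Rn) (p q : \bar R).

Lemma measurable_reflect z : measurable_fun setT (fun y : Rn => z - y).
Proof.
apply: measurable_fun_cV => i; under eq_fun do rewrite !mxE.
by apply: measurable_funB => //; exact: measurable_coord.
Qed.

Lemma lpnorm_reflect p f z : (1 <= p)%E -> cmeas f -> Defs.periodic f ->
  lpnorm p (fun y => f (z - y)) = lpnorm p f.
Proof.
move=> p1 mf pf.
apply: (@Lnorm_tau _ _ p (fun x => (normc (f x))%:E) (fun y => z - y)) => //.
- exact: measurable_reflect.
- by move=> F mF F0 FZ; exact: ge0_integral_torusN.
- exact: emeas_normc.
- by move=> x k; rewrite pf.
Qed.

Lemma Cint_reflect f z : Defs.periodic f -> cmeas f -> Cint (fun y => f (z - y)) = Cint f.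
Proof.
move=> pf mf; apply: (@Cint_change _ _ (fun y => z - y)) => //; first exact: measurable_reflect.
by move=> F mF F0 FZ; exact: ge0_integral_torusN.
Qed.

Lemma int_vecN k : int_vec (- k) = - int_vec k :> Rn.
Proof. by apply/colP => i; rewrite !mxE rmorphN. Qed.

Lemma periodic_reflect f z : Defs.periodic f -> Defs.periodic (fun y => f (z - y)).
Proof. by move=> pf k x; rewrite opprD addrA -int_vecN pf. Qed.

Lemma Lp_reflect p f z : (1 <= p)%E -> Lp p f -> Lp p (fun y => f (z - y)).
Proof.
move=> p1 [pf mf f1]; split.
- exact: periodic_reflect.
- exact: (cmeas_comp (t := fun y => z - y) Rn Rn mf (measurable_reflect z)).
- by rewrite lpnorm_reflect.
Qed.

Lemma conjugateC p q : (p^-1 + q^-1 = 1 -> q^-1 + p^-1 = 1)%E.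
Proof. by rewrite addeC. Qed.

Lemma conjugate_ge1 p q : (1 <= p -> p^-1 + q^-1 = 1 -> 1 <= q)%E.
Proof.
move=> p1 pq; case: (conjugate_cases p1 pq) => [[_ ->]|[_ ->]|[r [s [_ -> _ s1 _]]]].
- exact: leey.
- by [].
- by rewrite lee_fin ltW.
Qed.

Lemma int_le_lpnorm p q f : (1 <= p)%E -> (p^-1 + q^-1 = 1)%E -> cmeas f ->
  (\int[torus]_x (normc (f x))%:E <= lpnorm p f)%E.
Proof.
move=> p1 pq mf; have := hoelder_lpnorm p1 pq mf (cmeas_cst (1 : C)).
rewrite lpnorm_cst; last exact: conjugate_ge1 pq.
by rewrite normc1 mule1; under eq_integral do rewrite mulr1.
Qed.

Lemma tconvE (S : {fset Zn}) w f : Defs.periodic f -> cintegrable f ->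
  tconv (trig S w) f = trig S (fun l => w l * fcoef f l).
Proof.
move=> pf fi; apply/funext => x; rewrite /tconv.
(* [conv_trig] expects coefficients that vanish off [S], while [w] is arbitrary there. *)
pose w' k := if k \in S then w k else 0.
have wE : trig S w = trig S w' :> (Rn -> C).
  apply/funext => y; rewrite /trig big_seq [RHS]big_seq; apply: eq_bigr => k kS.
  by rewrite /w' kS.
pose H y := trig S w' y * f (x - y).
have Hi : cintegrable H.
  have := cintegrableMb (@cintegrable_conv R n f x 1 isT pf fi) (cmeas_trig S w') (normc_trig S w').
  by under eq_fun do rewrite mulr1n.
have pH : Defs.periodic H.
  by move=> k y; rewrite /H trig_periodic (periodic_reflect x pf).
transitivity (Cint H).
  rewrite -(Cint_reflect x pH (proj1 Hi)) wE; congr Cint; apply/funext => y.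
  by rewrite /H subKr.
have := @conv_trig R n S w' f x 1 S isT pf fi.
under [X in Cint X]eq_fun do rewrite mulr1n.
rewrite /H => ->.
- rewrite /trig big_seq [RHS]big_seq; apply: eq_bigr => k kS.
  by rewrite mulr1n /w' kS.
- by move=> k /negbTE kS; rewrite /w' kS.
- by move=> k /negbTE kS; rewrite mulr1n /w' kS.
Qed.

Lemma conv_norm_ge0 q (phi : Rn -> C) : (1 <= q)%E -> (0 <= conv_norm q phi)%E.
Proof.
move=> q1; apply: (@le_trans _ _ (lpnorm q (tconv phi (fun=> 0)))); first exact: lpnorm_ge0.
apply: ereal_sup_ubound; exists (fun=> 0) => //; split; last by rewrite lpnorm0.
by split; [by []|exact: cmeas_cst|rewrite lpnorm0// ltry].
Qed.

(** A crude coefficient bound; it only serves to make the norm a real number so that products of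
    extended reals can be handled. *)
Lemma conv_norm_fin p q (S : {fset Zn}) w : (1 <= q)%E -> (q^-1 + p^-1 = 1)%E ->
  conv_norm q (trig S w : Rn -> C) \is a fin_num.
Proof.
move=> q1 qp; rewrite ge0_fin_numE ?conv_norm_ge0//.
apply: (@le_lt_trans _ _ (\sum_(k <- S) normc (w k) * 2)%:E); last exact: ltry.
apply: ub_ereal_sup => _ [f [[pf mf foo] f1] <-].
have fi := Lp_cintegrable q1 (And3 pf mf foo).
rewrite tconvE//; apply: lpnorm_le_bound => //; first exact: cmeas_trig.
move=> x; apply: le_trans (normc_trig _ _ _) _; apply: ler_sum => k _.
rewrite normcM ler_wpM2l ?normc_ge0// -lee_fin; apply: le_trans (normc_Cint _) _.
  exact: cintegrable_coef.
rewrite -[leRHS]mule1; apply: lee_wpmul2l => //; apply: le_trans f1.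
apply: le_trans (int_le_lpnorm q1 qp mf).
rewrite le_eqVlt; apply/orP; left; apply/eqP/eq_integral => y _.
by rewrite normcM normc_expk mulr1.
Qed.

Lemma conv_norm_le p q (S : {fset Zn}) w f : (1 <= q)%E -> (q^-1 + p^-1 = 1)%E -> Lp q f ->
  (lpnorm q (tconv (trig S w) f) <= conv_norm q (trig S w : Rn -> C) * lpnorm q f)%E.
Proof.
move=> q1 qp fq; have [pf mf foo] := fq; have fi := Lp_cintegrable q1 fq.
have Kf := @conv_norm_fin p q S w q1 qp.
rewrite -(fineK Kf); apply: homogeneous_bound.
- by rewrite fine_ge0// conv_norm_ge0.
- exact: lpnorm_ge0.
- by rewrite ge0_fin_numE// lpnorm_ge0.
move=> B B0 fB; rewrite (fineK Kf) muleC -lee_pdivrMl//.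
have BE : normc (B^-1)%:C = B^-1 by rewrite normc_real gtr0_norm// invr_gt0.
have fBq := LpZ (B^-1)%:C q1 fq.
rewrite -[X in (X%:E * _)%E]BE -lpnormZ//; last by rewrite tconvE//; exact: cmeas_trig.
apply: ereal_sup_ubound; exists (fun x => (B^-1)%:C * f x).
  by split => //; rewrite lpnormZ// BE lee_pdivrMl// mule1.
congr lpnorm; rewrite !tconvE//; last exact: cintegrableZ.
  apply/funext => x; rewrite /trig mulr_sumr; apply: eq_bigr => k _.
  by rewrite fcoefZ//; ring.
by move=> k x; rewrite pf.
Qed.

Lemma Cint_real (u : Rn -> R) : Cint (fun x => (u x)%:C) = (\int[torus]_x u x)%:C.
Proof. by rewrite /Cint /= /Rintegral integral0. Qed.

(** The extremal test function is conj(T) |T|^{r-2}. Boundedness of [T] ensures that it lies in L_q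
    and that all integrals involved are finite. *)
Lemma lpnorm_dual (r A : R) q (T : Rn -> C) : 1 <= r -> ((r%:E)^-1 + q^-1 = 1)%E ->
  Defs.periodic T -> cmeas T -> (exists B, forall x, normc (T x) <= B) -> 0 <= A ->
  (forall h, Lp q h -> ((normc (Cint (fun x => T x * h x)%R))%:E <= A%:E * lpnorm q h)%E) ->
  (lpnorm r%:E T <= A%:E)%E.
Proof.
move=> r1 pq pT mT [B TB] A0 H; have r0 : 0 < r by rewrite (lt_le_trans ltr01).
have p1 : (1 <= r%:E)%E by rewrite lee_fin.
have q1 := conjugate_ge1 p1 pq.
pose h x : C := (T x)^*%C * (normc (T x) `^ (r - 2))%:C.
have mnT := cmeas_normc mT.
have mh : cmeas h.
  apply: cmeasM.
    case: mT => mR mI; split.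
      rewrite (_ : (fun x => _) = fun x => complex.Re (T x))//.
      by apply/funext => x; case: (T x).
    rewrite (_ : (fun x => _) = fun x => - complex.Im (T x)); first exact: measurable_funN.
    by apply/funext => x; case: (T x).
  split => //=; exact: (measurableT_comp (measurable_powR _) mnT).
(* At r = 1 the convention 0^0 = 1 would give the wrong value at zeros of [T], where [h] vanishes;
   hence the alternative. *)
have hE x : normc (h x) = normc (T x) `^ (r - 1) \/ (normc (h x) = 0 /\ normc (T x) = 0).
  have [T0|T0] := eqVneq (normc (T x)) 0.
    by right; rewrite /h normcM normc_conj T0 mul0r.
  left; rewrite /h normcM normc_conj normc_real ger0_norm ?powR_ge0//.
  rewrite -[X in X * _]powRr1 ?normc_ge0// -powRD ?T0 ?implybT//; congr (_ `^ _); ring.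
have ThE x : T x * h x = (normc (T x) `^ r)%:C.
  rewrite /h mulrA normcMconj -rmorphM/=; congr (_%:C).
  have [T0|T0] := eqVneq (normc (T x)) 0; first by rewrite T0 expr0n mul0r powR0// gt_eqF.
  rewrite -powR_mulrn ?normc_ge0// -powRD ?T0 ?implybT//; congr (_ `^ _); ring.
have hB : exists B', forall x, normc (h x) <= B'.
  exists (B `^ (r - 1)) => x.
  have [->|[-> _]] := hE x; last exact: powR_ge0.
  by apply: ge0_ler_powR; rewrite ?subr_ge0// nnegrE ?normc_ge0// (le_trans _ (TB x))// normc_ge0.
have hq : Lp q h.
  split => //; first by move=> k x; rewrite /h pT.
  case: hB => B' hB'; exact: le_lt_trans (lpnorm_le_bound q1 mh hB') (ltry _).
pose X := \int[torus]_x (normc (T x) `^ r).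
have mTr : measurable_fun setT (fun x => normc (T x) `^ r).
  exact: (measurableT_comp (measurable_powR _) mnT).
have Xfin : (\int[torus]_x (normc (T x) `^ r)%:E \is a fin_num)%E.
  rewrite ge0_fin_numE; last by apply: integral_ge0 => x _; rewrite lee_fin powR_ge0.
  apply: (@le_lt_trans _ _ (\int[torus]_(x in [set: Rn]) (B `^ r)%:E)%E).
    apply: ge0_le_integral => //.
    - by move=> x _; rewrite lee_fin powR_ge0.
    - exact/measurable_EFinP.
    - move=> x _; rewrite lee_fin; apply: ge0_ler_powR; rewrite ?(ltW r0)// nnegrE ?normc_ge0//.
      by rewrite (le_trans _ (TB x))// normc_ge0.
  by rewrite ge0_integral_torus_cst ?ltry// lee_fin powR_ge0.
have XE : (\int[torus]_x (normc (T x) `^ r)%:E = X%:E)%E by rewrite /X /Rintegral fineK.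
have X0 : 0 <= X.
  by rewrite -lee_fin -XE; apply: integral_ge0 => x _; rewrite lee_fin powR_ge0.
have NE : lpnorm r%:E T = (X `^ r^-1)%:E.
  rewrite /lpnorm Lnorm_fin -poweR_EFin -XE; congr (_ `^ _)%E; apply: eq_integral => x _.
  by rewrite gee0_abs ?lee_fin ?normc_ge0.
have := H h hq.
rewrite (_ : Cint _ = X%:C); last first.
  by rewrite -Cint_real; congr Cint; apply/funext => x; rewrite ThE.
rewrite normc_real ger0_norm// NE lee_fin => XA.
case: (conjugate_cases p1 pq) => [[[rE] qE]|[]//|[r' [s [[rE] qE r'1 s1 rs]]]].
  rewrite rE invr1 powRr1//; rewrite -lee_fin; apply: le_trans XA _.
  rewrite -[leRHS]mule1; apply: lee_wpmul2l; first by rewrite lee_fin.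
  apply: lpnorm_le_bound => // x; rewrite rE in hE; have [->|[-> _]//] := hE x.
  by rewrite subrr powRr0.
rewrite -rE in rs r'1 => {r' rE}.
have s0 : 0 < s by rewrite (lt_trans ltr01).
have e1 : (r - 1) * s = r.
  have sE : s^-1 = 1 - r^-1 by rewrite -rs addrAC subrr add0r.
  rewrite -[s]invrK sE; field; rewrite gt_eqF//=; apply/eqP => hh.
  by move: r'1; rewrite -subr_gt0 hh ltxx.
have hN : lpnorm q h = (X `^ s^-1)%:E.
  rewrite qE /lpnorm Lnorm_fin -poweR_EFin -XE; congr (_ `^ _)%E; apply: eq_integral => x _.
  rewrite gee0_abs ?lee_fin ?normc_ge0// poweR_EFin; congr _%:E.
  have [->|[-> ->]] := hE x; first by rewrite -powRrM e1.
  by rewrite !powR0// gt_eqF.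
move: XA; rewrite hN -EFinM lee_fin => XA.
have [X00|X00] := eqVneq X 0; first by rewrite X00 powR0// invr_eq0 gt_eqF.
have Xp : 0 < X by rewrite lt_neqAle eq_sym X00.
have rE : r^-1 = 1 - s^-1 by rewrite -rs addrK.
rewrite rE powRB; last by rewrite X00 implybT.
by rewrite powRr1// ler_pdivrMr ?powR_gt0.
Qed.

End reflection.

(** * Samples of band-limited functions and sums of translates *)

Section sampling.
Context {R : realType} {n : nat}.
Local Notation Rn := 'cV[R]_n.
Local Notation Zn := 'cV[int]_n.
Local Notation C := R[i].
Implicit Types (f P F psi : Rn -> C) (x y z : Rn) (p q : \bar R) (b : 'I_n -> int).
Context (v : Rn -> C) (v_smooth : smooth v)
  (v_eq1 : forall x, (forall i, - (1 / 4) <= x i ord0 < 1 / 4) -> v x = 1)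
  (v_eq0 : forall x, ~ (forall i, - (3 / 8) <= x i ord0 < 3 / 8) -> v x = 0).

Let r38 : 0 <= 3 / 8 :> R. Proof. by lra. Qed.
Let vn := v_nice v_smooth v_eq0.
Let Gr := nice_supp (vn 0%N).

Lemma conv_op_reproduce (a : 'I_n -> R) (S : {fset Zn}) (w : Zn -> C) : (forall i, a i != 0) ->
  (forall k, k \in S -> w k != 0 -> v (gnode a k) = 1) ->
  conv_op a v (trig S w) = trig S w.
Proof.
move=> a0 Sw; rewrite (conv_opE r38 a0 Gr (trig_periodic _ _) (cintegrable_trig _ _)).
transitivity (trig S (fun k => if k \in S then w k else 0) : Rn -> C).
  apply: eq_trig => k.
  - by move=> /(freqbox_supp r38 a0 Gr) ->; rewrite mul0r.
  - by move=> /negbTE ->.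
  - rewrite fcoef_trig; case: ifP => kS; last by rewrite mulr0.
    by have [->|wk] := eqVneq (w k) 0; rewrite ?mulr0// Sw ?mul1r.
by rewrite /trig; apply/funext => x; rewrite big_seq [RHS]big_seq; apply: eq_bigr => k ->.
Qed.

(** The factor 4 turns |x_i| <= 1/2 into |x_i| <= 1/8, where [v] is 1. *)
Lemma band_reproduce (a : 'I_n -> R) P : (forall i, a i != 0) -> bandlimited a P ->
  conv_op (fun i => 4 * a i) v P = P.
Proof.
move=> a0 [S [w [-> Sw]]]; apply: conv_op_reproduce => [i|k kS wk]; first by rewrite mulf_neq0.
apply: (v_one v_eq1) => i; have h := Sw k kS wk i.
rewrite gnodeZ mxE normrM normfV [ `|4|]gtr0_norm//.
by set t := `|_| in h *; lra.
Qed.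

(** A band-limited function is its own convolution with a kernel dominated by [pwt]; this converts
    pointwise values into local averages. *)
Lemma band_pointwise : exists2 K, 0 <= K & forall a, (forall i, 1 <= `|a i|) ->
  forall P, bandlimited a P -> forall z,
  ((normc (P z))%:E <= K%:E *
     \int[torus]_y (normc (P (z - y)) * pwt (fun i => 4 * a i) y)%:E)%E.
Proof.
have e4 : 0 < 4 :> R by [].
have [K K0 hK] := normc_kern_le_pwt r38 e4 vn.
exists (2 * K); first by rewrite mulr_ge0.
move=> a a1 P bP z.
have a0 i : a i != 0 by rewrite -normr_gt0 (lt_le_trans ltr01).
have a4 i : 4 <= `|4 * a i| by rewrite normrM gtr0_norm// ler_peMr.
have a40 i : 4 * a i != 0 by rewrite mulf_neq0.
have [S [w [PE _]]] := bP.
have pP : Defs.periodic P by rewrite PE; exact: trig_periodic.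
have Pi : cintegrable P by rewrite PE; exact: cintegrable_trig.
have ci : cintegrable (fun y => kern (fun i => 4 * a i) v y * P (z - y)).
  have := cintegrable_kern_conv z 1 r38 a40 Gr pP Pi.
  by under eq_fun do rewrite mulr1n.
have mz : measurable_fun setT (fun y => normc (P (z - y)) * pwt (fun i => 4 * a i) y).
  apply: measurable_funM; last exact: measurable_pwt.
  exact: cmeas_normc (cmeas_comp (t := fun y => z - y) Rn Rn (proj1 Pi) (measurable_reflect z)).
rewrite -[in leLHS](band_reproduce a0 bP) /conv_op.
apply: le_trans (normc_Cint ci) _; rewrite EFinM -muleA; apply: lee_wpmul2l => //.
rewrite -ge0_integralZl//; last 2 first.
- exact/measurable_EFinP.
- by move=> y _; rewrite lee_fin mulr_ge0 ?normc_ge0 ?pwt_ge0.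
apply: ge0_le_integral => //.
- by move=> y _; rewrite lee_fin normc_ge0.
- by apply: emeas_normc; case: ci.
- by apply: measurable_funeM; exact/measurable_EFinP.
- move=> y _; rewrite -EFinM lee_fin normcM mulrC mulrCA ler_wpM2l ?normc_ge0//.
  exact: hK.
Qed.

(* Marcinkiewicz-Zygmund; [e] selects the nodes [x_k] or [- x_k]. *)
Lemma band_samples : exists2 K, 0 <= K & forall b, (forall i, 1 <= `|(b i)%:~R : R|) ->
  forall P, bandlimited (fun i => (b i)%:~R) P -> forall (e : bool) p, (1 <= p)%E ->
  mean_le p (Dset (fun i => (b i)%:~R : R))
    (fun k => normc (P ((-1) ^+ e *: gnode (fun i => (b i)%:~R) k)))
    (K * fine (lpnorm p P)).
Proof.
have [K K0 hK] := band_pointwise.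
have [c c0 hc] := @integral_pwt_le R n.
have [c' c'0 hc'] := @pwt_mean_le R n.
(* One constant above both masses, so that c^{r-1} c' <= M^r for every exponent; the summand 1 keeps
   it positive. *)
pose M := c + c' + 1.
have M0 : 0 < M by rewrite /M ltr_wpDl// addr_ge0.
have cM : c <= M by rewrite /M -addrA lerDl addr_ge0.
have c'M : c' <= M by rewrite /M addrAC lerDr addr_ge0.
exists (K * M); first by rewrite mulr_ge0// ltW.
move=> b b1 P bP e p p1; set a : 'I_n -> R := fun i => (b i)%:~R; set D := Dset a.
have a0 i : a i != 0 by rewrite -normr_gt0 (lt_le_trans ltr01)// b1.
have b0 i : b i != 0 by have := a0 i; rewrite intr_eq0.
have a40 i : 4 * a i != 0 by rewrite mulf_neq0.
pose w := pwt (fun i => 4 * a i).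
have wc := hc _ a40; rewrite -/w in wc.
have Pp := bandlimited_Lp p1 bP; have [pP mP P1] := Pp.
pose zk k : Rn := (-1) ^+ e *: gnode a k.
have Hz y : \sum_(k <- D) w (zk k - y) <= c' * #|` D|%:R.
  have c4 : is_true ((0 < (4 : R)) && ((4 : R) <= 4)) by rewrite lexx ltr0n.
  rewrite /zk; case: (e) => /=.
    apply: le_trans (hc' 4 b c4 b0 y); rewrite le_eqVlt; apply/orP; left; apply/eqP.
    by apply: eq_bigr => k _; rewrite scaleN1r -opprD /w pwtN.
  apply: le_trans (hc' 4 b c4 b0 (- y)); rewrite le_eqVlt; apply/orP; left; apply/eqP.
  by apply: eq_bigr => k _; rewrite scale1r.
have mw : measurable_fun setT w by exact: measurable_pwt.
have w0 y : 0 <= w y by exact: pwt_ge0.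
have Nf : lpnorm p P \is a fin_num by rewrite ge0_fin_numE// lpnorm_ge0.
have N0 : 0 <= fine (lpnorm p P) by rewrite fine_ge0// lpnorm_ge0.
have mPz (z : Rn) : measurable_fun setT (fun y => normc (P (z - y))).
  exact: cmeas_normc (cmeas_comp (t := fun y => z - y) Rn Rn mP (measurable_reflect z)).
case: p p1 Pp P1 Nf N0 => [r| |]//; last first.
  move=> p1 Pp P1 Nf N0 k kD /=.
  rewrite -lee_fin; apply: le_trans (hK a b1 P bP (zk k)) _.
  rewrite -mulrA EFinM; apply: lee_wpmul2l; first by rewrite lee_fin.
  have pq : (+oo^-1 + 1^-1 = 1 :> \bar R)%E by rewrite invey add0e inver oner_eq0 invr1.
  have := Lnorm_hoelder p1 pq (mPz (zk k)) mw.
  rewrite [X in (X * _)%E](_ : _ = lpnorm +oo (fun y => P (zk k - y))) //.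
  rewrite lpnorm_reflect//; rewrite Lnorm1 => h.
  apply: (@le_trans _ _ (lpnorm +oo P * c%:E)%E); last first.
    by rewrite EFinM fineK// muleC; apply: lee_wpmul2r; rewrite ?lpnorm_ge0 ?lee_fin.
  apply: le_trans (le_trans _ h) _.
    rewrite le_eqVlt; apply/orP; left; apply/eqP/eq_integral => y _.
    by rewrite ger0_norm// mulr_ge0 ?normc_ge0.
  apply: lee_wpmul2l; first exact: lpnorm_ge0.
  apply: le_trans wc; rewrite le_eqVlt; apply/orP; left; apply/eqP/eq_integral => y _.
  by rewrite /= ger0_norm.
move=> p1 Pp P1 Nf N0 /=; have r1 : 1 <= r by rewrite -lee_fin.
have r0 : 0 < r by rewrite (lt_le_trans ltr01).
have mPr : measurable_fun setT (fun y => normc (P y) `^ r).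
  exact: (measurableT_comp (measurable_powR r) (cmeas_normc mP)).
have mwz (z : Rn) : measurable_fun setT (fun y => w (z - y)).
  exact: (measurableT_comp mw (measurable_reflect z)).
have NE : (\int[torus]_y (normc (P y) `^ r)%:E = (fine (lpnorm r%:E P) `^ r)%:E)%E.
  rewrite -poweR_EFin fineK// /lpnorm Lnorm_fin -poweRrM mulVf ?gt_eqF// poweRe1.
    by apply: eq_integral => y _; rewrite gee0_abs ?lee_fin ?normc_ge0.
  by apply: integral_ge0 => y _; exact: poweR_ge0.
(* Jensen for the weight centred at the node moves the power inside; summing the weights over the
   nodes is then [pwt_mean_le]. *)
have step k : ((normc (P (zk k)) `^ r)%:E <= (K `^ r * c `^ (r - 1))%:E *
    \int[torus]_y (normc (P y) `^ r * w (zk k - y))%:E)%E.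
  rewrite -poweR_EFin; apply: le_trans (ge0_le_poweR (ltW r0) _ (hK a b1 P bP (zk k))) _.
    by rewrite lee_fin normc_ge0.
  rewrite poweRM ?lee_fin//; last first.
    by apply: integral_ge0 => y _; rewrite lee_fin mulr_ge0 ?normc_ge0 ?pwt_ge0.
  rewrite poweR_EFin EFinM -muleA; apply: lee_wpmul2l; first by rewrite lee_fin powR_ge0.
  apply: le_trans (jensen_weight r1 (mPz (zk k)) mw _ w0 wc) _.
    by move=> y; exact: normc_ge0.
  apply: lee_wpmul2l; first by rewrite lee_fin powR_ge0.
  rewrite -(@ge0_integral_torusN R n (zk k) (fun y => (normc (P y) `^ r * w (zk k - y))%:E)).
  - by rewrite le_eqVlt; apply/orP; left; apply/eqP/eq_integral => y _; rewrite subKr.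
  - by apply/measurable_EFinP; exact: measurable_funM.
  - by move=> y; rewrite lee_fin mulr_ge0// powR_ge0.
  - move=> y k'; congr (_%:E); rewrite pP; congr (_ * _).
    by rewrite opprD addrA -int_vecN /w pwt_periodic.
have mI k : measurable_fun setT (fun y => (normc (P y) `^ r * w (zk k - y))%:E).
  by apply/measurable_EFinP; exact: measurable_funM.
rewrite -lee_fin -sumEFin.
apply: (@le_trans _ _ (\sum_(k <- D) (K `^ r * c `^ (r - 1))%:E *
    \int[torus]_y (normc (P y) `^ r * w (zk k - y))%:E)%E).
  by apply: lee_sum => k _; exact: step.
have KC0 : 0 <= K `^ r * c `^ (r - 1) by rewrite mulr_ge0 ?powR_ge0.
rewrite -ge0_sume_distrr; last first.
  by move=> k _; apply: integral_ge0 => y _; rewrite lee_fin mulr_ge0// powR_ge0.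
rewrite -ge0_integral_sum//; last by move=> k y _; rewrite lee_fin mulr_ge0// powR_ge0.
apply: (@le_trans _ _ ((K `^ r * c `^ (r - 1))%:E *
    ((c' * #|` D|%:R)%:E * \int[torus]_y (normc (P y) `^ r)%:E))%E).
  apply: lee_wpmul2l; first by rewrite lee_fin.
  rewrite -ge0_integralZl//; last 3 first.
  - exact/measurable_EFinP.
  - by move=> y _; rewrite lee_fin powR_ge0.
  - by rewrite lee_fin mulr_ge0.
  apply: ge0_le_integral => //.
  - by move=> y _; apply: sume_ge0 => k _; rewrite lee_fin mulr_ge0// powR_ge0.
  - by apply: emeasurable_sum => k; exact: mI.
  - by apply: measurable_funeM; exact/measurable_EFinP.
  - move=> y _; rewrite sumEFin -EFinM lee_fin -mulr_sumr mulrC ler_wpM2r ?powR_ge0//.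
rewrite NE -!EFinM lee_fin.
set N := fine _ in N0 *.
rewrite [leLHS](_ : _ = #|` D|%:R * (N `^ r) * (K `^ r * (c `^ (r - 1) * c'))); last by ring.
rewrite powRM ?mulr_ge0 ?(ltW M0)// powRM ?(ltW M0)// -mulrA.
rewrite ler_wpM2l// [leRHS]mulrC ler_wpM2l ?powR_ge0// ler_wpM2l ?powR_ge0//.
rewrite -(mulr_powRB1 (ltW M0) r0) [leLHS]mulrC; apply: ler_pM => //; first exact: powR_ge0.
by apply: ge0_ler_powR; rewrite ?subr_ge0// nnegrE// ltW.
Qed.

(** Pairing the sum with [h] gives the mean of r_k G(- x_k), where G is phi convolved with the
    reflection of [h]. Discrete Hölder, the sampling inequality for G and the definition of
    [conv_norm] finish the case p < oo by duality. *)
Lemma mean_translates_bound : exists2 K, 0 <= K & forall b,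
  (forall i, 1 <= `|(b i)%:~R : R|) ->
  forall p q, (1 <= p)%E -> (p^-1 + q^-1 = 1)%E ->
  forall w (r : Zn -> C) B, 0 <= B ->
  let a : 'I_n -> R := fun i => (b i)%:~R in
  mean_le p (Dset a) (fun k => normc (r k)) B ->
  (lpnorm p (fun x => (#|` Dset a|%:R^-1)%:C *
     \sum_(k <- Dset a) r k * trig (Dset a) w (x - gnode a k))%R
   <= (K * B)%:E * conv_norm q (trig (Dset a) w : Rn -> C))%E.
Proof.
have [K K0 hK] := band_samples.
have e4 : 0 < 4 :> R by [].
have [K2 K20 hK2] := normc_kern_le_pwt r38 e4 vn.
have [c c0 hc] := @integral_pwt_le R n.
exists (K * (1 + K2 * c)); first by rewrite mulr_ge0// addr_ge0// mulr_ge0.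
move=> b b1 p q p1 pq w r B B0 a rB.
have q1 := conjugate_ge1 p1 pq; have qp := conjugateC pq.
have a0 i : a i != 0 by rewrite -normr_gt0 (lt_le_trans ltr01)// b1.
have b0 i : b i != 0 by have := a0 i; rewrite intr_eq0.
set D := Dset a in rB *; set phi := trig D w.
have Kf := @conv_norm_fin R n p q D w q1 qp.
have KN0 := @conv_norm_ge0 R n q phi q1.
rewrite -(fineK Kf); set N := fine _; have N0 : 0 <= N by rewrite fine_ge0.
set T := (X in lpnorm p X).
have D0 : 0 < #|` D|%:R :> R.
  rewrite ltr0n card_Dset//; apply/prodn_gt0 => i; by rewrite absz_gt0.
pose W l : C := (#|` D|%:R^-1)%:C * (\sum_(k <- D) r k * expk l (- gnode a k)) * w l.
have TE : T = trig D W.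
  apply/funext => x; rewrite /T /phi /trig mulr_sumr.
  under eq_bigr do rewrite mulrA mulr_sumr.
  rewrite exchange_big/=; apply: eq_bigr => l _; rewrite /W mulr_sumr !mulr_suml.
  by apply: eq_bigr => k _; rewrite expkDr; ring.
have bT : bandlimited a T by rewrite TE; exact: bandlimited_Dset.
have Ti : cintegrable T by rewrite TE; exact: cintegrable_trig.
have pT : Defs.periodic T by rewrite TE; exact: trig_periodic.
have key h : Lp q h -> ((normc (Cint (fun x => T x * h x)))%:E <=
    (K * B * N)%:E * lpnorm q h)%E.
  move=> hq; have [ph mh hoo] := hq; have hi := Lp_cintegrable q1 hq.
  have hf : lpnorm q h \is a fin_num by rewrite ge0_fin_numE// lpnorm_ge0.
  (* The reflection makes the pairing with translates of [phi] a genuine convolution, evaluated at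
     minus the nodes; this is why [band_samples] carries a sign. *)
  pose h' y := h (0 - y).
  have hq' : Lp q h' by exact: Lp_reflect.
  have hi' := Lp_cintegrable q1 hq'.
  have ph' : Defs.periodic h' by case: hq'.
  pose G := tconv phi h'.
  have GE : G = trig D (fun l => w l * fcoef h' l) by exact: tconvE.
  have bG : bandlimited a G by rewrite GE; exact: bandlimited_Dset.
  have Gval k : Cint (fun x => phi (x - gnode a k) * h x) = G (- gnode a k).
    rewrite /G /tconv -(@Cint_reflect R n (fun y => phi (- gnode a k - y) * h' y) 0).
    - by congr Cint; apply/funext => y; rewrite /h' subKr sub0r opprK addrC.
    - by move=> l y; rewrite /phi (periodic_reflect _ (trig_periodic D w)) ph'.
    - apply: cmeasM; last by case: hi'.
      exact: (cmeas_comp (t := fun y => - gnode a k - y) Rn Rn (cmeas_trig D w) (measurable_reflect _)).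
  have phk k : cintegrable (fun x => phi (x - gnode a k) * h x).
    apply: (cintegrableMb hi (K := \sum_(l <- D) normc (w l))) => [|x]; last exact: normc_trig.
    exact: cmeas_shift (cmeas_trig D w).
  have -> : Cint (fun x => T x * h x) =
      (#|` D|%:R^-1)%:C * \sum_(k <- D) r k * G (- gnode a k).
    transitivity ((#|` D|%:R^-1)%:C *
        \sum_(k <- D) Cint (fun x => r k * (phi (x - gnode a k) * h x))); last first.
      by congr (_ * _); apply: eq_bigr => k _; rewrite CintZ// Gval.
    rewrite -Cint_sum; last by move=> k; exact: cintegrableZ.
    rewrite -CintZ; last by apply: cintegrable_sum => k; exact: cintegrableZ.
    congr Cint; apply/funext => x; rewrite /T -mulrA mulr_suml; congr (_ * _).
    by apply: eq_bigr => k _; rewrite mulrA.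
  have Gn := @conv_norm_le R n p q D w h' q1 qp hq'.
  rewrite -/G lpnorm_reflect// -[X in (_ <= X * _)%E](fineK Kf) -/N in Gn.
  have Gf : lpnorm q G \is a fin_num.
    by rewrite ge0_fin_numE ?lpnorm_ge0//; case: (bandlimited_Lp q1 bG).
  have := hK b b1 G bG true q q1; rewrite -/a -/D => hG.
  have := mean_hoelder p1 pq (fun k => normc_ge0 (r k)) (fun k => normc_ge0 _) B0 _ rB hG.
  rewrite mulr_ge0 ?fine_ge0 ?lpnorm_ge0// => /(_ isT) hs.
  rewrite normcM normc_real ger0_norm ?invr_ge0//.
  apply: (@le_trans _ _ (B * (K * fine (lpnorm q G)))%:E).
    rewrite lee_fin ler_pdivrMl//; apply: le_trans (normc_sum _ _ _) _.
    apply: le_trans hs; rewrite le_eqVlt; apply/orP; left; apply/eqP.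
    by apply: eq_bigr => k _; rewrite normcM expr1 scaleN1r.
  rewrite mulrA [B * K]mulrC EFinM fineK// (EFinM (K * B) N) -muleA.
  by apply: lee_wpmul2l => //; rewrite lee_fin mulr_ge0.
have KBN : 0 <= K * B * N by rewrite !mulr_ge0.
rewrite -EFinM.
case: p p1 pq qp rB Kf N N0 key KBN {hK} => [s| |]// p1 pq qp rB Kf N N0 key KBN.
  apply: (@le_trans _ _ (K * B * N)%:E).
    apply: (lpnorm_dual _ pq) => //; [by case: Ti|].
    by exists (\sum_(l <- D) normc (W l)) => x; rewrite TE; exact: normc_trig.
  rewrite lee_fin; apply: ler_wpM2r => //; apply: ler_wpM2r => //.
  by rewrite -[leLHS]mulr1 ler_wpM2l// lerDl mulr_ge0.
have qE : q = 1%E.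
  by case: (conjugate_cases p1 pq) => [[]//|[_ ->]//|[? [? []]]//].
subst q.
apply: (lpnorm_le_bound p1 (proj1 Ti)) => x.
have a4 i : 4 <= `|4 * a i| by rewrite normrM gtr0_norm// ler_peMr// b1.
have a40 i : 4 * a i != 0 by rewrite mulf_neq0.
(* For p = oo the pointwise value is recovered by testing against the reproducing kernel centred at
   [x], whose L_1 norm is bounded uniformly; this adds K2 c to the constant. *)
pose kx y := kern (fun i => 4 * a i) v (x - y).
have pk : Defs.periodic (kern (fun i => 4 * a i) v).
  by rewrite (kern_trig r38 a40 Gr); exact: trig_periodic.
have mk : cmeas (kern (fun i => 4 * a i) v).
  by rewrite (kern_trig r38 a40 Gr); exact: cmeas_trig.
have kq : Lp 1%E kx.
  by apply: Lp_reflect => //; rewrite (kern_trig r38 a40 Gr); exact: Lp_trig.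
have kn : (lpnorm 1%E kx <= (K2 * c)%:E)%E.
  rewrite lpnorm_reflect// /lpnorm Lnorm1.
  apply: (@le_trans _ _ (\int[torus]_y (K2%:E * (pwt (fun i => 4 * a i) y)%:E))%E).
    apply: ge0_le_integral => //.
    - by apply: measurableT_comp => //; exact: emeas_normc.
    - by apply: measurable_funeM; apply/measurable_EFinP; exact: measurable_pwt.
    - move=> y _; rewrite gee0_abs; last by rewrite lee_fin normc_ge0.
      by rewrite -EFinM lee_fin; exact: hK2.
  rewrite ge0_integralZl//.
  - by rewrite EFinM lee_wpmul2l ?lee_fin//; exact: hc.
  - by apply/measurable_EFinP; exact: measurable_pwt.
  - by move=> y _; rewrite lee_fin pwt_ge0.
have -> : T x = Cint (fun y => T y * kx y).
  rewrite -[in LHS](band_reproduce a0 bT) /conv_op.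
  rewrite -(@Cint_reflect R n (fun y => T y * kx y) x).
  - by congr Cint; apply/funext => y; rewrite /kx subKr mulrC.
  - by move=> l y; rewrite pT /kx (periodic_reflect _ pk).
  - apply: cmeasM; first by case: Ti.
    exact: (cmeas_comp (t := fun y => x - y) Rn Rn mk (measurable_reflect _)).
rewrite -lee_fin; apply: le_trans (key _ kq) _.
apply: (@le_trans _ _ ((K * B * N)%:E * (K2 * c)%:E)%E); first by apply: lee_wpmul2l.
rewrite -EFinM lee_fin mulrAC; apply: ler_wpM2r => //.
by rewrite [leRHS]mulrAC ler_wpM2l ?mulr_ge0// lerDr.
Qed.

End sampling.

(** * Discrete Young inequality at the nodes *)

Section discrete_young.
Context {R : realType} {n : nat}.
Local Notation Rn := 'cV[R]_n.
Local Notation Zn := 'cV[int]_n.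
Local Notation C := R[i].
Implicit Types (f F psi : Rn -> C) (x y z t : Rn) (p q : \bar R) (b : 'I_n -> int).

Lemma sume_cst_seq (K : choiceType) (D : {fset K}) (X : \bar R) : (0 <= X)%E ->
  (\sum_(k <- D) X = #|` D|%:R%:E * X)%E.
Proof.
move=> X0; rewrite big_const_seq count_predT; elim: (size D) => [|m IH].
  by rewrite mul0e.
by rewrite iterS IH mulrS EFinD ge0_muleDl// mul1e.
Qed.

Lemma normc_tconv_le psi F x : cintegrable (fun y => psi (x - y) * F y) ->
  ((normc (tconv psi F x))%:E <= 2%:E * \int[torus]_y (normc (psi (x - y) * F y))%:E)%E.
Proof. exact: normc_Cint. Qed.

Lemma cintegrable_tconv p q psi F x : (1 <= p)%E -> (p^-1 + q^-1 = 1)%E ->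
  Lp p F -> Lp q psi -> cintegrable (fun y => psi (x - y) * F y).
Proof.
move=> p1 pq Fp pq'; have q1 := conjugate_ge1 p1 pq.
have [pF mF F1] := Fp; have [pP mP P1] := Lp_reflect x q1 pq'.
split; first exact: cmeasM.
apply: le_lt_trans (hoelder_lpnorm q1 (conjugateC pq) mP mF) _.
by apply: lte_mul_pinfty => //; [exact: lpnorm_ge0|rewrite ge0_fin_numE// lpnorm_ge0].
Qed.

(** The quantity whose L_q norm over a cell defines [Lqj_norm]; its periodicity under the node
    lattice turns that into a norm over the torus. *)
Definition node_mean b psi x : R := #|` Dset (fun i => (b i)%:~R : R)|%:R^-1 *
  \sum_(k <- Dset (fun i => (b i)%:~R : R)) normc (psi (x - gnode (fun i => (b i)%:~R) k)).

Lemma measurable_node_mean b psi : cmeas psi -> measurable_fun setT (node_mean b psi).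
Proof.
move=> mpsi; apply: measurable_funM => //; apply: measurable_sum => k.
exact: cmeas_normc (cmeas_shift _ mpsi).
Qed.

Lemma node_mean_ge0 b psi x : 0 <= node_mean b psi x.
Proof. by rewrite mulr_ge0 ?invr_ge0// sumr_ge0// => k _; exact: normc_ge0. Qed.

(** For finite p the sum over the nodes is tested against a sequence. Each convolution value is also
    averaged over translations of the integration variable by all nodes, so that [psi] enters only
    through [node_mean] and [F] only through its mean r-norm over the nodes. For p = oo plain Hölder
    is enough, since with q = 1 averaging does not change the norm of [psi]. *)
Lemma tconv_samples p q b psi F (L : R) : (1 <= p)%E -> (p^-1 + q^-1 = 1)%E ->
  (forall i, b i != 0) -> Lp q psi -> Lp p F -> 0 <= L ->
  (Lnorm torus q (fun x => (node_mean b psi x)%:E) <= L%:E)%E ->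
  mean_le p (Dset (fun i => (b i)%:~R : R))
    (fun k => normc (tconv psi F (gnode (fun i => (b i)%:~R) k)))
    (2 * L * fine (lpnorm p F)).
Proof.
move=> p1 pq b0 psiq Fp L0 PsiL; have q1 := conjugate_ge1 p1 pq.
set a : 'I_n -> R := fun i => (b i)%:~R; set D := Dset a.
have a0 i : a i != 0 by rewrite intr_eq0.
have D0 : (0 < #|` D|)%N.
  by rewrite card_Dset//; apply/prodn_gt0 => i; rewrite absz_gt0.
have DR : 0 < #|` D|%:R :> R by rewrite ltr0n.
have [ppsi mpsi psi1] := psiq; have [pF mF F1] := Fp.
have Ff : lpnorm p F \is a fin_num by rewrite ge0_fin_numE// lpnorm_ge0.
have F0 : 0 <= fine (lpnorm p F) by rewrite fine_ge0// lpnorm_ge0.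
have ci x := cintegrable_tconv x p1 pq Fp psiq.
have mFz z : measurable_fun setT (fun t : Rn => normc (F (z - t))).
  exact: cmeas_normc (cmeas_comp (t := fun y => z - y) Rn Rn mF (measurable_reflect z)).
have mpz (h : Rn) : measurable_fun setT (fun t : Rn => normc (psi (t - h))).
  exact: cmeas_normc (cmeas_shift _ mpsi).
have mpF (h z : Rn) : measurable_fun setT (fun t : Rn => (normc (psi (t - h)) * normc (F (z - t)))%:E).
  by apply/measurable_EFinP; exact: measurable_funM.
have pFp (h z : Rn) t : (0 <= (normc (psi (t - h)) * normc (F (z - t)))%:E)%E.
  by rewrite lee_fin mulr_ge0 ?normc_ge0.
have pH (h z : Rn) : eperiodic (fun t : Rn => (normc (psi (t - h)) * normc (F (z - t)))%:E).
  move=> t k; congr (_%:E); congr (_ * _); last by rewrite (periodic_reflect z pF).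
  by rewrite addrAC ppsi.
(* The same integral for every shift [h]; it will be used with [h] running through all nodes. *)
have I0 z (h : Rn) : (\int[torus]_y (normc (psi (z - y) * F y))%:E =
    \int[torus]_t (normc (psi (t - h)) * normc (F (z + h - t)))%:E)%E.
  transitivity (\int[torus]_t (normc (psi (t - 0)) * normc (F (z - t)))%:E)%E.
    rewrite -[RHS](@ge0_integral_torusN R n z (fun t =>
      (normc (psi (t - 0)) * normc (F (z - t)))%:E))//.
    by apply: eq_integral => y _; rewrite normcM subr0 subKr.
  rewrite -[RHS](@ge0_integral_torusD R n h (fun t =>
    (normc (psi (t - h)) * normc (F (z + h - t)))%:E))//.
  apply: eq_integral => t _; congr (normc (psi _) * normc (F _))%:E.
    by rewrite addrK subr0.
  by rewrite opprD addrACA subrr addr0.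
have uJ k (h : Rn) : ((normc (tconv psi F (gnode a k)))%:E <=
    2%:E * \int[torus]_t (normc (psi (t - h)) * normc (F (gnode a k + h - t)))%:E)%E.
  by rewrite -I0; exact: normc_tconv_le.
have [pE|[r [pE r1]]] : p = +oo%E \/ exists r, p = r%:E /\ 1 <= r.
  case: (p) p1 => [r| |]// r1; last by left.
  by right; exists r; split => //; rewrite -lee_fin.
- have qE : q = 1%E.
    rewrite pE in pq; case: (conjugate_cases (leey 1) pq) => [[]//|[_ ->]//|[? [? []]]//].
  have psiL : (lpnorm 1%E psi <= L%:E)%E.
    apply: le_trans PsiL; rewrite qE /lpnorm !Lnorm1 /node_mean.
    rewrite [leRHS](_ : _ = (\int[torus]_x (#|` D|%:R^-1%:E *
        (\sum_(k <- D) (normc (psi (x - gnode a k)))%:E)))%E); last first.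
      apply: eq_integral => x _; rewrite sumEFin -EFinM gee0_abs// lee_fin.
      exact: node_mean_ge0.
    rewrite ge0_integralZl//; last 2 first.
    - by apply: emeasurable_sum => k; apply/measurable_EFinP; exact: mpz.
    - by move=> x _; apply: sume_ge0 => k _; rewrite lee_fin normc_ge0.
    rewrite ge0_integral_sum//; last 2 first.
    - by move=> k; apply/measurable_EFinP; exact: mpz.
    - by move=> k x _; rewrite lee_fin normc_ge0.
    under eq_bigr => k _.
      rewrite (@ge0_integral_torusD R n (- gnode a k) (fun x => (normc (psi x))%:E)); last 3 first.
      + exact: emeas_normc.
      + by move=> x; rewrite lee_fin normc_ge0.
      + by move=> x l; rewrite ppsi.
      over.
    rewrite lee_pdivlMl//; under eq_integral do rewrite gee0_abs ?lee_fin ?normc_ge0//.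
    by rewrite sume_cst_seq//; apply: integral_ge0 => x _; rewrite lee_fin normc_ge0.
  rewrite pE => k kD; rewrite -lee_fin.
  apply: le_trans (normc_tconv_le (ci _)) _.
  apply: (@le_trans _ _ (2%:E * (lpnorm 1%E psi * lpnorm p F))%E).
    apply: lee_wpmul2l => //; rewrite -qE.
    rewrite -[in leRHS](lpnorm_reflect (gnode a k) q1 mpsi ppsi).
    apply: hoelder_lpnorm q1 (conjugateC pq) _ mF.
    exact: (cmeas_comp (t := fun y => gnode a k - y) Rn Rn mpsi (measurable_reflect _)).
  rewrite -mulrA EFinM EFinM -pE fineK//; apply: lee_wpmul2l => //.
  by apply: lee_wpmul2r => //; exact: lpnorm_ge0.
have r0 : 0 < r by rewrite (lt_le_trans ltr01).
apply: (mean_dual p1 pq D0).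
- by move=> k; exact: normc_ge0.
- by rewrite !mulr_ge0.
move=> c B c0 B0 cB.
(* The normalised l_r norm of the values of [F] at the nodes reflected through [t]. Integrating its
   r-th power over [t] gives back the norm of [F]. *)
pose NN (t : Rn) : R := (#|` D|%:R^-1 * \sum_(k <- D) normc (F (gnode a k - t)) `^ r) `^ r^-1.
have S0 t : 0 <= #|` D|%:R^-1 * \sum_(k <- D) normc (F (gnode a k - t)) `^ r.
  by rewrite mulr_ge0 ?invr_ge0// sumr_ge0// => k _; exact: powR_ge0.
have NN0 t : 0 <= NN t by exact: powR_ge0.
have mFr k : measurable_fun setT (fun t : Rn => normc (F (gnode a k - t)) `^ r).
  exact: (measurableT_comp (measurable_powR r) (mFz _)).
have mNN : measurable_fun setT NN.
  apply: (measurableT_comp (measurable_powR r^-1)).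
  by apply: measurable_funM => //; apply: measurable_sum => k; exact: mFr.
have NNr t : NN t `^ r = #|` D|%:R^-1 * \sum_(k <- D) normc (F (gnode a k - t)) `^ r.
  by rewrite /NN -powRrM mulVf ?gt_eqF// powRr1.
have hoel l t : \sum_(k <- D) normc (F (gnode a k + gnode a l - t)) * c k <=
    #|` D|%:R * (NN t * B).
  apply: mean_hoelder p1 pq _ c0 (NN0 t) B0 _ cB => [k|]; first exact: normc_ge0.
  rewrite pE /= NNr mulrA mulfV ?gt_eqF// mul1r.
  rewrite -(@sum_Dset_shift R n _ b (fun k => normc (F (gnode a k - t)) `^ r) l b0).
    by rewrite le_eqVlt; apply/orP; left; apply/eqP/eq_bigr => k _; rewrite gnodeD.
  by move=> k l'; rewrite gnodeD gnode_zmul// addrAC pF.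
have NNn : (Lnorm torus p (fun t => (NN t)%:E) <= lpnorm p F)%E.
  rewrite pE /lpnorm !Lnorm_fin; apply: ge0_le_poweR; first by rewrite invr_ge0 ltW.
    by apply: integral_ge0 => t _; exact: poweR_ge0.
  have mFr1 : measurable_fun setT (fun t : Rn => (normc (F t) `^ r)%:E).
    by apply/measurable_EFinP; exact: (measurableT_comp (measurable_powR r) (cmeas_normc mF)).
  rewrite [leRHS](_ : _ = (\int[torus]_t (normc (F t) `^ r)%:E)%E); last first.
    by apply: eq_integral => t _; rewrite gee0_abs// lee_fin normc_ge0.
  rewrite [leLHS](_ : _ = (\int[torus]_t (#|` D|%:R^-1%:E *
      \sum_(k <- D) (normc (F (gnode a k - t)) `^ r)%:E))%E); last first.
    apply: eq_integral => t _; rewrite gee0_abs ?lee_fin// poweR_EFin NNr.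
    by rewrite sumEFin.
  rewrite ge0_integralZl//; last 2 first.
  - by apply: emeasurable_sum => k; apply/measurable_EFinP; exact: mFr.
  - by move=> t _; apply: sume_ge0 => k _; rewrite lee_fin powR_ge0.
  rewrite ge0_integral_sum//; last 2 first.
  - by move=> k; apply/measurable_EFinP; exact: mFr.
  - by move=> k t _; rewrite lee_fin powR_ge0.
  under eq_bigr => k _.
    rewrite (@ge0_integral_torusN R n (gnode a k) (fun t => (normc (F t) `^ r)%:E))//; last 2 first.
    + by move=> t; rewrite lee_fin powR_ge0.
    + by move=> t l; rewrite pF.
    over.
  rewrite lee_pdivrMl// sume_cst_seq//.
  by apply: integral_ge0 => t _; rewrite lee_fin powR_ge0.
have Hmain : (\int[torus]_t (node_mean b psi t * NN t)%:E <= L%:E * lpnorm p F)%E.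
  have := Lnorm_hoelder q1 (conjugateC pq) (measurable_node_mean b mpsi) mNN.
  move=> h; apply: le_trans (le_trans _ h) _.
    rewrite le_eqVlt; apply/orP; left; apply/eqP/eq_integral => t _.
    by rewrite ger0_norm// mulr_ge0// node_mean_ge0.
  by apply: lee_pmul => //; exact: Lnorm_ge0.
(* Multiplying by the cardinal of [D] makes room for the second sum over nodes, one shifted copy of
   the integral per node. *)
rewrite -(@ler_pM2l _ #|` D|%:R)// -lee_fin.
apply: (@le_trans _ _ (\sum_(k <- D) \sum_(l <- D) (c k)%:E *
   (2%:E * \int[torus]_t (normc (psi (t - gnode a l)) * normc (F (gnode a k + gnode a l - t)))%:E))%E).
  rewrite mulr_sumr -sumEFin; apply: lee_sum => k _.
  rewrite EFinM -sume_cst_seq; last by rewrite lee_fin mulr_ge0// normc_ge0.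
  apply: lee_sum => l _; rewrite mulrC EFinM; apply: lee_wpmul2l; first by rewrite lee_fin.
  exact: uJ.
pose G k l (t : Rn) : \bar R := ((2 * c k) *
  (normc (psi (t - gnode a l)) * normc (F (gnode a k + gnode a l - t))))%:E.
have G0 k l t : (0 <= G k l t)%E by rewrite lee_fin !mulr_ge0 ?normc_ge0.
have mG k l : measurable_fun setT (G k l).
  apply/measurable_EFinP; apply: measurable_funM => //.
  by apply/measurable_EFinP; exact: mpF.
rewrite (eq_bigr (fun k => \int[torus]_t \sum_(l <- D) G k l t)%E); last first.
  move=> k _; rewrite ge0_integral_sum//; apply: eq_bigr => l _.
  rewrite muleA -EFinM mulrC -ge0_integralZl//.
  by rewrite lee_fin mulr_ge0.
rewrite -ge0_integral_sum//; last 2 first.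
- by move=> k; apply: emeasurable_sum => l; exact: mG.
- by move=> k t _; apply: sume_ge0 => l _; exact: G0.
have mPN : measurable_fun setT (fun t => (node_mean b psi t * NN t)%:E).
  by apply/measurable_EFinP; apply: measurable_funM => //; exact: measurable_node_mean.
have PN0 t : (0 <= (node_mean b psi t * NN t)%:E)%E.
  by rewrite lee_fin mulr_ge0// node_mean_ge0.
pose m : R := #|` D|%:R * (#|` D|%:R * (2 * B)).
have m0 : 0 <= m by rewrite !mulr_ge0.
apply: (@le_trans _ _ (\int[torus]_t (m%:E * (node_mean b psi t * NN t)%:E))%E).
  apply: ge0_le_integral => //.
  - by move=> t _; apply: sume_ge0 => k _; apply: sume_ge0 => l _; exact: G0.
  - by apply: emeasurable_sum => k; apply: emeasurable_sum => l; exact: mG.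
  - by apply: measurable_funeM.
  move=> t _; rewrite exchange_big/=.
  under eq_bigr do rewrite sumEFin.
  rewrite sumEFin -EFinM lee_fin.
  apply: (@le_trans _ _ (\sum_(l <- D) normc (psi (t - gnode a l)) * (2 * (#|` D|%:R * (NN t * B))))).
    apply: ler_sum => l _; rewrite (_ : \sum_(k <- D) _ = normc (psi (t - gnode a l)) *
      (2 * \sum_(k <- D) normc (F (gnode a k + gnode a l - t)) * c k)); last first.
      by rewrite !mulr_sumr; apply: eq_bigr => k _; ring.
    by rewrite ler_wpM2l ?normc_ge0// ler_wpM2l.
  rewrite -mulr_suml /node_mean -/a -/D /m.
  set X := \sum_(_ <- _) _; rewrite le_eqVlt; apply/orP; left; apply/eqP.
  by field; rewrite gt_eqF.
rewrite ge0_integralZl//.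
apply: (@le_trans _ _ (m%:E * (L%:E * lpnorm p F))%E).
  by apply: lee_wpmul2l; rewrite ?lee_fin.
rewrite -[in leLHS](fineK Ff) -!EFinM lee_fin /m le_eqVlt; apply/orP; left; apply/eqP; ring.
Qed.

End discrete_young.

Lemma continuous_lincomb (R : realType) (T : topologicalType) (F G : T -> R) (al be : R) :
  continuous F -> continuous G -> continuous (fun x => al * F x + be * G x).
Proof.
move=> cF cG x; apply: cvgD; apply: cvgM.
- exact: cvg_cst.
- exact: cF.
- exact: cvg_cst.
- exact: cG.
Qed.

(** * The quasi-interpolation operator *)

Section smooth_characters.
Context {R : realType} {n : nat}.
Local Notation Rn := 'cV[R]_n.
Local Notation Zn := 'cV[int]_n.
Local Notation C := R[i].
Implicit Types (k : Zn) (x y : Rn) (i : 'I_n).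

Lemma continuous_dotp k : continuous (fun x : Rn => 2 * pi * dotp k x).
Proof.
have cM (c : R) (F : Rn -> R) : continuous F -> continuous (fun x => c * F x).
  move=> cF; have := @continuous_lincomb R Rn F F c 0 cF cF.
  by under eq_fun do rewrite mul0r addr0.
apply: (cM (2 * pi)); rewrite /dotp.
elim: (index_enum 'I_n) => [|i r IH]; first by under eq_fun do rewrite big_nil; exact: cst_continuous.
have := @continuous_lincomb R Rn _ _ 1 1 (cM (k i ord0)%:~R _ (@coord_continuous R n 1 i ord0)) IH.
suff -> : (fun y : Rn => 1 * ((k i ord0)%:~R * y i ord0) + 1 * \sum_(l <- r) (k l ord0)%:~R * y l ord0)
  = (fun y => \sum_(l <- i :: r) (k l ord0)%:~R * y l ord0) by [].
by apply/funext => y; rewrite big_cons !mul1r.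
Qed.

(** The directional derivative is computed from the one-variable restriction to the coordinate line
    through [x]. *)
Lemma derive_trig_line k i x (al be : R) :
  let g (y : Rn) := al * cos (2 * pi * dotp k y) + be * sin (2 * pi * dotp k y) in
  let c := 2 * pi * (k i ord0)%:~R in
  derivable g x (delta_mx i ord0) /\
  'D_(delta_mx i ord0) g x =
    c * (be * cos (2 * pi * dotp k x) - al * sin (2 * pi * dotp k x)).
Proof.
move=> g c.
pose z (t : R) := c * t + 2 * pi * dotp k x.
pose f (t : R) := al * cos (z t) + be * sin (z t).
have dz : is_derive (0 : R) 1 z c.
  have h := @is_deriveD R R R _ _ (0 : R) 1 _ _
    (@is_deriveZ R R R (@id R) c (0 : R) 1 1 (is_derive_id _ _))
    (is_derive_cst (2 * pi * dotp k x) (0 : R) 1).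
  by apply: (is_derive_eq h); rewrite /GRing.scale/= mulr1 addr0.
have z0 : z 0 = 2 * pi * dotp k x by rewrite /z mulr0 add0r.
have df : is_derive (0 : R) 1 f
    (c * (be * cos (2 * pi * dotp k x) - al * sin (2 * pi * dotp k x))).
  have dc : is_derive (0 : R) 1 (cos \o z) (- sin (z 0) * c).
    by apply: is_derive1_comp; exact: is_derive_cos.
  have ds : is_derive (0 : R) 1 (sin \o z) (cos (z 0) * c).
    by apply: is_derive1_comp; exact: is_derive_sin.
  have h := @is_deriveD R R R _ _ (0 : R) 1 _ _
    (@is_deriveZ R R R _ al (0 : R) 1 _ dc) (@is_deriveZ R R R _ be (0 : R) 1 _ ds).
  by apply: (is_derive_eq h); rewrite z0 /GRing.scale/=; ring.
have E : (fun h : R => h^-1 *: ((g \o shift x) (h *: delta_mx i ord0) - g x)) =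
    (fun h : R => h^-1 *: ((f \o shift 0) (h *: 1) - f 0)).
  apply/funext => h; congr (_ *: (_ - _)); last by rewrite /f z0.
  rewrite /g /f /= addr0 [h *: (1 : R)]mulr1.
  have -> : 2 * pi * dotp k (h *: delta_mx i ord0 + x) = z h; last by [].
    rewrite dotpDr mulrDr; congr (_ + _); rewrite /c -[RHS]mulrA; congr (_ * _).
    rewrite /dotp (bigD1 i)//= big1 ?addr0 => [|l li].
      by rewrite !mxE !eqxx mulr1 mulrC.
    by rewrite !mxE (negbTE li) !mulr0.
by split; [rewrite /derivable E; case: df|rewrite /derive E; case: df].
Qed.

Lemma ReIm_expkM (z : C) k x :
  z * expk k x = (complex.Re z * cos (2 * pi * dotp k x) + - complex.Im z * sin (2 * pi * dotp k x)) +i*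
    (complex.Im z * cos (2 * pi * dotp k x) + complex.Re z * sin (2 * pi * dotp k x)).
Proof.
rewrite expkE /cis; case: z => a b; apply/eqP; rewrite eq_complex/=.
by rewrite mulNr eqxx addrC eqxx.
Qed.

Lemma Cderivable_expkM (z : C) k : Cderivable (fun x : Rn => z * expk k x).
Proof.
move=> i x; split.
  rewrite (_ : (fun _ => _) = fun y : Rn => complex.Re z * cos (2 * pi * dotp k y) +
      - complex.Im z * sin (2 * pi * dotp k y)); last by apply/funext => y; rewrite ReIm_expkM.
  exact: (derive_trig_line k i x _ _).1.
rewrite (_ : (fun _ => _) = fun y : Rn => complex.Im z * cos (2 * pi * dotp k y) +
    complex.Re z * sin (2 * pi * dotp k y)); last by apply/funext => y; rewrite ReIm_expkM.
exact: (derive_trig_line k i x _ _).1.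
Qed.

Lemma pderiv_expkM i (z : C) k : pderiv i (fun x : Rn => z * expk k x) =
  fun x => (z * (0 +i* (2 * pi * (k i ord0)%:~R))) * expk k x.
Proof.
apply/funext => x; rewrite /pderiv [RHS]ReIm_expkM; congr (_ +i* _).
  rewrite (_ : (fun _ => _) = fun y : Rn => complex.Re z * cos (2 * pi * dotp k y) +
      - complex.Im z * sin (2 * pi * dotp k y)); last by apply/funext => y; rewrite ReIm_expkM.
  by rewrite (derive_trig_line k i x _ _).2; case: z => a b /=; ring.
rewrite (_ : (fun _ => _) = fun y : Rn => complex.Im z * cos (2 * pi * dotp k y) +
    complex.Re z * sin (2 * pi * dotp k y)); last by apply/funext => y; rewrite ReIm_expkM.
by rewrite (derive_trig_line k i x _ _).2; case: z => a b /=; ring.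
Qed.

Lemma Ccontinuous_expkM (z : C) k : Ccontinuous (fun x : Rn => z * expk k x).
Proof.
have cc : continuous (fun y : Rn => cos (2 * pi * dotp k y)).
  move=> x; apply: (@continuous_comp _ _ _ (fun y : Rn => 2 * pi * dotp k y) cos).
    exact: continuous_dotp.
  exact: continuous_cos.
have cs : continuous (fun y : Rn => sin (2 * pi * dotp k y)).
  move=> x; apply: (@continuous_comp _ _ _ (fun y : Rn => 2 * pi * dotp k y) sin).
    exact: continuous_dotp.
  exact: continuous_sin.
split.
  rewrite (_ : (fun _ => _) = fun y : Rn => complex.Re z * cos (2 * pi * dotp k y) +
      - complex.Im z * sin (2 * pi * dotp k y)); last by apply/funext => y; rewrite ReIm_expkM.
  exact: continuous_lincomb cc cs.
rewrite (_ : (fun _ => _) = fun y : Rn => complex.Im z * cos (2 * pi * dotp k y) +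
    complex.Re z * sin (2 * pi * dotp k y)); last by apply/funext => y; rewrite ReIm_expkM.
exact: continuous_lincomb cc cs.
Qed.

(** Iterated partial derivatives of a character are multiples of it. This allows [represents] to be
    tested on characters, which yields the coefficients of the distribution. *)
Lemma test_function_expk k : test_function (@expk R n k).
Proof.
split; first exact: expk_periodic.
move=> a; have [z ->] : exists z : C, pderivs a (@expk R n k) = fun x => z * expk k x.
  elim: a => [|i a [z IH]] /=.
    by exists 1; apply/funext => x; rewrite mul1r.
  by rewrite -/(pderivs a _) IH pderiv_expkM; eexists.
split; [exact: Ccontinuous_expkM|exact: Cderivable_expkM].
Qed.

End smooth_characters.

Section quasi_interpolation_facts.
Context {R : realType} {n : nat}.
Local Notation Rn := 'cV[R]_n.
Local Notation Zn := 'cV[int]_n.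
Local Notation C := R[i].
Implicit Types (b : 'I_n -> int) (psi : Rn -> C) (x : Rn).

(** Two distinct frequencies of D(A) are never congruent modulo the lattice, so by discrete
    orthogonality only the term of frequency [l] survives. *)
Lemma quasi_interp_expk b w l x : (forall i, b i != 0) ->
  let a : 'I_n -> R := fun i => (b i)%:~R in l \in Dset a ->
  \sum_(k <- Dset a) expk l (gnode a k) * trig (Dset a) w (x - gnode a k) =
  #|` Dset a|%:R * (w l * expk l x) :> C.
Proof.
move=> b0 a lD; set D := Dset a in lD *.
transitivity (\sum_(l2 <- D) w l2 * expk l2 x * \sum_(k <- D) expk (l - l2) (gnode a k) : C).
  under [RHS]eq_bigr do rewrite mulr_sumr.
  rewrite exchange_big/=; apply: eq_bigr => k _; rewrite /trig mulr_sumr.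
  by apply: eq_bigr => l2 _; rewrite expkDr expkDl expkNr; ring.
rewrite (big_fsetD1 l)//= [X in _ + X]big_seq [X in _ + X]big1 ?addr0; last first.
  move=> l2; rewrite in_fsetD1 => /andP[l2l l2D].
  rewrite sum_expk_gnode ?mulr0// => l' h.
  have e : l2 + zmul b l' = l by rewrite -h addrC subrK.
  have := @Dset_inj R n b l2 l' b0 l2D; rewrite e => /(_ lD) l'0.
  move: l2l; rewrite -e l'0 (_ : zmul b 0 = 0) ?addr0 ?eqxx//.
  by apply/colP => i; rewrite !mxE mulr0.
rewrite subrr mulrC; congr (_ * _).
under eq_bigr do rewrite expk0l.
by rewrite big_const_seq count_predT iter_addr addr0.
Qed.

(** Without aliasing, the operator acts on polynomials with frequencies in D(A) as the multiplier
    given by the coefficients of phi_j. *)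
Lemma quasi_interp_trig b S w' w x : (forall i, b i != 0) ->
  let a : 'I_n -> R := fun i => (b i)%:~R in
  (forall l, l \in S -> w' l != 0 -> l \in Dset a) ->
  (#|` Dset a|%:R^-1)%:C *
  \sum_(k <- Dset a) trig S w' (gnode a k) * trig (Dset a) w (x - gnode a k) =
  trig S (fun l => w' l * w l) x :> C.
Proof.
move=> b0 a Sw; set D := Dset a.
have D0 : (#|` D|%:R : C) != 0.
  by rewrite pnatr_eq0 -lt0n card_Dset//; apply/prodn_gt0 => i; rewrite absz_gt0.
transitivity ((#|` D|%:R^-1)%:C * \sum_(l <- S) w' l *
    \sum_(k <- D) expk l (gnode a k) * trig D w (x - gnode a k)).
  congr (_ * _); under [RHS]eq_bigr do rewrite mulr_sumr.
  rewrite exchange_big/=; apply: eq_bigr => k _; rewrite [trig S _ _]/trig mulr_suml.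
  by apply: eq_bigr => l _; rewrite mulrA.
rewrite mulr_sumr /trig big_seq [RHS]big_seq; apply: eq_bigr => l lS.
have [->|wl] := eqVneq (w' l) 0; first by rewrite !mul0r mulr0.
rewrite quasi_interp_expk ?Sw// fmorphV/= rmorph_nat.
by rewrite mulrCA mulKf// mulrA.
Qed.

Lemma node_mean_shift b psi x l : (forall i, b i != 0) -> Defs.periodic psi ->
  node_mean b psi (x + gnode (fun i => (b i)%:~R) l) = node_mean b psi x.
Proof.
move=> b0 pp; rewrite /node_mean; congr (_ * _).
rewrite -[RHS](@sum_Dset_shift R n _ b
  (fun k => normc (psi (x - gnode (fun i => (b i)%:~R) k))) (- l) b0).
  apply: eq_bigr => k _; congr (normc (psi _)); rewrite gnodeD opprD.
  rewrite addrAC -addrA; congr (_ + _); congr (_ + _).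
  by apply/colP => i; rewrite gnodeE [RHS]mxE gnodeE mxE mulrNz mulNr opprK.
by move=> k l'; rewrite gnodeD gnode_zmul// opprD addrA -int_vecN pp.
Qed.

(** For finite q this is the passage from the torus to one cell. At q = oo the right side is a true
    supremum and the left one an essential supremum, whence an inequality. *)
Lemma Lnorm_node_mean_le (mu : 'rV[int]_n) j q psi : (forall i, mu ord0 i != 0) ->
  (1 <= q)%E -> Defs.periodic psi -> cmeas psi ->
  (Lnorm torus q (fun x => (node_mean (dilb mu j) psi x)%:E) <=
   Lqj_norm (dilation mu) j q psi)%E.
Proof.
move=> mu0 q1 pp mp; set b := dilb mu j.
have b0 : forall i, b i != 0 := dilb_neq0 j mu0.
have nm (x : Rn) : `|\det (dilation mu : 'M[R]_n)| ^- j *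
    (\sum_(k \in freq ((dilation mu : 'M[R]_n) ^+ j)) normc (psi (x - node (dilation mu : 'M[R]_n) j k))) =
    node_mean b psi x.
  rewrite sum_freq_dilation// -(card_Dset_dilation j mu0); congr (_ * _).
  by apply: eq_bigr => k _; rewrite node_gnode.
have mnm := measurable_node_mean b mp.
case: q q1 => [s| |]//; last first.
  move=> _ /=; rewrite Lnorm_oo; apply/ess_supP; apply: aeW => x /=.
  rewrite ger0_norm ?node_mean_ge0// -nm EFinM; apply: lee_wpmul2l.
    by rewrite lee_fin invr_ge0 exprn_ge0.
  by apply: ereal_sup_ubound; exists x.
rewrite lee_fin => s1; rewrite Lnorm_fin /=.
apply: ge0_le_poweR; first by rewrite invr_ge0 (le_trans ler01).
  by apply: integral_ge0 => x _; rewrite lee_fin powR_ge0.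
have mF : measurable_fun setT (fun x => (node_mean b psi x `^ s)%:E).
  by apply/measurable_EFinP; exact: (measurableT_comp (measurable_powR s) mnm).
rewrite [leLHS](_ : _ = (\int[torus]_x (node_mean b psi x `^ s)%:E)%E); last first.
  by apply: eq_integral => x _; rewrite ger0_norm// node_mean_ge0.
rewrite -(@ge0_integral_cell R n b _ b0 mF) => [|x|x l]; last 2 first.
- by rewrite lee_fin powR_ge0.
- by have := node_mean_shift x l b0 pp; rewrite /gnode => ->.
have dE : `|\det (dilation mu : 'M[R]_n)| ^+ j = \prod_i `|(b i)%:~R| by exact: det_dilationX.
have -> : [set invmx ((dilation mu : 'M[R]_n) ^+ j) *m y | y in @cube R n] =
    [set scale_cV (fun i => (b i)%:~R^-1 : R) y | y in cube].
  by apply/seteqP; split => _ [y cy <-]; exists y => //; rewrite invmx_dilationX.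
rewrite -dE.
set I1 := (X in (_ * X <= _)%E).
set I2 := (X in (_ <= _ * X)%E).
have E : I1 = I2.
  by apply: eq_integral => x _; rewrite -nm.
by rewrite E.
Qed.

End quasi_interpolation_facts.

(** * Error decomposition and the one-sided estimate *)

Section quasi_interpolation_error.
Context {R : realType} {n : nat}.
Local Notation Rn := 'cV[R]_n.
Local Notation Zn := 'cV[int]_n.
Local Notation C := R[i].
Implicit Types (f g psi F : Rn -> C) (b : 'I_n -> int) (w dc Gamma r : Zn -> C) (k l : Zn)
  (x y : Rn) (p q : \bar R).
Local Notation "b %:a" := (fun i => (b i)%:~R : R) (at level 2, format "b %:a").

Lemma mean_le_mono p (D : {fset Zn}) (u u' : Zn -> R) (B : R) : (1 <= p)%E ->
  (forall k, 0 <= u k) -> (forall k, u k <= u' k) -> mean_le p D u' B -> mean_le p D u B.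
Proof.
move=> p1 u0 uu; case: p p1 => [t| |]// p1 h; last by move=> k kD; apply: le_trans (uu k) (h k kD).
move: p1; rewrite lee_fin => t1.
apply: le_trans h; apply: ler_sum => k _; apply: ge0_ler_powR; rewrite ?nnegrE//.
- by apply: le_trans t1.
- exact: le_trans (u0 k) (uu k).
Qed.

(* [Q_j] for [phi_j] with coefficients [w], applied to the node values [r]. *)
Definition translates b w r : Rn -> C := fun x =>
  (#|` Dset b%:a|%:R^-1)%:C *
  \sum_(k <- Dset b%:a) r k * trig (Dset b%:a) w (x - gnode b%:a k).

Lemma translatesD b w r r' x :
  translates b w r x + translates b w r' x = translates b w (fun k => r k + r' k) x.
Proof.
rewrite /translates -mulrDr -big_split; congr (_ * _).
by apply: eq_bigr => k _; rewrite mulrDl.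
Qed.

Lemma cmeas_translates b w r : cmeas (translates b w r).
Proof.
apply: cmeasM; first exact: cmeas_cst.
apply: cmeas_sum => k; apply: cmeasM; first exact: cmeas_cst.
exact: cmeas_shift (cmeas_trig _ _).
Qed.

Context (v : Rn -> C) (v_smooth : smooth v)
  (v_eq1 : forall x, (forall i, - (1 / 4) <= x i ord0 < 1 / 4) -> v x = 1)
  (v_eq0 : forall x, ~ (forall i, - (3 / 8) <= x i ord0 < 3 / 8) -> v x = 0).
Context (delta : R) (delta_itv : 0 < delta < 2^-1).

Let r38 : 0 <= 3 / 8 :> R. Proof. by lra. Qed.
Let vn := v_nice v_smooth v_eq0.
Let Gr := nice_supp (vn 0%N).
Let d0 : 0 < delta. Proof. by case/andP: delta_itv. Qed.

Local Notation dil b := (fun i => delta * (b i)%:~R).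
Local Notation cutoff b := (freqbox (dil b) (3 / 8)).

Lemma dil_neq0 b : (forall i, 1 <= `|(b i)%:~R : R|) -> forall i, delta * (b i)%:~R != 0.
Proof.
move=> b1 i; apply: mulf_neq0; first by rewrite gt_eqF.
by rewrite -normr_gt0 (lt_le_trans ltr01)// b1.
Qed.

(** The support gives |A^-1 l| <= 3 delta / 8, which is below 1/2 because delta < 1/2. *)
Lemma cutoff_in_Dset b l : (forall i, 1 <= `|(b i)%:~R : R|) -> v (gnode (dil b) l) != 0 ->
  l \in Dset b%:a.
Proof.
move=> b1 vl; have a0 i : (b i)%:~R != 0 :> R by rewrite -normr_gt0 (lt_le_trans ltr01)// b1.
rewrite in_Dset//; apply/asboolP => i.
have := v_supp v_eq0 i vl; rewrite gnodeZ mxE normrM gtr0_norm ?invr_gt0//.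
rewrite ler_pdivrMl// => h; have /andP[_ d2] := delta_itv.
have : `|gnode b%:a l i ord0| < 2^-1 by set t := `|_| in h *; nra.
by rewrite ltr_norml => /andP[/ltW -> ->].
Qed.

(** The node values [r] are left arbitrary, so that one decomposition serves both estimates; only
    the last term, built from the deviation of [r] from the samples of the smoothed g, differs
    between them. *)
Lemma quasi_interp_error s : (0 < s)%N -> exists2 K, 0 <= K &
  forall b (A : 'M[R]_n), (forall i, 1 <= `|(b i)%:~R : R|) ->
  (forall x, A *m x = scale_cV b%:a x) ->
  forall p f w dc Gamma N r, (1 <= p)%E -> Lp p f -> 0 <= N ->
  let lam k := Gamma k * v (gnode (dil b) k) in
  multiplier p lam -> (multiplier_norm p lam <= N%:E)%E ->
  (forall k, v (gnode (dil b) k) != 0 ->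
     w k * dc k = 1 + (hompoly s (gnode b%:a k))%:C * Gamma k) ->
  (lpnorm p (fun x => f x - translates b w r x)%R <=
   (K * (1 + N))%:E * modulus s f A p +
   lpnorm p (translates b w (fun k => (r k -
     trig (cutoff b) (fun l => v (gnode (dil b) l) * (dc l * fcoef f l)) (gnode b%:a k))%R)))%E.
Proof.
move=> s0.
have [K1 K10 hK1] := approx_bound v_smooth v_eq1 v_eq0 s d0.
have [K2 K20 hK2] := hompoly_part v_smooth v_eq1 v_eq0 s0 d0.
have e0 : 0 < 2 * delta by rewrite mulr_gt0.
have [K3 K30 hK3] := conv_op_bound r38 e0 vn.
exists (K1 + K3 * K2); first by rewrite addr_ge0// mulr_ge0.
move=> b A b1 hA p f w dc Gamma N r p1 fp N0 lam ml mN hyp.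
have a0 i : (b i)%:~R != 0 :> R by rewrite -normr_gt0 (lt_le_trans ltr01)// b1.
have b0 i : b i != 0 by have := a0 i; rewrite intr_eq0.
have da0 := dil_neq0 b1.
have [pf _ _] := fp; have fi := Lp_cintegrable p1 fp.
have Om0 := @modulus_ge0 R n s f A p.
have [F [Fp FK Fc]] := hK2 b%:a A b1 hA p f p1 fp.
have [G [Gp Gc GN]] := multiplier_bound p1 ml mN Fp.
have [pG _ _] := Gp; have Gi := Lp_cintegrable p1 Gp.
(* At scale 2 delta the cutoff is 1 wherever v(A^-1 k / delta) is nonzero, since 3/16 < 1/4. It
   therefore keeps the coefficients of [G] and turns it into an explicit polynomial. *)
pose a2 := fun i => (2 * delta) * (b i)%:~R.
have a20 i : a2 i != 0 by rewrite /a2 -mulrA mulf_neq0// da0.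
pose Rp := conv_op a2 v G.
have RN : (lpnorm p Rp <= (K3 * K2 * N)%:E * modulus s f A p)%E.
  apply: (@le_trans _ _ (K3%:E * lpnorm p G)%E).
    apply: hK3 => // i; rewrite normrM [ `|2 * delta|]gtr0_norm//.
    by rewrite ler_peMr ?b1// ltW.
  rewrite -mulrA [K2 * N]mulrC (EFinM K3) (EFinM N) -!muleA.
  apply: lee_wpmul2l; rewrite ?lee_fin//; apply: le_trans GN _.
  by apply: lee_wpmul2l; rewrite ?lee_fin.
set S := cutoff b.
have RE : Rp = trig S (fun l => v (gnode (dil b) l) *
    ((hompoly s (gnode b%:a l))%:C * Gamma l * fcoef f l)).
  rewrite /Rp (conv_opE r38 a20 Gr pG Gi); apply: eq_trig => l.
  - by move=> /(freqbox_supp r38 a20 Gr) ->; rewrite mul0r.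
  - by move=> /(freqbox_supp r38 da0 Gr) ->; rewrite mul0r.
  - rewrite Gc /lam; have [->|vl] := eqVneq (v (gnode (dil b) l)) 0.
      by rewrite mulr0 mul0r mulr0 mul0r.
    rewrite (v_one v_eq1) => [|i].
      by rewrite Fc//; ring.
    have -> : gnode a2 l = 2^-1 *: gnode (dil b) l.
      by rewrite -gnodeZ; congr gnode; apply/funext => i'; rewrite /a2 mulrA.
    have vi := v_supp v_eq0 i vl; rewrite mxE normrM gtr0_norm//.
    by set t := `|_| in vi *; lra.
set Vg := trig S _.
pose Vf := conv_op (dil b) v f.
(* Here the compatibility condition enters: the product of the two coefficients is 1 plus the
   polynomial term, giving [Vf] and [Rp] respectively. *)
have QV x : translates b w (fun k => Vg (gnode b%:a k)) x = Vf x + Rp x.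
  rewrite /translates quasi_interp_trig//; last first.
    move=> l _ h; apply: cutoff_in_Dset => //.
    by apply: contraNneq h => ->; rewrite mul0r.
  rewrite RE /Vf (conv_opE r38 da0 Gr pf fi) trigD /trig; apply: eq_bigr => l _.
  congr (_ * _); have [->|vl] := eqVneq (v (gnode (dil b) l)) 0; first by rewrite !mul0r addr0.
  by rewrite -mulrDr -mulrA; congr (_ * _); rewrite mulrAC [dc l * _]mulrC hyp//; ring.
have E : (fun x => f x - translates b w r x) =
    (fun x => (f x - Vf x) + (- Rp x - translates b w (fun k => r k - Vg (gnode b%:a k)) x)).
  apply/funext => x.
  have -> : translates b w r x = translates b w (fun k => r k - Vg (gnode b%:a k)) x +
      translates b w (fun k => Vg (gnode b%:a k)) x.
    by rewrite translatesD; congr (translates b w _ x); apply/funext => k; rewrite subrK.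
  by rewrite QV; ring.
have mV : cmeas Vf by rewrite /Vf (conv_opE r38 da0 Gr pf fi); exact: cmeas_trig.
have mR : cmeas Rp by rewrite RE; exact: cmeas_trig.
have mf : cmeas f by case: fp.
have mt := cmeas_translates b w (fun k => r k - Vg (gnode b%:a k)).
rewrite E; apply: le_trans (lpnormD p1 (cmeasB mf mV) (cmeasB (cmeasN mR) mt)) _.
have h1 : (lpnorm p (fun x => f x - Vf x)%R <= K1%:E * modulus s f A p)%E by exact: hK1.
have h2 := lpnormB p1 (cmeasN mR) mt; rewrite lpnormN in h2.
apply: le_trans (leeD h1 h2) _; rewrite addeA; apply: leeD => //.
apply: le_trans (leeD (lexx _) RN) _.
rewrite -ge0_muleDl ?lee_fin ?mulr_ge0//; apply: lee_wpmul2r => //.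
rewrite -EFinD lee_fin; set t := K3 * K2.
have t0 : 0 <= t by rewrite mulr_ge0.
by nra.
Qed.

(** [g] is merely bounded and its samples cannot be controlled by a norm. With h = t - g one has g -
    V g = V h - h, where V h is band-limited and |h| is dominated pointwise by the band-limited T -
    t, so the sampling inequality applies to both. *)
Lemma translates_one_sided : exists2 K, 0 <= K &
  forall b, (forall i, 1 <= `|(b i)%:~R : R|) ->
  forall p q, (1 <= p)%E -> (p^-1 + q^-1 = 1)%E ->
  forall w g wt wT, Defs.periodic g -> cintegrable g ->
  let t : Rn -> C := trig (Dset (fun i => delta / 2 * (b i)%:~R)) wt in
  let T : Rn -> C := trig (Dset (fun i => delta / 2 * (b i)%:~R)) wT in
  (forall x, t x <= g x <= T x) ->
  (lpnorm p (translates b w (fun k => g (gnode b%:a k) - conv_op (dil b) v g (gnode b%:a k))%R)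
   <= K%:E * conv_norm q (trig (Dset b%:a) w : Rn -> C) * lpnorm p (fun x => t x - T x)%R)%E.
Proof.
have [K1 K10 hK1] := mean_translates_bound v_smooth v_eq1 v_eq0.
have [K2 K20 hK2] := band_samples v_smooth v_eq1 v_eq0.
have [K3 K30 hK3] := conv_op_bound r38 d0 vn.
exists (K1 * K2 * (1 + K3)); first by rewrite !mulr_ge0 ?addr_ge0.
move=> b b1 p q p1 pq w g wt wT pg gi t T tgT.
have q1 := conjugate_ge1 p1 pq.
have a0 i : (b i)%:~R != 0 :> R by rewrite -normr_gt0 (lt_le_trans ltr01)// b1.
have da0 := dil_neq0 b1.
set S := Dset (fun i => delta / 2 * (b i)%:~R) in t T tgT *.
have a20 i : delta / 2 * (b i)%:~R != 0 by rewrite mulf_neq0// mulf_neq0 ?gt_eqF// invr_eq0 pnatr_eq0.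
have ti : cintegrable t by exact: cintegrable_trig.
have Ti : cintegrable T by exact: cintegrable_trig.
have pt : Defs.periodic t by exact: trig_periodic.
pose e x := t x - T x.
have eE : e = trig S (fun k => wt k + - wT k).
  by apply/funext => x; rewrite /e /t /T trigN trigD.
have Slow l : l \in S -> forall i, `|gnode b%:a l i ord0| <= 2^-1.
  rewrite in_Dset// => /asboolP h i; have := h i.
  rewrite !gnodeE => hh; have /andP[_ d2] := delta_itv.
  have -> : (l i ord0)%:~R / (b i)%:~R = delta / 2 * ((l i ord0)%:~R / (delta / 2 * (b i)%:~R)).
    by field; rewrite a0 gt_eqF.
  set u := _ / (delta / 2 * _) in hh *.
  have u1 : `|u| <= 2^-1 by have /andP[u1 u2] := hh; rewrite ler_norml u1 ltW.
  rewrite normrM [ `|delta / 2|]gtr0_norm ?divr_gt0//.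
  have := normr_ge0 u; set z := `|u| in u1 * => z0; nra.
have eb : bandlimited b%:a e by exists S, (fun k => wt k + - wT k); split=> // k kS _; exact: Slow.
have ep : Lp p e by exact: bandlimited_Lp eb.
have ef : lpnorm p e \is a fin_num by rewrite ge0_fin_numE ?lpnorm_ge0//; case: ep.
(* The factor delta / 2 is chosen for this: D(delta/2 A) lands in [-1/4, 1/4)^d at scale delta,
   exactly where [v] is prescribed to be 1. *)
have Vt : conv_op (dil b) v t = t.
  apply: (conv_op_reproduce v_smooth v_eq0) => // k; rewrite in_Dset// => /asboolP hk _.
  apply: v_eq1 => i; have := hk i; rewrite !gnodeE => {}hk.
  have -> : (k i ord0)%:~R / (delta * (b i)%:~R) = 2^-1 * ((k i ord0)%:~R / (delta / 2 * (b i)%:~R)).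
    by field; rewrite a0 gt_eqF.
  by set u := _ / (delta / 2 * _) in hk *; lra.
have gte x : normc (g x - t x) <= normc (e x).
  have /andP[tg gT] := tgT x.
  have : `|g x - t x| <= `|T x - t x|.
    rewrite !ger0_norm ?subr_ge0 ?lerD2r//; exact: le_trans tg gT.
  by rewrite -[T x - t x]opprB normrN -lecR.
pose h x := t x + (-1) * g x.
have hi : cintegrable h by apply: cintegrableD => //; exact: cintegrableZ.
have he x : normc (h x) <= normc (e x) by rewrite /h mulN1r -normcN opprB.
have me : cmeas e by case: ep.
have mh : cmeas h by case: hi.
have hle : (lpnorm p h <= lpnorm p e)%E by exact: lpnorm_mono.
have ph : Defs.periodic h by move=> k x; rewrite /h pt pg.
have hp : Lp p h by split=> //; apply: le_lt_trans hle _; case: ep.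
pose Vh := conv_op (dil b) v h.
have VhE x : Vh x = t x - conv_op (dil b) v g x.
  by rewrite /Vh /h (conv_op_linear _ r38 da0 Gr) // Vt mulN1r.
have Vhb : bandlimited b%:a Vh.
  rewrite /Vh (conv_opE r38 da0 Gr ph hi); eexists; eexists; split; first by [].
  move=> k _ vk i; have : k \in Dset b%:a.
    by apply: cutoff_in_Dset => //; apply: contraNneq vk => ->; rewrite mul0r.
  rewrite in_Dset// => /asboolP /(_ i) /andP[k1 k2].
  by rewrite ler_norml k1 ltW.
have Vhf : lpnorm p Vh \is a fin_num.
  by rewrite ge0_fin_numE ?lpnorm_ge0//; case: (bandlimited_Lp p1 Vhb).
set E := fine (lpnorm p e); have E0 : 0 <= E by rewrite fine_ge0// lpnorm_ge0.
have VhE' : fine (lpnorm p Vh) <= K3 * E.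
  rewrite -lee_fin fineK// EFinM fineK//.
  apply: le_trans (_ : (K3%:E * lpnorm p h <= _)%E); last by apply: lee_wpmul2l; rewrite ?lee_fin.
  apply: hK3 => // i; rewrite normrM gtr0_norm//.
  by rewrite ler_peMr ?b1// ltW.
have m1 : mean_le p (Dset b%:a) (fun k => normc (- h (gnode b%:a k))) (K2 * E).
  apply: (mean_le_mono p1 (fun k => normc_ge0 _) _ (hK2 b b1 e eb false p p1)) => k.
  by rewrite normcN expr0 scale1r.
have m2 : mean_le p (Dset b%:a) (fun k => normc (Vh (gnode b%:a k))) (K2 * fine (lpnorm p Vh)).
  apply: (mean_le_mono p1 (fun k => normc_ge0 _) _ (hK2 b b1 Vh Vhb false p p1)) => k.
  by rewrite expr0 scale1r.
have F0 : 0 <= fine (lpnorm p Vh) by rewrite fine_ge0// lpnorm_ge0.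
have := hK1 b b1 p q p1 pq w _ _ (mulr_ge0 K20 E0) m1.
have := hK1 b b1 p q p1 pq w _ _ (mulr_ge0 K20 F0) m2.
rewrite -/(translates b w _) -/(translates b w _) => t2 t1.
have -> : translates b w (fun k => g (gnode b%:a k) - conv_op (dil b) v g (gnode b%:a k)) =
    (fun x => translates b w (fun k => - h (gnode b%:a k)) x +
      translates b w (fun k => Vh (gnode b%:a k)) x).
  apply/funext => x; rewrite translatesD; congr (translates b w _ x); apply/funext => k.
  by rewrite VhE /h; ring.
apply: le_trans (lpnormD p1 (cmeas_translates _ _ _) (cmeas_translates _ _ _)) _.
apply: le_trans (leeD t1 t2) _.
rewrite -(fineK ef) -/E; have qp := conjugateC pq.
have Kf := @conv_norm_fin R n p q (Dset b%:a) w q1 qp.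
have N0 := @conv_norm_ge0 R n q (trig (Dset b%:a) w) q1.
rewrite -(fineK Kf); set N := fine _; have {}N0 : 0 <= N by rewrite fine_ge0.
rewrite -!EFinM -EFinD lee_fin -mulrDl -mulrDr -mulrDr.
rewrite [leRHS](_ : _ = K1 * (K2 * (E + K3 * E)) * N); last by ring.
apply: ler_wpM2r => //; apply: ler_wpM2l => //; apply: ler_wpM2l => //.
by rewrite lerD2l.
Qed.

End quasi_interpolation_error.

(** * Samples of convolutions with an integrable kernel *)

Section convolution_samples.
Context {R : realType} {n : nat}.
Local Notation Rn := 'cV[R]_n.
Local Notation Zn := 'cV[int]_n.
Local Notation C := R[i].
Implicit Types (f g psi F : Rn -> C) (b : 'I_n -> int) (w : Zn -> C) (k l : Zn)
  (x y : Rn) (p q : \bar R).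
Local Notation "b %:a" := (fun i => (b i)%:~R : R) (at level 2, format "b %:a").

Lemma tconv_trig psi (S : {fset Zn}) w : Defs.periodic psi -> cintegrable psi ->
  tconv psi (trig S w) = trig S (fun l => w l * fcoef psi l).
Proof.
move=> ppsi ipsi; rewrite -tconvE//; apply/funext => x; rewrite /tconv.
rewrite -(@Cint_reflect R n (fun y => trig S w (x - y) * psi y) x).
- by congr Cint; apply/funext => y; rewrite subKr mulrC.
- by move=> k y; rewrite (periodic_reflect _ (trig_periodic S w)) ppsi.
- apply: cmeasM; last by case: ipsi.
  exact: (cmeas_comp (t := fun y => x - y) Rn Rn (cmeas_trig S w) (measurable_reflect _)).
Qed.

Lemma tconvB p q psi f g x : (1 <= p)%E -> (p^-1 + q^-1 = 1)%E -> Lp q psi ->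
  Lp p f -> Lp p g ->
  tconv psi f x - tconv psi g x = tconv psi (fun y => f y - g y) x.
Proof.
move=> p1 pq qpsi pf pg.
have fi := cintegrable_tconv x p1 pq pf qpsi; have gi := cintegrable_tconv x p1 pq pg qpsi.
rewrite /tconv -mulN1r -CintZ// -CintD//; last exact: cintegrableZ.
by congr Cint; apply/funext => y; rewrite mulN1r mulrBr.
Qed.

(** The conclusion holds at every point by Hölder, so it applies at the nodes. It settles the case
    of a vanishing modulus together with an infinite norm of tphi_j, where the bound reads 0 * oo =
    0. *)
Lemma tconv_null p q psi F x : (1 <= p)%E -> (p^-1 + q^-1 = 1)%E -> Lp q psi -> Lp p F ->
  lpnorm p F = 0%E -> tconv psi F x = 0.
Proof.
move=> p1 pq qpsi pF F0; have q1 := conjugate_ge1 p1 pq.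
have := normc_tconv_le (cintegrable_tconv x p1 pq pF qpsi).
have [_ mF _] := pF; have [_ mpsi _] := Lp_reflect x q1 qpsi.
have := hoelder_lpnorm p1 pq mF mpsi; rewrite F0 mul0e => h0 h.
apply: normc_eq0; apply/eqP; rewrite eq_le normc_ge0 andbT -lee_fin.
apply: le_trans h _.
rewrite (_ : integral _ _ _ = integral torus setT (fun y => (normc (F y * psi (x - y)))%:E)).
  by apply: le_trans (lee_wpmul2l _ h0) _; rewrite ?mule0.
by congr integral; apply/funext => y; rewrite mulrC.
Qed.

(** The constant function 1 is mapped to w 0. Positivity matters when the one-sided error is +oo:
    the product must then be +oo and not 0. *)
Lemma conv_norm_gt0 p q (S : {fset Zn}) w : (1 <= q)%E -> (q^-1 + p^-1 = 1)%E ->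
  0 \in S -> w 0 != 0 -> (0 < conv_norm q (trig S w : Rn -> C))%E.
Proof.
move=> q1 qp S0 w0.
have one : (fun=> 1 : C) = trig [fset (0 : Zn)]%fset (fun=> 1) :> (Rn -> C).
  by apply/funext => x; rewrite /trig big_seq_fset1 expk0l mulr1.
have onep : Lp q (fun _ : Rn => 1 : C) by rewrite one; exact: Lp_trig.
have := @conv_norm_le R n p q S w _ q1 qp onep.
rewrite (lpnorm_cst _ q1) normc1 mule1; apply: lt_le_trans.
have -> : tconv (trig S w) (fun=> 1) = (fun=> w 0).
  have [po _ _] := onep.
  rewrite tconvE//; last exact: Lp_cintegrable onep.
  apply/funext => x; rewrite /trig (big_fsetD1 0)//= big1_seq ?addr0 => [|l].
    by rewrite {1}one fcoef_trig inE eqxx expk0l !mulr1.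
  rewrite in_fsetD1 => /andP[_ /andP[l0 _]].
  by rewrite one fcoef_trig inE (negbTE l0) mulr0 mul0r.
rewrite lpnorm_cst// lte_fin lt_neqAle normc_ge0 andbT eq_sym.
by apply: contra w0 => /eqP /normc_eq0 ->.
Qed.

Context (v : Rn -> C) (v_smooth : smooth v)
  (v_eq1 : forall x, (forall i, - (1 / 4) <= x i ord0 < 1 / 4) -> v x = 1)
  (v_eq0 : forall x, ~ (forall i, - (3 / 8) <= x i ord0 < 3 / 8) -> v x = 0).

Lemma translates_tconv : exists2 K, 0 <= K &
  forall b, (forall i, 1 <= `|(b i)%:~R : R|) ->
  forall p q, (1 <= p)%E -> (p^-1 + q^-1 = 1)%E ->
  forall w psi F L, Lp q psi -> Lp p F -> 0 <= L ->
  (Lnorm torus q (fun x => (node_mean b psi x)%:E) <= L%:E)%E ->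
  (lpnorm p (translates b w (fun k => tconv psi F (gnode b%:a k)))
   <= K%:E * (conv_norm q (trig (Dset b%:a) w : Rn -> C) * L%:E) * lpnorm p F)%E.
Proof.
have [K K0 hK] := mean_translates_bound v_smooth v_eq1 v_eq0.
exists (2 * K); first by rewrite mulr_ge0.
move=> b b1 p q p1 pq w psi F L qpsi pF L0 hL.
have a0 i : (b i)%:~R != 0 :> R by rewrite -normr_gt0 (lt_le_trans ltr01)// b1.
have b0 i : b i != 0 by have := a0 i; rewrite intr_eq0.
have Ff : lpnorm p F \is a fin_num by rewrite ge0_fin_numE ?lpnorm_ge0//; case: pF.
have F0 : 0 <= fine (lpnorm p F) by rewrite fine_ge0// lpnorm_ge0.
have B0 : 0 <= 2 * L * fine (lpnorm p F) by rewrite !mulr_ge0.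
have := hK b b1 p q p1 pq w _ _ B0 (tconv_samples p1 pq b0 qpsi pF L0 hL).
rewrite -/(translates b w _) => /le_trans; apply.
have q1 := conjugate_ge1 p1 pq; have qp := conjugateC pq.
have Kf := @conv_norm_fin R n p q (Dset b%:a) w q1 qp.
rewrite -(fineK Kf) -(fineK Ff) -!EFinM lee_fin le_eqVlt; apply/orP; left; apply/eqP.
by rewrite /=; ring.
Qed.

End convolution_samples.

(** Positivity of [c] is essential for an empty [S], whose infimum is +oo. *)
Lemma le_affine_ereal_inf (R : realType) (S : set (\bar R)) (X A : \bar R) (c : R) :
  A \is a fin_num -> 0 < c -> (forall e, S e -> (X <= A + c%:E * e)%E) ->
  (X <= A + c%:E * ereal_inf S)%E.
Proof.
move=> Af c0 h; rewrite addeC -leeBlDr// -lee_pdivrMl//.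
apply: le_ereal_inf_tmp => e Se.
by rewrite lee_pdivrMl// leeBlDr// addeC; exact: h.
Qed.

Section dilation_facts.
Context {R : realType} {n : nat}.
Local Notation C := R[i].
Implicit Types (mu : 'rV[int]_n) (j : nat).

Lemma dilb_ge1 mu j : (forall i, 1 < `|mu ord0 i|) ->
  forall i, 1 <= `|(dilb mu j i)%:~R : R|.
Proof. by move=> mu1 i; rewrite -intr_norm ler1z normrX exprn_ege1// ltW. Qed.

Lemma quasi_interp_translates mu j (g : 'cV[R]_n -> C) w : (forall i, mu ord0 i != 0) ->
  quasi_interp (dilation mu) j g (trig (Dset (fun i => (dilb mu j i)%:~R : R)) w) =
  translates (dilb mu j) w (fun k => g (gnode (fun i => (dilb mu j i)%:~R : R) k)).
Proof.
move=> mu0; apply/funext => x; rewrite quasi_interpE// /translates.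
congr (_^-1%:C * _).
by rewrite (@card_Dset_dilation R n mu j mu0) det_dilationX.
Qed.

End dilation_facts.

Theorem theorem4p2 (R : realType) (d : nat) (d_gt0 : (0 < d)%N)
  (mu : 'rV[int]_d) (mu_gt1 : forall i, 1 < `|mu ord0 i|)
  (v : 'cV[R]_d -> R[i]) (v_smooth : smooth v)
  (v_eq1 : forall x : 'cV[R]_d,
     (forall i, - (1 / 4) <= x i ord0 < 1 / 4) -> v x = 1)
  (v_eq0 : forall x : 'cV[R]_d,
     ~ (forall i, - (3 / 8) <= x i ord0 < 3 / 8) -> v x = 0)
  (p q : \bar R) (p_ge1 : (1 <= p)%E) (pq : (p^-1 + q^-1 = 1)%E)
  (s : nat) (s_gt0 : (0 < s)%N) (delta : R) (delta_itv : 0 < delta < 2^-1)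
  (tphi : nat -> ('cV[R]_d -> R[i]) -> R[i]) (phi : nat -> 'cV[R]_d -> R[i])
  (Gamma : nat -> 'cV[int]_d -> R[i]) :
  let M : 'M[R]_d := dilation mu in
  (forall j, (0 < j)%N -> periodic_distribution (tphi j)) ->
  (forall j, (0 < j)%N -> trig_poly (M ^+ j) (phi j)) ->
  (forall j, (0 < j)%N -> forall k, freq (delta *: M ^+ j) k ->
     fcoef (phi j) k * dcoef (tphi j) k =
     1 + (power_sum M j s k)%:C * Gamma j k) ->
  let lambda j k := Gamma j k * v (delta^-1 *: node M j k) in
  (forall j, (0 < j)%N -> multiplier p (lambda j)) ->
  (ereal_sup [set multiplier_norm p (lambda j) | j in [set j | (0 < j)%N]]
     < +oo)%E ->
  exists2 c : R, 0 < c &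
    (forall j, (0 < j)%N -> forall f g, Xp p f -> is_dconv (tphi j) f g ->
       (lpnorm p (fun x => f x - quasi_interp M j g (phi j) x)%R
        <= c%:E * (modulus s f (M ^+ j) p +
                   conv_norm q (phi j) *
                   one_sided_error ((delta / 2) *: M ^+ j) p g))%E) /\
    (forall j, (0 < j)%N -> forall psi, Lp q psi -> represents psi (tphi j) ->
       forall f, Xp p f ->
       (lpnorm p
          (fun x => f x - quasi_interp M j (tconv psi f) (phi j) x)%R
        <= c%:E * (1 + conv_norm q (phi j) * Lqj_norm M j q psi) *
           modulus s f (M ^+ j) p)%E).
Proof.
move=> M dist phiT hyp lambda mult multN.
have mu0 i : mu ord0 i != 0 by rewrite -normr_gt0 (lt_trans ltr01)// mu_gt1.
have q1 := conjugate_ge1 p_ge1 pq; have qp := conjugateC pq.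
(* The supremum is only known to differ from +oo; the maximum with 0 makes the bound a nonnegative
   real. *)
have [N N0 hN] : exists2 N : R, 0 <= N &
    forall j, (0 < j)%N -> (multiplier_norm p (lambda j) <= N%:E)%E.
  have ub j : (0 < j)%N -> (multiplier_norm p (lambda j) <=
      ereal_sup [set multiplier_norm p (lambda j) | j in [set j | (0 < j)%N]])%E.
    by move=> j0; apply: ereal_sup_ubound; exists j.
  move: multN ub; case: ereal_sup => [r|//|] _ ub.
    exists (Num.max 0 r); first by rewrite le_max lexx.
    by move=> j /ub /le_trans; apply; rewrite lee_fin le_max lexx orbT.
  by exists 0 => // j /ub /le_trans; apply; rewrite leNye.
have /andP[d0 d2] := delta_itv.
have [K1 K10 hK1] := quasi_interp_error v_smooth v_eq1 v_eq0 delta_itv s_gt0.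
have [K2 K20 hK2] := translates_one_sided v_smooth v_eq1 v_eq0 delta_itv.
have [K3 K30 hK3] := translates_tconv v_smooth v_eq1 v_eq0.
have [K4 K40 hK4] := approx_bound v_smooth v_eq1 v_eq0 s d0.
have N1 : 0 <= 1 + N by rewrite addr_ge0.
have c1 : 0 <= K1 * (1 + N) by rewrite mulr_ge0.
have c3 : 0 <= K3 * K4 by rewrite mulr_ge0.
pose c := K1 * (1 + N) + (K2 + K3 * K4 + 1).
have c0 : 0 < c by rewrite ltr_wpDl// ltr_wpDl// addr_ge0.
exists c => //.
pose a j : 'I_d -> R := fun i => (dilb mu j i)%:~R.
have b1 j : forall i, 1 <= `|a j i| by exact: dilb_ge1.
have a0 j i : a j i != 0 by rewrite -normr_gt0 (lt_le_trans ltr01)// b1.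
have hA j x : M ^+ j *m x = scale_cV (a j) x by exact: dilationX_mul.
have hphi j : (0 < j)%N -> exists w, phi j = trig (Dset (a j)) w.
  move=> j0; have := phiT j j0; rewrite -[M ^+ j]scale1r => ht.
  have [w ->] := trig_poly_dilation mu0 (oner_neq0 R) ht.
  by exists w; congr (trig (Dset _) _); apply/funext => i; rewrite mul1r.
(* The support of the cutoff lies in D(delta M^j) since 3/8 < 1/2, so the compatibility hypothesis
   is available there. *)
have wE j w : (0 < j)%N -> phi j = trig (Dset (a j)) w ->
    forall k, v (gnode (fun i => delta * a j i) k) != 0 ->
    w k * dcoef (tphi j) k = 1 + (hompoly s (gnode (a j) k))%:C * Gamma j k.
  move=> j0 phiE k vk.
  have kD : k \in Dset (a j) by exact: (cutoff_in_Dset v_eq0 delta_itv (b1 j) vk).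
  have := hyp j j0 k; rewrite phiE fcoef_trig kD => ->.
    by rewrite -(node_gnode j mu0).
  apply/(freq_dilation j mu0 k (lt0r_neq0 d0)) => i.
  have := v_supp v_eq0 i vk; rewrite ler_norml => /andP[k1 k2].
  by apply/andP; split; lra.
have lamE j : lambda j = fun k => Gamma j k * v (gnode (fun i => delta * a j i) k).
  by apply/funext => k; rewrite /lambda node_gnode// -gnodeZ.
have main j w f r : (0 < j)%N -> phi j = trig (Dset (a j)) w -> Lp p f ->
    (lpnorm p (fun x => f x - translates (dilb mu j) w r x)%R <=
     (K1 * (1 + N))%:E * modulus s f (M ^+ j) p +
     lpnorm p (translates (dilb mu j) w (fun k => r k -
       trig (freqbox (fun i => delta * a j i) (3 / 8))
         (fun l => v (gnode (fun i => delta * a j i) l) * (dcoef (tphi j) l * fcoef f l))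
         (gnode (a j) k))%R))%E.
  move=> j0 phiE fp; apply: hK1 (b1 j) (hA j) _ _ _ _ _ _ _ p_ge1 fp N0 _ _ (wE j w j0 phiE).
    by rewrite -lamE; exact: mult.
  by rewrite -lamE; exact: hN.
have r38 : 0 <= 3 / 8 :> R by lra.
have Gr := nice_supp (v_nice v_smooth v_eq0 0).
have da0 j i : delta * a j i != 0 by rewrite mulf_neq0// gt_eqF.
have Om0 f j := @modulus_ge0 R d s f (M ^+ j) p.
(* At k = 0 the polynomial vanishes and the compatibility condition reads w 0 * dcoef = 1, so the
   mean of phi_j is nonzero. *)
have kap_gt0 j w : (0 < j)%N -> phi j = trig (Dset (a j)) w ->
    (0 < conv_norm q (trig (Dset (a j)) w))%E.
  move=> j0 phiE; apply: (conv_norm_gt0 q1 qp).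
    by rewrite in_Dset// gnode0; apply/asboolP => i; rewrite mxE; apply/andP; split; lra.
  have := wE j w j0 phiE 0; rewrite !gnode0 hompoly0// mul0r addr0.
  rewrite v_one// => [|i]; last by rewrite mxE normr0; lra.
  rewrite oner_eq0 => /(_ isT) h; apply: contra_eq_neq h => ->.
  by rewrite mul0r eq_sym oner_eq0.
split=> j j0.
  move=> f g Xf [[pg mg [B gB]] gc]; have fp := Xp_Lp p_ge1 Xf.
  have [w phiE] := hphi j j0; rewrite phiE quasi_interp_translates//.
  have gi : cintegrable g by exact: cintegrable_bounded gB.
  apply: le_trans (main j w f _ j0 phiE fp) _.
  set X := lpnorm p _.
  have kf := @conv_norm_fin R d p q (Dset (a j)) w q1 qp.
  have k0 := kap_gt0 j w j0 phiE.
  set kap := conv_norm q _ in kf k0 *.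
  have kr : 0 < fine kap by rewrite fine_gt0// k0 ltey_eq kf.
  set Y := one_sided_error _ _ _.
  have Y0 : (0 <= Y)%E.
    by apply: le_ereal_inf_tmp => _ [t [T [_ _ _ _ ->]]]; exact: lpnorm_ge0.
  (* K2 may be 0; adding 1 gives the positive coefficient needed to pass to the infimum over all
     pairs t, T. *)
  have XY : (X <= 0 + ((K2 + 1) * fine kap)%:E * Y)%E.
    apply: le_affine_ereal_inf => //; first by rewrite mulr_gt0// ltr_wpDl.
    move=> e [t [T [ht hT _ tgT ->]]]; rewrite add0e EFinM fineK//.
    have dn : delta / 2 != 0 by rewrite mulf_neq0 ?gt_eqF// invr_eq0 pnatr_eq0.
    have [wt tE] := trig_poly_dilation mu0 dn ht.
    have [wT TE] := trig_poly_dilation mu0 dn hT.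
    rewrite tE TE in tgT *.
    apply: (@le_trans _ _ (K2%:E * kap * lpnorm p (fun x => trig (Dset (fun i => delta / 2 * a j i)) wt x -
        trig (Dset (fun i => delta / 2 * a j i)) wT x)%R)%E).
      rewrite /X.
      have := hK2 (dilb mu j) (b1 j) p q p_ge1 pq w g wt wT pg gi tgT.
      rewrite (conv_opE r38 (da0 j) Gr pg gi).
      rewrite (_ : (fun l => v (gnode _ l) * fcoef g l) =
        (fun l => v (gnode (fun i => delta * a j i) l) * (dcoef (tphi j) l * fcoef f l)))//.
      by apply/funext => l; rewrite gc.
    apply: lee_wpmul2r; first exact: lpnorm_ge0.
    by apply: lee_wpmul2r; [exact: ltW|rewrite lee_fin lerDl].
  rewrite add0e EFinM fineK// -muleA in XY.
  apply: le_trans (leeD (lexx _) XY) _.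
  have kY : (0 <= kap * Y)%E by rewrite mule_ge0// ltW.
  rewrite ge0_muleDr//; apply: leeD; apply: lee_wpmul2r => //; rewrite lee_fin /c.
    by rewrite lerDl !addr_ge0.
  by rewrite (le_trans _ (lerD c1 (lexx _)))// add0r -addrA lerD2l lerDr.
move=> psi qpsi rep f Xf; have fp := Xp_Lp p_ge1 Xf.
have [w phiE] := hphi j j0; rewrite phiE quasi_interp_translates//.
have fi := Lp_cintegrable p_ge1 fp; have [pf _ _] := fp.
have psii := Lp_cintegrable q1 qpsi; have [ppsi mpsi _] := qpsi.
have dcE k : dcoef (tphi j) k = fcoef psi k.
  rewrite /dcoef rep; last exact: test_function_expk.
  by congr Cint; apply/funext => x; rewrite mulrC.
pose Vf := conv_op (fun i => delta * a j i) v f.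
have VfE : Vf = trig (freqbox (fun i => delta * a j i) (3 / 8))
    (fun l => v (gnode (fun i => delta * a j i) l) * fcoef f l).
  exact: conv_opE r38 (da0 j) Gr pf fi.
have Vfp : Lp p Vf by rewrite VfE; exact: Lp_trig.
pose F x := f x - Vf x.
have Fp : Lp p F by exact: LpB.
have FO : (lpnorm p F <= K4%:E * modulus s f (M ^+ j) p)%E.
  exact: hK4 (b1 j) (hA j) p f p_ge1 fp.
apply: le_trans (main j w f _ j0 phiE fp) _.
(* At the nodes the deviation g - V g is tphi_j convolved with f - V f, because convolution commutes
   with the cutoff. *)
rewrite (_ : (fun k => _) = (fun k => tconv psi F (gnode (a j) k))); last first.
  apply/funext => k; rewrite -(tconvB _ p_ge1 pq qpsi fp Vfp) VfE tconv_trig//.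
  congr (_ - trig _ _ _); apply/funext => l.
  by rewrite dcE; ring.
have kf := @conv_norm_fin R d p q (Dset (a j)) w q1 qp.
have k0 := kap_gt0 j w j0 phiE.
set kap := conv_norm q _ in kf k0 *.
set Om := modulus _ _ _ _ in FO *; have {}Om0 : (0 <= Om)%E by exact: Om0.
have LL := @Lnorm_node_mean_le R d mu j q psi mu0 q1 ppsi mpsi.
have L0 : (0 <= Lqj_norm M j q psi)%E by apply: le_trans LL; exact: Lnorm_ge0.
set L := Lqj_norm _ _ _ _ in LL L0 *.
have k1 : (0 <= 1 + kap * L)%E by rewrite adde_ge0// mule_ge0// ltW.
have cK : (K1 * (1 + N) <= c)%R by rewrite /c lerDl !addr_ge0.
(* With a zero modulus the right side is 0 even if [L] is infinite, so the deviation has to vanish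
   exactly. *)
have [z0|zn0] := eqVneq Om 0%E.
  have F0 : lpnorm p F = 0%E.
    by apply/eqP; rewrite eq_le lpnorm_ge0 andbT; rewrite z0 mule0 in FO.
  rewrite z0 !mule0 add0e.
  rewrite (_ : translates _ _ _ = fun=> 0) ?lpnorm0//.
  apply/funext => x; rewrite /translates big1 ?mulr0// => k _.
  by rewrite (tconv_null _ p_ge1 pq qpsi Fp F0) mul0r.
have Op : (0 < Om)%E by rewrite lt_neqAle eq_sym zn0.
(* With a positive modulus and positive [kap], an infinite [L] makes the right side +oo. *)
have [Ly|Lf] := eqVneq L +oo%E.
  by rewrite Ly gt0_muley// addey// gt0_muley ?lte_fin// gt0_mulye// leey.
have Lfin : L \is a fin_num by rewrite ge0_fin_numE// lt_neqAle Lf leey.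
have LL' : (Lnorm torus q (fun x => (node_mean (dilb mu j) psi x)%:E) <= (fine L)%:E)%E.
  by rewrite fineK.
have Lr : 0 <= fine L by rewrite fine_ge0.
have := hK3 (dilb mu j) (b1 j) p q p_ge1 pq w psi F (fine L) qpsi Fp Lr LL'.
rewrite -/kap fineK// => h3.
apply: le_trans (leeD (lexx _) (le_trans h3 (lee_wpmul2l _ FO))) _.
  by rewrite mule_ge0// ?lee_fin// mule_ge0// ltW.
rewrite -/kap -(fineK kf) -(fineK Lfin).
have kr : 0 <= fine kap by rewrite fine_ge0// ltW.
have kL : 0 <= fine kap * fine L by rewrite mulr_ge0.
rewrite [X in (_ + X <= _)%E](_ : _ = (K3 * K4 * (fine kap * fine L))%:E * Om)%E; last first.
  by rewrite muleA -!EFinM; congr (_%:E * _)%E; rewrite mulrAC.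
rewrite [X in (_ <= X * _)%E](_ : _ = (c * (1 + fine kap * fine L))%:E)//.
rewrite -ge0_muleDl ?lee_fin//; last exact: mulr_ge0.
apply: lee_wpmul2r => //; rewrite -EFinD lee_fin [leRHS]mulrDr mulr1; apply: lerD => //.
by apply: ler_wpM2r => //; rewrite /c; lra.
Qed.
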